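(* Let $\alpha\in(0,1)$ and $n\ge2$. There exists a constant $c_{n,\alpha}>0$ such that $$|E|^{\frac{n-\alpha}{n}}\le c_{n,\alpha}\,|D^\alpha\chi_E|(\mathbb R^n)$$ for every measurable set $E\subset\mathbb R^n$ such that $|E|<+\infty$ and $|D^\alpha\chi_E|(\mathbb R^n)<+\infty$.
   Context: $|E|$ denotes Lebesgue measure. For $\alpha\in(0,1)$ let $\mu_{n,\alpha}:=2^\alpha\pi^{-n/2}\,\Gamma\big(\tfrac{n+\alpha+1}{2}\big)/\Gamma\big(\tfrac{1-\alpha}{2}\big)$. For $\varphi\in C^\infty_c(\mathbb R^n;\mathbb R^n)$ the fractional $\alpha$-divergence is $$\mathrm{div}^\alpha\varphi(x):=\mu_{n,\alpha}\int_{\mathbb R^n}\frac{(y-x)\cdot(\varphi(y)-\varphi(x))}{|y-x|^{n+\alpha+1}}\,dy,$$ which is a function in $L^1(\mathbb R^n)\cap L^\infty(\mathbb R^n)$. For a measurable set $E\subset\mathbb R^n$, the fractional Caccioppoli $\alpha$-perimeter of $E$ in $\mathbb R^n$ is $$|D^\alpha\chi_E|(\mathbb R^n):=\sup\Big\{\int_E\mathrm{div}^\alpha\varphi\,dx:\ \varphi\in C^\infty_c(\mathbb R^n;\mathbb R^n),\ \|\varphi\|_{L^\infty(\mathbb R^n;\mathbb R^n)}\le1\Big\}.$$ *)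

(* Defs.v *)
From HB Require Import structures.
From mathcomp Require Import all_boot all_order all_algebra.
From mathcomp Require Import all_classical all_reals all_analysis.

Set Implicit Arguments.
Unset Strict Implicit.
Unset Printing Implicit Defensive.
Import Order.TTheory GRing.Theory Num.Theory.
Import numFieldNormedType.Exports.
Local Open Scope classical_set_scope.
Local Open Scope ring_scope.

Section euclidean.
Context {R : realType} {n : nat}.
Implicit Types x y : 'rV[R]_n.

Definition dot x y : R := \sum_i x 0 i * y 0 i.

(* The norm `|x| of the library on row vectors is the sup norm. *)
Definition enorm x : R := Num.sqrt (dot x x).

End euclidean.

Section lebesgue_outer_measure.
Context {R : realType} {n : nat}.
Local Notation V := 'rV[R]_n.

Definition box (B : V * V) : set V :=
  [set x | forall i, B.1 0 i <= x 0 i < B.2 0 i].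

Definition box_volume (B : V * V) : R := \prod_i Num.max 0 (B.2 0 i - B.1 0 i).

(* Covers are indexed by arbitrary sets of integers: in dimension 0 every box
   has volume 1, and the empty set has to be covered by the empty family. *)
Definition lebesgue_outer (E : set V) : \bar R :=
  ereal_inf [set \esum_(k in DB.1) (box_volume (DB.2 k))%:E |
    DB in [set DB : set nat * (nat -> V * V) |
           E `<=` \bigcup_(k in DB.1) box (DB.2 k)]].

Local Open Scope ereal_scope.

Let vol_ge0 B : 0 <= (box_volume B)%:E.
Proof. by rewrite lee_fin; apply: prodr_ge0 => i _; rewrite le_max lexx. Qed.

Let lebesgue_outer_ge0 E : 0 <= lebesgue_outer E.
Proof.
by apply: le_ereal_inf_tmp => _ [DB _ <-]; apply: esum_ge0 => k _; exact: vol_ge0.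
Qed.

Let lebesgue_outer0 : lebesgue_outer set0 = 0.
Proof.
apply/eqP; rewrite eq_le lebesgue_outer_ge0 andbT.
apply: ereal_inf_lbound; exists (set0, fun=> (0%R, 0%R)) => //=.
by rewrite esum_set0.
Qed.

Let le_lebesgue_outer : {homo lebesgue_outer : A B / A `<=` B >-> A <= B}.
Proof.
move=> A B AB; apply: ereal_inf_le_tmp => _ [DB BDB <-].
by exists DB => //; exact: subset_trans BDB.
Qed.

Let lebesgue_outer_sigma_subadditive : sigma_subadditive lebesgue_outer.
Proof.
move=> A; have [[i ioo]|] := pselect (exists i, lebesgue_outer (A i) = +oo).
  rewrite (eseries_pinfty _ _ ioo) ?leey// => k _.
  by rewrite -ltNye (lt_le_trans _ (lebesgue_outer_ge0 _)).
rewrite -forallNE => Aoo.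
apply/lee_addgt0Pr => e e0.
rewrite (le_trans _ (epsilon_trick _ _ (ltW e0)))//.
pose P k (DB : set nat * (nat -> V * V)) :=
  A k `<=` \bigcup_(j in DB.1) box (DB.2 j) /\
  \esum_(j in DB.1) (box_volume (DB.2 j))%:E
    <= lebesgue_outer (A k) + (e / (2 ^ k.+1)%:R)%:E.
have [G PG] : {G : nat -> set nat * (nat -> V * V) & forall k, P k (G k)}.
  apply: (@choice _ _ P) => k.
  have fink : lebesgue_outer (A k) \is a fin_num.
    by rewrite ge0_fin_numE// ltey; exact/eqP/Aoo.
  have ek : (0 < e / (2 ^ k.+1)%:R)%R by rewrite divr_gt0// ltr0n expn_gt0.
  have [_ [DB cDB <-] /ltW DBle] := lb_ereal_inf_adherent ek fink.
  by exists DB.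
have /card_esym/ppcard_eqP[f] := card_nat2.
pose K := [set: nat] `*`` (fun k => (G k).1).
pose D := f @^-1` K.
pose B k := (G (f k).1).2 (f k).2.
apply: (@le_trans _ _ (\esum_(k in D) (box_volume (B k))%:E)).
  apply: ereal_inf_lbound; exists (D, B) => //= x [k _ /(PG k).1[j Dj xj]].
  by exists (f^-1%FUN (k, j)); rewrite /D /B /K/= invK ?inE.
pose vol p := (box_volume ((G p.1).2 p.2))%:E.
have Kf : set_bij D K f.
  split => [k //|k l _ _|p Kp]; first by apply: 'inj_f; rewrite inE.
  by exists (f^-1%FUN p); rewrite /D/= invK ?inE.
rewrite -(reindex_esum D K f vol Kf) /K.
rewrite -(esum_esum (a := fun k j => vol (k, j))); last first.
  by move=> k j _ _; exact: vol_ge0.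
rewrite nneseries_esumT; last first.
  by move=> k; rewrite adde_ge0// lee_fin divr_ge0// ltW.
by apply: le_esum => k _; exact: (PG k).2.
Qed.

HB.instance Definition _ := isOuterMeasure.Build R V lebesgue_outer
  lebesgue_outer0 lebesgue_outer_ge0 le_lebesgue_outer
  lebesgue_outer_sigma_subadditive.

(* R^n with the sigma-algebra of Lebesgue-measurable (not only Borel) sets. *)
Definition lebesgue_space := caratheodory_type lebesgue_outer.

HB.instance Definition _ := Measurable.on lebesgue_space.

Definition leb : set lebesgue_space -> \bar R := lebesgue_outer.

HB.instance Definition _ := isMeasure.Build _ lebesgue_space R leb
  (outer_measure0 _) (outer_measure_ge0 _)
  (@caratheodory_measure_sigma_additive R _ lebesgue_outer).

End lebesgue_outer_measure.

Arguments lebesgue_space : clear implicits.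

Section test_fields.
Context {R : realType} {n : nat}.
Local Notation V := 'rV[R]_n.

Fixpoint Ck (k : nat) (f : V -> V) : Prop :=
  continuous f /\
  if k is k'.+1 then
    forall i, (forall x, derivable f x (delta_mx 0 i)) /\
              Ck k' (fun x => 'D_(delta_mx 0 i) f x)
  else True.

Definition smooth (f : V -> V) : Prop := forall k, Ck k f.

Definition compactly_supported (f : V -> V) : Prop :=
  compact (closure [set x | f x != 0]).

Definition test_field (phi : V -> V) : Prop :=
  [/\ smooth phi, compactly_supported phi &
      ('N[@leb R n]_+oo [EFin \o (enorm \o phi)] <= 1)%E].

End test_fields.

Section fractional_perimeter.
Context {R : realType}.

(* Only meaningful for s > 0. *)
Definition Gamma (s : R) : R :=
  \int[lebesgue_measure]_(t in `]0%R, +oo[) (t `^ (s - 1) * expR (- t)).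

Definition frac_const (n : nat) (alpha : R) : R :=
  2 `^ alpha * pi `^ (- (n%:R / 2)) *
  Gamma ((n%:R + alpha + 1) / 2) / Gamma ((1 - alpha) / 2).

Context {n : nat}.
Local Notation V := 'rV[R]_n.

Definition frac_div (alpha : R) (phi : V -> V) (x : V) : R :=
  frac_const n alpha *
  \int[@leb R n]_y
    (dot (y - x) (phi y - phi x) / enorm (y - x) `^ (n%:R + alpha + 1)).

Definition frac_perimeter (alpha : R) (E : set (lebesgue_space R n)) : \bar R :=
  ereal_sup [set (\int[@leb R n]_(x in E) (frac_div alpha phi x)%:E)%E |
             phi in test_field].

End fractional_perimeter.

(* Main.v *)
(** The inequality follows from testing the perimeter of E with one explicit field.
Cut E into small pieces with masses w_i and centres z_i, and put
  phi(x) = sum_i w_i sum_j r_j^(alpha-1-n) k_(r_j)(x - z_i),  k_r(u) = u exp(-|u|^2/r^2),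
over the dyadic scales r_j = R/2^(j+1), from R, comparable to |E|^(1/n), down to the size
of the pieces.  Since r^(-n) sum_i w_i exp(-|x-z_i|^2/r^2) is bounded by a dimensional
constant, |phi| <= C sum_j r_j^alpha <= C R^alpha.  Conversely, with
T_r = r^(-n) sum_(p,q) w_p w_q exp(-|z_p-z_q|^2/r^2), positive definiteness of the Gaussian
gives r^(alpha-1-n) sum_(p,q) w_p w_q (div^alpha k_r)(z_p - z_q) >= c (T_r - T_(2r)).
The sum over the scales telescopes to c (T_eps - T_R), where T_eps >= c0 |E| by
Cauchy-Schwarz because the eps-neighbourhood of most of E has measure at most 3 |E|, while
T_R <= R^(-n) |E|^2 is at most half of that for a suitable R.  Hence the integral of
div^alpha phi over E is at least c |E|, and |E| <= C R^alpha P(E).  The Gaussian tails of k_r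
are cut off smoothly, and continuity of div^alpha k_r replaces the double sum by the integral over E. *)

(* Summed over all dyadic scales, the kernels r_j^(alpha-1-n) k_(r_j)(u) are comparable to u
   |u|^(alpha-1-n), which up to a negative factor is the gradient of the Riesz kernel
   |u|^(1+alpha-n). So phi imitates -grad I_(1+alpha) chi_E, the field whose div^alpha is a multiple
   of chi_E itself; this explains both the weights and an energy linear in |E|. Dyadic Gaussians
   make the positivity of the energy a matter of positive definite sums, and completing the square
   reduces every Gaussian integral to one constant, [gauss_mass]. The pieces turn double integrals
   over E x E into finite sums, which commute with integrals by linearity alone. The delicate point
   is that div^alpha is nonlocal, so a cutoff of the field changes it everywhere. The change is
   controlled by interpolation: a field that is uniformly small and has a Lipschitz bound
   independent of the cutoff has a uniformly small div^alpha. *)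
Require Import Defs.
From mathcomp Require Import all_boot all_order all_algebra.
From mathcomp Require Import all_classical all_reals all_analysis.
From mathcomp Require Import measurable_realfun ring lra.
Set Implicit Arguments.
Unset Strict Implicit.
Unset Printing Implicit Defensive.
Import Order.TTheory GRing.Theory Num.Theory.
Import numFieldNormedType.Exports.
Local Open Scope classical_set_scope.
Local Open Scope ring_scope.

(** * Euclidean norm *)

Section euclidean_norm.
Context {R : realType} {n : nat}.
Local Notation V := 'rV[R]_n.
Implicit Types (x y z : V) (a : R).

Lemma dotC x y : dot x y = dot y x.
Proof. by apply: eq_bigr => i _; rewrite mulrC. Qed.

Lemma dotDr x y z : dot x (y + z) = dot x y + dot x z.
Proof. by rewrite -big_split; apply: eq_bigr => i _; rewrite mxE mulrDr. Qed.

Lemma dotZr a x y : dot x (a *: y) = a * dot x y.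
Proof. by rewrite mulr_sumr; apply: eq_bigr => i _; rewrite mxE mulrCA. Qed.

Lemma dotNr x y : dot x (- y) = - dot x y.
Proof. by rewrite -scaleN1r dotZr mulN1r. Qed.

Lemma dotBr x y z : dot x (y - z) = dot x y - dot x z.
Proof. by rewrite dotDr dotNr. Qed.

Lemma dotDl x y z : dot (x + y) z = dot x z + dot y z.
Proof. by rewrite dotC dotDr !(dotC z). Qed.

Lemma dotZl a x y : dot (a *: x) y = a * dot x y.
Proof. by rewrite dotC dotZr dotC. Qed.

Lemma dotNl x y : dot (- x) y = - dot x y.
Proof. by rewrite dotC dotNr dotC. Qed.

Lemma dotBl x y z : dot (x - y) z = dot x z - dot y z.
Proof. by rewrite dotDl dotNl. Qed.

Lemma dot0r x : dot x 0 = 0.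
Proof. by rewrite -(scale0r 0) dotZr mul0r. Qed.

Lemma dot0l x : dot 0 x = 0.
Proof. by rewrite dotC dot0r. Qed.

Lemma dot_ge0 x : 0 <= dot x x.
Proof. by apply: sumr_ge0 => i _; rewrite -expr2 sqr_ge0. Qed.

Lemma enorm_ge0 x : 0 <= enorm x.
Proof. exact: sqrtr_ge0. Qed.

Lemma sqr_enorm x : enorm x ^+ 2 = dot x x.
Proof. by rewrite sqr_sqrtr ?dot_ge0. Qed.

Lemma enorm0 : enorm (0 : V) = 0.
Proof. by rewrite /enorm dot0r sqrtr0. Qed.

Lemma enormZ a x : enorm (a *: x) = `|a| * enorm x.
Proof.
by rewrite /enorm dotZl dotZr mulrA -expr2 sqrtrM ?sqr_ge0 // sqrtr_sqr.
Qed.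

Lemma enormN x : enorm (- x) = enorm x.
Proof. by rewrite -scaleN1r enormZ normrN1 mul1r. Qed.

Lemma enormB x y : enorm (x - y) = enorm (y - x).
Proof. by rewrite -enormN opprB. Qed.

Lemma coord_le_enorm x i : `|x 0 i| <= enorm x.
Proof.
rewrite -(@ler_pXn2r _ 2) ?nnegrE ?enorm_ge0 // sqr_enorm real_normK ?num_real //.
rewrite /dot (bigD1 i) //= -expr2 lerDl.
by apply: sumr_ge0 => j _; rewrite -expr2 sqr_ge0.
Qed.

Lemma enorm_eq0 x : (enorm x == 0) = (x == 0).
Proof.
apply/eqP/eqP => [x0|->]; last exact: enorm0.
apply/rowP => i; rewrite mxE; apply/normr0_eq0/le_anti.
by rewrite normr_ge0 -x0 coord_le_enorm.
Qed.

Lemma enorm_gt0 x : (0 < enorm x) = (x != 0).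
Proof. by rewrite lt_def enorm_ge0 enorm_eq0 andbT. Qed.

Lemma cauchy_schwarz x y : `|dot x y| <= enorm x * enorm y.
Proof.
have [->|x0] := eqVneq x 0; first by rewrite dot0l normr0 enorm0 mul0r.
rewrite -(@ler_pXn2r _ 2) ?nnegrE ?mulr_ge0 ?enorm_ge0 //.
rewrite exprMn !sqr_enorm real_normK ?num_real //.
have xx : 0 < dot x x by rewrite -sqr_enorm exprn_gt0 // enorm_gt0.
(* This vector is x.x times the component of y orthogonal to x; its square is x.x times the Gram
   determinant. *)
have := dot_ge0 (dot x x *: y - dot x y *: x).
rewrite dotBl !dotBr !dotZl !dotZr (dotC y x) => h.
have : 0 <= dot x x * (dot x x * dot y y - dot x y ^+ 2).
  by apply: le_trans h _; rewrite le_eqVlt; apply/orP; left; apply/eqP; ring.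
by rewrite pmulr_rge0 // subr_ge0.
Qed.

Lemma dot_le_enorm x y : dot x y <= enorm x * enorm y.
Proof. exact: le_trans (ler_norm _) (cauchy_schwarz x y). Qed.

Lemma enormD x y : enorm (x + y) <= enorm x + enorm y.
Proof.
rewrite -(@ler_pXn2r _ 2) ?nnegrE ?addr_ge0 ?enorm_ge0 //.
rewrite sqr_enorm dotDl !dotDr (dotC y x) sqrrD !sqr_enorm.
have := dot_le_enorm x y; lra.
Qed.

Lemma enorm_sum I (s : seq I) (P : pred I) (F : I -> V) :
  enorm (\sum_(i <- s | P i) F i) <= \sum_(i <- s | P i) enorm (F i).
Proof.
elim/big_rec2: _ => [|i u v _ h]; first by rewrite enorm0.
by apply: le_trans (enormD _ _) _; rewrite lerD2l.
Qed.

Lemma enorm_le_sum x : enorm x <= \sum_i `|x 0 i|.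
Proof.
have S0 : 0 <= \sum_i `|x 0 i| by apply: sumr_ge0 => i _.
rewrite -(@ler_pXn2r _ 2) ?nnegrE ?enorm_ge0 // sqr_enorm.
rewrite expr2 mulr_suml; apply: ler_sum => i _.
rewrite (le_trans (ler_norm _))// normrM ler_wpM2l // (bigD1 i) //= lerDl.
exact: sumr_ge0.
Qed.

(** The topology of row vectors is that of the sup norm; this bound and [enorm_le_norm] translate
    between it and Euclidean estimates. *)
Lemma norm_le_enorm x : `|x| <= enorm x.
Proof.
rewrite [leLHS]/Num.norm/= mx_normrE; apply/bigmax_leP; split => [|[i j] _].
  exact: enorm_ge0.
by rewrite ord1 coord_le_enorm.
Qed.

Lemma coord_le_norm x i : `|x 0 i| <= `|x|.
Proof.
rewrite [leRHS]/Num.norm/= mx_normrE.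
exact: (le_bigmax_cond _ (fun ij => `|x ij.1 ij.2|) (j := (0, i))).
Qed.

Lemma enorm_le_norm x : enorm x <= n%:R * `|x|.
Proof.
apply: le_trans (enorm_le_sum x) _.
rewrite -[X in X%:R]card_ord -sumr_const mulr_suml.
by apply: ler_sum => i _; rewrite mul1r coord_le_norm.
Qed.

Lemma coord_cts i : continuous (fun x : V => x 0 i).
Proof. exact: coord_continuous. Qed.

Lemma sum_cts (T : topologicalType) (W : normedModType R) I (s : seq I)
    (f : I -> T -> W) :
  (forall i, continuous (f i)) -> continuous (fun t => \sum_(i <- s) f i t).
Proof.
move=> cf; elim: s => [|i s IH] t.
  by under eq_fun do rewrite big_nil; exact: cvg_cst.
rewrite (_ : (fun _ => _) = fun t => f i t + \sum_(j <- s) f j t).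
  by apply: cvgD; [exact: cf|exact: IH].
by apply/funext => u; rewrite big_cons.
Qed.

Lemma dot_cts (T : topologicalType) (f g : T -> V) :
  continuous f -> continuous g -> continuous (fun t => dot (f t) (g t)).
Proof.
move=> cf cg t.
apply: (@sum_cts T R^o _ _ (fun i t => f t 0 i * g t 0 i)) => i {}t.
apply: cvgM.
- exact: (continuous_comp (cf t) (@coord_cts i _)).
- exact: (continuous_comp (cg t) (@coord_cts i _)).
Qed.

Lemma enorm_cts : continuous (@enorm R n).
Proof.
move=> x; apply: (@continuous_comp _ _ _ (fun x => dot x x) Num.sqrt).
  by apply: (@dot_cts V id id) => t; exact: cvg_id.
exact: sqrt_continuous.
Qed.

End euclidean_norm.

(** * Lebesgue measure and affine maps *)

Section lebesgue_affine.
Context {R : realType} {n : nat}.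
Local Notation V := 'rV[R]_n.
Implicit Types (x c : V) (a : R) (A : set V).

Lemma box_volume_ge0 (B : V * V) : 0 <= box_volume B.
Proof. by apply: prodr_ge0 => i _; rewrite le_max lexx. Qed.

Lemma lebesgue_outer_box_le (B : V * V) :
  (lebesgue_outer (box B) <= (box_volume B)%:E)%E.
Proof.
apply: ereal_inf_lbound; exists ([set 0%N], fun=> B) => /=.
  by move=> x Bx; exists 0%N.
by rewrite esum_set1 // lee_fin box_volume_ge0.
Qed.

Lemma esumZl (D : set nat) (u : nat -> \bar R) a : 0 <= a ->
  (forall k, 0 <= u k)%E ->
  (\esum_(k in D) (a%:E * u k) = a%:E * \esum_(k in D) u k)%E.
Proof.
move=> a0 u0; rewrite [LHS]esum_mkcond [X in (_ * X)%E]esum_mkcond.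
rewrite -!nneseries_esumT => [||k]; last first.
- by case: ifP => // _; rewrite mule_ge0.
- by move=> k; case: ifP.
rewrite -nneseriesZl => [|k _]; last by case: ifP.
by apply: eq_eseriesr => k _; case: ifP; rewrite ?mule0.
Qed.

Definition affine a c x : V := a *: x + c.

(** The map carries a box to a box of volume [a ^+ n] times larger, so covers of the preimage become
    covers of A. *)
Lemma lebesgue_outer_affine_le a c A : 0 < a ->
  (lebesgue_outer A <= (a ^+ n)%:E * lebesgue_outer (affine a c @^-1` A))%E.
Proof.
move=> a0; have an0 : 0 < a ^+ n by rewrite exprn_gt0.
rewrite muleC -lee_pdivrMr //; apply: le_ereal_inf_tmp => _ [[D B] /= cB <-].
rewrite lee_pdivrMr // muleC -(esumZl _ (ltW an0)); last first.
  by move=> k; rewrite lee_fin box_volume_ge0.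
apply: ereal_inf_lbound.
exists (D, fun k => (affine a c (B k).1, affine a c (B k).2)) => /=.
  move=> x Ax.
  have : (affine a c @^-1` A) (a^-1 *: (x - c)).
    by rewrite /= /affine scalerA divff ?gt_eqF // scale1r subrK.
  move=> /cB [k Dk Bk]; exists k => // i.
  have := Bk i; rewrite !mxE -[x 0 i](subrK (c 0 i)).
  rewrite lerD2r ltrD2r addrK.
  by rewrite ler_pdivlMl // ltr_pdivrMl.
apply: eq_esum => k _; rewrite -EFinM; congr EFin; rewrite /box_volume /=.
rewrite -[X in a ^+ X]card_ord -prodr_const -big_split /=; apply: eq_bigr => i _.
rewrite maxr_pMr ?(ltW a0)// mulr0 /affine !mxE.
by congr Num.max; ring.
Qed.

Lemma affineK a c x : a != 0 ->
  affine a c (affine a^-1 (- (a^-1 *: c)) x) = x.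
Proof.
by move=> a0; rewrite /affine scalerDr scalerN !scalerA divff // !scale1r subrK.
Qed.

Lemma lebesgue_outer_affine a c A : 0 < a ->
  (lebesgue_outer (affine a c @^-1` A) = (a^-1 ^+ n)%:E * lebesgue_outer A)%E.
Proof.
move=> a0; have an0 : 0 < a ^+ n by rewrite exprn_gt0.
apply/eqP; rewrite eq_le; apply/andP; split.
  (* The previous lemma for the inverse map: pulling the preimage back along it gives A again. *)
  apply: (le_trans (@lebesgue_outer_affine_le a^-1 (- (a^-1 *: c)) _ _)).
    by rewrite invr_gt0.
  rewrite le_eqVlt; apply/orP; left; apply/eqP; congr (_ * lebesgue_outer _)%E.
  by apply/funext => x; rewrite /preimage/= affineK // gt_eqF.
rewrite muleC exprVn lee_pdivrMr // muleC; exact: lebesgue_outer_affine_le.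
Qed.

Lemma measurable_caratheodory (A : set (lebesgue_space R n)) :
  measurable A = caratheodory_measurable lebesgue_outer A.
Proof. by []. Qed.

(** In the Caratheodory criterion every test set X is the preimage of some X'; the three outer
    measures for X are then those for X' times one common factor. *)
Lemma measurable_affine a c : 0 < a ->
  measurable_fun [set: lebesgue_space R n] (affine a c : lebesgue_space R n -> lebesgue_space R n).
Proof.
move=> a0 _ A mA; rewrite setTI measurable_caratheodory => X.
have an0 : 0 < a ^+ n by rewrite exprn_gt0.
pose X' := affine a^-1 (- (a^-1 *: c)) @^-1` X.
have XE : X = affine a c @^-1` X'.
  apply/funext => x; rewrite /X' /preimage /=; congr X.
  rewrite /affine scalerDr scalerA mulVf ?gt_eqF // scale1r.
  by rewrite addrK.
rewrite {}XE; clearbody X'.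
have := lebesgue_outer_affine c X' a0.
have := lebesgue_outer_affine c (X' `&` A) a0.
have := lebesgue_outer_affine c (X' `&` ~` A) a0.
rewrite preimage_setI preimage_setI -preimage_setC => -> -> ->.
by rewrite (mA X') ge0_muleDr ?outer_measure_ge0.
Qed.

End lebesgue_affine.

(** * Measurability of boxes, open sets and continuous functions *)

Section lebesgue_measurable.
Context {R : realType} {n : nat}.
Local Notation V := 'rV[R]_n.
Local Notation L := (lebesgue_space R n).
Local Notation mu := (@leb R n).
Implicit Types (x c : V) (a : R) (A : set V).

(** The hyperplane x_i = t cuts each box of a cover of X into two boxes whose volumes add up
    exactly, which splits the cover into one for each side. Clipping the corners with [min] and
    [max] also covers boxes that the hyperplane misses: one half then has volume 0. *)
Lemma measurable_halfspace (i : 'I_n) (t : R) :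
  measurable ([set x : V | x 0 i < t] : set L).
Proof.
set H := [set x | _]; rewrite measurable_caratheodory.
apply: le_caratheodory_measurable => X.
apply: le_ereal_inf_tmp => _ [[D B] /= cB <-].
pose up (u : V) := \row_j (if j == i then Num.min t (u 0 j) else u 0 j).
pose lo (u : V) := \row_j (if j == i then Num.max t (u 0 j) else u 0 j).
have volE k : box_volume (B k) =
    box_volume ((B k).1, up (B k).2) + box_volume (lo (B k).1, (B k).2).
  rewrite /box_volume (bigD1 i) //= [X in _ = X + _](bigD1 i) //=.
  rewrite [X in _ = _ + X](bigD1 i) //= !mxE eqxx.
  set p := \prod_(j < n | _) _.
  have -> : \prod_(j < n | j != i) Num.max 0 (up (B k).2 0 j - (B k).1 0 j) = p.
    by apply: eq_bigr => j /negPf ji; rewrite mxE ji.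
  have -> : \prod_(j < n | j != i) Num.max 0 ((B k).2 0 j - lo (B k).1 0 j) = p.
    by apply: eq_bigr => j /negPf ji; rewrite mxE ji.
  rewrite -mulrDl; congr (_ * _).
  move: ((B k).1 0 i) ((B k).2 0 i) => u v.
  rewrite /Num.max /Num.min.
  by case: (ltP t v) => ?; case: (ltP t u) => ?; repeat case: ltP => ?; lra.
under eq_esum do rewrite volE EFinD.
rewrite esumD; last 2 first.
- by move=> k _; rewrite lee_fin box_volume_ge0.
- by move=> k _; rewrite lee_fin box_volume_ge0.
apply: leeD; apply: ereal_inf_lbound.
- exists (D, fun k => ((B k).1, up (B k).2)) => //= x [/cB[k Dk Bk] xt].
  exists k => // j; have /andP[-> /=] := Bk j; rewrite mxE.
  by case: eqP => // -> xj; rewrite lt_min xj andbT.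
- exists (D, fun k => (lo (B k).1, (B k).2)) => //= x [/cB[k Dk Bk] xt].
  exists k => // j; have /andP[+ ->] := Bk j; rewrite mxE andbT.
  case: eqP => // -> xj; rewrite ge_max xj andbT leNgt; exact/negP.
Qed.

Lemma measurable_box (B : V * V) : measurable (box B : set L).
Proof.
rewrite (_ : box B = \bigcap_(i in [set: 'I_n])
   ([set x : V | x 0 i < B.2 0 i] `\` [set x : V | x 0 i < B.1 0 i])).
  apply: fin_bigcap_measurable => // i _.
  by apply: measurableD; exact: measurable_halfspace.
apply/seteqP; split => x /= Bx i => [_|].
  have /andP[h1 h2] := Bx i; split => //=.
  by apply/negP; rewrite -leNgt.
by have [//|/= -> /negP] := Bx i; rewrite -leNgt => ->.
Qed.

(** A countable family fine enough to write every open set as a union of its members, which makes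
    open sets measurable. *)
Definition ratbox (p : 'rV[rat]_n * nat) : V * V :=
  (\row_i (ratr (p.1 0 i) - p.2.+1%:R^-1), \row_i (ratr (p.1 0 i) + p.2.+1%:R^-1)).

Lemma ratbox_small x (e : R) : 0 < e ->
  exists p, box (ratbox p) x /\ forall y, box (ratbox p) y -> `|x - y| < e.
Proof.
move=> e0; pose k := Num.truncn (2 / e)%R.
have ke : k.+1%:R^-1 < e / 2.
  rewrite -[ltRHS]invrK ltf_pV2 ?posrE ?invr_gt0 ?divr_gt0 // ?ltr0n //.
  rewrite invf_div; exact: truncnS_gt.
have k0 : 0 < k.+1%:R^-1 :> R by rewrite invr_gt0 ltr0n.
have /choice[q qP] i : exists q : rat, x 0 i - k.+1%:R^-1 < ratr q < x 0 i + k.+1%:R^-1.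
  have : x 0 i - k.+1%:R^-1 < x 0 i + k.+1%:R^-1.
    by rewrite ltrD2l gtrN.
  by move=> /rat_in_itvoo[q]; rewrite in_itv /= => qP; exists q.
exists (\row_i q i, k); split => [i|y yB].
  rewrite !mxE; have /andP[h1 h2] := qP i.
  by apply/andP; split; move: h1 h2; set Q := ratr _; set d := _^-1; lra.
rewrite [ltLHS]/Num.norm/= mx_normrE; apply/bigmax_ltP; split => // -[i j] _ /=.
have := yB j; have := qP j; rewrite !mxE (ord1 i); move: ke.
set Q := ratr _; set d := _^-1 => ke.
move=> /andP[h1 h2] /andP[h3 h4].
by rewrite ltr_norml; apply/andP; split; lra.
Qed.

Lemma open_measurable_leb A : open A -> measurable (A : set L).
Proof.
move=> oA; pose F p : set L := if pselect (box (ratbox p) `<=` A) then box (ratbox p) else set0.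
rewrite (_ : A = \bigcup_p F p).
  apply: countable_bigcupT_measurable => [|p]; first exact: countableP.
  by rewrite /F; case: (pselect (_ `<=` _)) => ?; [exact: measurable_box|exact: measurable0].
apply/seteqP; split => [x Ax|x [p _]]; last first.
  by rewrite /F; case: (pselect (_ `<=` _)) => // h /h.
have [e /= e0 eA] := (iffLR (@nbhs_ballP _ V x A)) (open_nbhs_nbhs (conj oA Ax)).
have [p [xp px]] := ratbox_small x e0.
exists p => //; rewrite /F; case: (pselect (_ `<=` _)) => // -[] y /px xy.
by apply: eA; rewrite -ball_normE.
Qed.

Lemma continuous_measurable_leb (f : V -> R) :
  continuous f -> measurable_fun [set: L] (f : L -> R).
Proof.
move=> cf; apply: (measurability _ (measurable_realfun.RGenOInfty.measurableE R)) => //.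
move=> _ [_ [t ->] <-]; rewrite setTI; apply: open_measurable_leb.
by move/continuousP : cf; apply; exact: interval_open.
Qed.

End lebesgue_measurable.

(** * Change of variables under translations and dilations *)

Section integral_affine.
Context {R : realType} {n : nat}.
Local Notation V := 'rV[R]_n.
Local Notation L := (lebesgue_space R n).
Local Notation mu := (@leb R n).
Implicit Types (x c : V) (a : R).

Let pushforward_affineE a c (a0 : 0 < a) (an : 0 <= a^-1 ^+ n) :
  pushforward mu (affine a c : L -> L) = mscale (NngNum an) mu :> (set L -> \bar R).
Proof. by apply/funext => A; exact: lebesgue_outer_affine. Qed.

Lemma ge0_integral_affine (f : L -> \bar R) a c : 0 < a ->
  measurable_fun [set: L] f -> (forall x, 0 <= f x)%E ->
  (\int[mu]_x f (affine a c x) = (a^-1 ^+ n)%:E * \int[mu]_x f x)%E.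
Proof.
move=> a0 mf f0; have an : 0 <= a^-1 ^+ n by rewrite exprn_ge0 // invr_ge0 ltW.
have := @ge0_integral_pushforward _ _ L L R _ (measurable_affine c a0)
  mu setT f.
move=> /(_ measurableT mf (fun y _ => f0 y)); rewrite preimage_setT => <-.
rewrite (eq_measure_integral _ (fun A _ _ => congr1 (fun m => m A) (pushforward_affineE c a0 an))).
by rewrite ge0_integral_mscale.
Unshelve. exact: measurable_affine.
Qed.

Lemma integrable_affine (f : L -> R) a c : 0 < a ->
  mu.-integrable [set: L] (EFin \o f) ->
  mu.-integrable [set: L] (EFin \o (f \o affine a c)).
Proof.
move=> a0 /integrableP[mf fi]; apply/integrableP; split.
  exact: (measurableT_comp mf (measurable_affine c a0)).
have mfn : measurable_fun [set: L] (fun x => `|(f x)%:E|)%E.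
  exact: measurableT_comp.
have -> := @ge0_integral_affine _ a c a0 mfn (fun x => abse_ge0 _).
 rewrite lte_mul_pinfty // lee_fin exprn_ge0 // invr_ge0 ltW //.
Qed.

Lemma Rintegral_affine (f : L -> R) a c : 0 < a ->
  mu.-integrable [set: L] (EFin \o f) ->
  \int[mu]_x f (affine a c x) = a^-1 ^+ n * \int[mu]_x f x.
Proof.
move=> a0 fi; have fi' := integrable_affine c a0 fi.
have [mf _] := integrableP _ _ _ fi.
have fp := @ge0_integral_affine ((EFin \o f)^\+%E) a c a0
  (measurable_funepos mf) (funepos_ge0 _).
have fn := @ge0_integral_affine ((EFin \o f)^\-%E) a c a0
  (measurable_funeneg mf) (funeneg_ge0 _).
rewrite /Rintegral [X in fine X]integralE; move: fp fn.
rewrite (_ : (fun x => _ ^\+ (affine _ _ x))%E = (EFin \o (f \o affine a c))^\+%E); last first.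
  exact: (esym (@funepos_comp L L R (EFin \o f) (affine a c))).
rewrite (_ : (fun x => _ ^\- (affine _ _ x))%E = (EFin \o (f \o affine a c))^\-%E); last first.
  exact: (esym (@funeneg_comp L L R (EFin \o f) (affine a c))).
move=> -> ->; rewrite -muleBr //; last exact: integrable_add_def.
rewrite [in RHS]integralE fineM // -integralE.
exact: integrable_fin_num.
Qed.

Lemma integrable_translate (f : L -> R) c :
  mu.-integrable [set: L] (EFin \o f) ->
  mu.-integrable [set: L] (EFin \o (fun x => f (x + c))).
Proof.
move=> /(integrable_affine c ltr01); apply: eq_integrable => // x _.
by rewrite /= /affine scale1r.
Qed.

Lemma Rintegral_translate (f : L -> R) c :
  mu.-integrable [set: L] (EFin \o f) ->
  \int[mu]_x f (x + c) = \int[mu]_x f x.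
Proof.
move=> /(Rintegral_affine c ltr01); rewrite invr1 expr1n mul1r => <-.
by apply: eq_Rintegral => x _; rewrite /affine scale1r.
Qed.

End integral_affine.

(** * Integrability by dyadic covers *)

Lemma nneseries_geometric_lty {R : realType} (M q : R) : 0 <= M -> 0 <= q < 1 ->
  (\sum_(0 <= k <oo) (M * q ^+ k)%:E < +oo)%E.
Proof.
move=> M0 /andP[q0 q1].
have cv : series (geometric M q) @ \oo --> M / (1 - q).
  by apply: cvg_geometric_series; rewrite ger0_norm.
rewrite (_ : limn _ = (M / (1 - q))%:E) ?ltry //.
apply/cvg_lim => //; rewrite (_ : (fun k => _) = EFin \o series (geometric M q)).
  by apply: cvg_EFin; [exact: nearW|exact: cv].
by apply/funext => k; rewrite /= sumEFin.
Qed.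

(** [f] is dominated by the sum of the [c j] times the indicators of the [A j], whose integral is at
    most a geometric series. The sets may overlap, so nested cubes or intervals can stand for dyadic
    shells. *)
Lemma integrable_geometric_cover d {R : realType} (T : measurableType d)
    (mu : {measure set T -> \bar R}) (f : T -> R) (A : nat -> set T) (c m : nat -> R) (M q : R) :
  measurable_fun [set: T] f -> (forall j, measurable (A j)) ->
  (forall j, 0 <= c j) -> 0 <= M -> 0 <= q < 1 ->
  (forall j, (mu (A j) <= (m j)%:E)%E) -> (forall j, c j * m j <= M * q ^+ j) ->
  (forall x, f x != 0 -> exists2 j, A j x & `|f x| <= c j) ->
  mu.-integrable [set: T] (EFin \o f).
Proof.
move=> mf mA c0 M0 q01 Am cM fc; apply/integrableP; split.
  exact/measurable_EFinP.
pose F j (x : T) : \bar R := (c j * \1_(A j) x)%:E.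
have F0 j x : (0 <= F j x)%E by rewrite lee_fin mulr_ge0.
have mI j : measurable_fun [set: T] (fun x => \1_(A j) x : R) by exact: measurable_indic.
have mF j : measurable_fun [set: T] (F j).
  by apply/measurable_EFinP; apply: measurable_funM (mI j); exact: measurable_cst.
apply: (@le_lt_trans _ _ (\int[mu]_x \sum_(0 <= j <oo) F j x)%E).
  apply: (ge0_le_integral _ measurableT).
  - by move=> x _; exact: abse_ge0.
  - by apply/measurable_EFinP; apply: measurableT_comp mf; exact: normr_measurable.
  - by apply: ge0_emeasurable_sum => [k x _ _|k _]; [exact: F0|exact: mF].
  - move=> x _ /=; have [->|/fc[j xj fj]] := eqVneq (f x) 0.
      by rewrite normr0; exact: nneseries_ge0.
    apply: (@le_trans _ _ (F j x)); first by rewrite /F indicE mem_set ?mulr1 ?lee_fin.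
    by rewrite (@nneseriesD1 _ _ j) //; apply: leeDl; exact: nneseries_ge0.
rewrite (integral_nneseries _ measurableT mF (fun j x _ => F0 j x)).
apply: le_lt_trans (nneseries_geometric_lty M0 q01).
apply: lee_nneseries => [j _ _|j _]; first exact: integral_ge0.
apply: (@le_trans _ _ (c j * m j)%:E); last by rewrite lee_fin.
rewrite /F; under eq_integral do rewrite EFinM.
rewrite (ge0_integralZl _ measurableT (iffRL (measurable_EFinP _ _) (mI j))).
- rewrite (integral_indic _ measurableT (mA j)) setIT EFinM.
  by apply: lee_wpmul2l (Am j); rewrite lee_fin.
- by move=> x _; rewrite lee_fin.
- by rewrite lee_fin.
Qed.

Section radial_integrability.
Context {R : realType} {n : nat}.
Local Notation V := 'rV[R]_n.
Local Notation L := (lebesgue_space R n).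
Local Notation mu := (@leb R n).
Implicit Types (x c : V) (a s : R).

Definition cube (r : R) : V * V := (const_mx (- r), const_mx r).

Lemma cube_enorm r x : enorm x < r -> box (cube r) x.
Proof.
move=> xr i; rewrite !mxE; have := coord_le_enorm x i.
by rewrite ler_norml => /andP[h1 h2]; apply/andP; split; lra.
Qed.

Lemma cube_volume r : 0 <= r -> box_volume (cube r) = (2 * r) ^+ n.
Proof.
move=> r0; rewrite /box_volume -[X in _ ^+ X]card_ord -prodr_const.
apply: eq_bigr => i _; rewrite !mxE max_r; first by ring.
by rewrite opprK addr_ge0.
Qed.

Lemma integrable_dyadic (f : V -> R) (c rho : nat -> R) (M q : R) :
  measurable_fun [set: L] (f : L -> R) ->
  (forall j, 0 <= c j) -> (forall j, 0 <= rho j) -> 0 <= q < 1 ->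
  (forall j, c j * (2 * rho j) ^+ n <= M * q ^+ j) ->
  (forall x, f x != 0 -> exists2 j, enorm x < rho j & `|f x| <= c j) ->
  mu.-integrable [set: L] (EFin \o (f : L -> R)).
Proof.
move=> mf c0 rho0 q01 cM fc.
have M0 : 0 <= M.
  have := cM 0%N; rewrite expr0 mulr1; apply: le_trans.
  by rewrite mulr_ge0 // exprn_ge0 // mulr_ge0.
apply: (integrable_geometric_cover (A := fun j => box (cube (rho j)) : set L)
  (m := fun j => box_volume (cube (rho j))) mf _ c0 M0 q01).
- by move=> j; exact: measurable_box.
- by move=> j; exact: lebesgue_outer_box_le.
- by move=> j; rewrite cube_volume.
- by move=> x /fc[j xj fj]; exists j => //; exact: cube_enorm.
Qed.

Lemma dyadic_bounds (t : R) : 1 <= t -> exists j : nat, 2 ^+ j <= t < 2 ^+ j.+1.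
Proof.
move=> t1; have t0 : 0 <= t by lra.
have k0 : (0 < Num.truncn t)%N by rewrite truncn_gt0.
exists (trunc_log 2 (Num.truncn t)); apply/andP; split.
  rewrite -natrX; apply: le_trans (_ : (Num.truncn t)%:R <= _); last by rewrite truncn_le.
  by rewrite ler_nat trunc_logP.
apply: lt_le_trans (truncnS_gt t) _.
by rewrite -natrX ler_nat trunc_log_ltn.
Qed.

Lemma powR_exprn (a s : R) k : 0 <= a -> (a ^+ k) `^ s = (a `^ s) ^+ k.
Proof.
move=> a0; elim: k => [|k IH]; first by rewrite !expr0 powR1.
by rewrite !exprS powRM ?exprn_ge0 // IH.
Qed.

Lemma powR_invE (a s : R) : 0 <= a -> a^-1 `^ s = a `^ (- s).
Proof. by move=> a0; rewrite -powR_inv1 // -powRrM mulN1r. Qed.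

Lemma ltr_powR_gt1 (a s t : R) : 1 < a -> s < t -> a `^ s < a `^ t.
Proof.
move=> a1 st; have a0 : a == 0 = false by apply/negbTE; lra.
by rewrite /powR a0 ltr_expR ltr_pM2r // ln_gt0.
Qed.

Lemma powR2_gt1 (s : R) : 0 < s -> 1 < 2 `^ s.
Proof.
by move=> s0; have := @ltr_powR_gt1 2 0 s; rewrite powRr0; apply => //; rewrite ltr1n.
Qed.

Lemma measurable_enorm_powR s :
  measurable_fun [set: L] (fun x : L => enorm x `^ s).
Proof.
apply: (@measurableT_comp _ _ _ _ _ _ (fun t : R => t `^ s)).
  exact: measurable_powR.
by apply: continuous_measurable_leb; exact: enorm_cts.
Qed.

Lemma measurable_enorm_lt r : measurable ([set x : V | enorm x < r] : set L).
Proof.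
apply: open_measurable_leb; rewrite (_ : [set _ | _] = enorm @^-1` [set t | t < r]) //.
by move/continuousP : (@enorm_cts R n); apply; exact: open_lt.
Qed.

Lemma integrable_powR_near s : 0 <= s -> s < n%:R ->
  mu.-integrable [set: L]
    (EFin \o (fun x : L => \1_([set x : V | enorm x < 1] : set L) x * enorm x `^ (- s))).
Proof.
move=> s0 sn.
have sq : 0 <= (2 : R) `^ s / 2 ^+ n < 1.
  rewrite divr_ge0 ?powR_ge0 ?exprn_ge0 //= ltr_pdivrMr ?exprn_gt0 // mul1r.
  by rewrite -powR_mulrn // ltr_powR_gt1 ?ltr1n.
(* On the shell 2^-(j+1) < |x| <= 2^-j the function is at most 2^((j+1)s), against a volume of order
   2^(-jn): the ratio is 2^(s-n) < 1. The radius is doubled because the cover asks for a strict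
   inequality. *)
apply: (@integrable_dyadic _ (fun j => (2 ^+ j.+1) `^ s) (fun j => 2 * 2 ^- j)
   (2 `^ s * 4 ^+ n) (2 `^ s / 2 ^+ n)).
- apply: measurable_funM; last exact: measurable_enorm_powR.
  by apply: measurable_indic; exact: measurable_enorm_lt.
- by move=> j; exact: powR_ge0.
- by move=> j; rewrite mulr_ge0 // invr_ge0 exprn_ge0.
- exact: sq.
- move=> j; rewrite powR_exprn // exprS !exprMn -!exprVn (exprAC _ j n).
  rewrite (_ : 4 = 2 * 2 :> R) ?exprMn; last by ring.
  by rewrite le_eqVlt; apply/orP; left; apply/eqP; ring.
- move=> x; rewrite indicE; case: (boolP (x \in _)) => [|_]; last by rewrite mul0r eqxx.
  rewrite inE /= => x1; rewrite mul1r => _.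
  rewrite ger0_norm ?powR_ge0 //.
  (* A power of 0 is 1 for exponent 0 and 0 otherwise, so the origin lies in no shell but is bounded
     by 1. *)
  have [->|x0] := eqVneq x 0.
    exists 0%N; rewrite ?enorm0 ?mulr1 ?invr1 //.
    apply: (@le_trans _ _ 1); first by rewrite /powR eqxx lern1 leq_b1.
    by rewrite -[leLHS](powRr0 (2 : R)) expr1 ler_powR // ler1n.
  have xp : 0 < enorm x by rewrite enorm_gt0.
  have [|j /andP[j1 j2]] := @dyadic_bounds (enorm x)^-1.
    by rewrite -invr1 lef_pV2 ?posrE // ltW.
  exists j.
    apply: (@le_lt_trans _ _ (2 ^- j)).
      by rewrite -[leLHS]invrK lef_pV2 ?posrE ?invr_gt0 ?exprn_gt0.
    by rewrite ltr_pMl ?ltr1n // invr_gt0 exprn_gt0.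
  rewrite -powR_invE ?ge0_ler_powR ?nnegrE ?exprn_ge0 ?invr_ge0 ?enorm_ge0 //.
  exact: ltW.
Qed.

Lemma integrable_powR_far s : n%:R < s ->
  mu.-integrable [set: L]
    (EFin \o (fun x : L => \1_([set x : V | 1 <= enorm x] : set L) x * enorm x `^ (- s))).
Proof.
move=> ns; have s0 : 0 <= s by apply: le_trans (ltW ns).
have sq : 0 <= (2 : R) ^+ n / 2 `^ s < 1.
  rewrite divr_ge0 ?powR_ge0 ?exprn_ge0 //= ltr_pdivrMr ?powR_gt0 // mul1r.
  by rewrite -powR_mulrn // ltr_powR_gt1 ?ltr1n.
(* Shells 2^j <= |x| < 2^(j+1), with ratio 2^(n-s) < 1. *)
apply: (@integrable_dyadic _ (fun j => (2 ^+ j) `^ (- s)) (fun j => 2 ^+ j.+1)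
   (4 ^+ n) (2 ^+ n / 2 `^ s)).
- apply: measurable_funM; last exact: measurable_enorm_powR.
  apply: measurable_indic; rewrite (_ : [set _ | _] = ~` [set x : V | enorm x < 1]).
    by apply: measurableC; exact: measurable_enorm_lt.
  by apply/seteqP; split => x /=; rewrite leNgt => /negP.
- by move=> j; exact: powR_ge0.
- by move=> j; rewrite exprn_ge0.
- exact: sq.
- move=> j; rewrite powR_exprn // powRN exprS !exprMn (exprAC _ j n).
  rewrite (_ : 4 = 2 * 2 :> R) ?exprMn; last by ring.
  by rewrite le_eqVlt; apply/orP; left; apply/eqP; ring.
- move=> x; rewrite indicE; case: (boolP (x \in _)) => [|_]; last by rewrite mul0r eqxx.
  rewrite inE /= => x1; rewrite mul1r => _.
  rewrite ger0_norm ?powR_ge0 //.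
  have [j /andP[j1 j2]] := dyadic_bounds x1.
  exists j => //; rewrite !powRN lef_pV2 ?posrE ?powR_gt0 ?exprn_gt0 //.
    by rewrite ge0_ler_powR ?nnegrE ?exprn_ge0 ?enorm_ge0.
  exact: lt_le_trans x1.
Qed.

End radial_integrability.

Section real_integrable.
Context d (T : measurableType d) (R : realType) (mu : {measure set T -> \bar R}).
Variables (D : set T) (mD : measurable D).
Implicit Types f g : T -> R.

Lemma integrable_addr f g : mu.-integrable D (EFin \o f) ->
  mu.-integrable D (EFin \o g) -> mu.-integrable D (EFin \o (fun x => f x + g x)).
Proof. by move=> fi gi; exact: (integrableD mD fi gi). Qed.

Lemma integrable_scaler (c : R) f : mu.-integrable D (EFin \o f) ->
  mu.-integrable D (EFin \o (fun x => c * f x)).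
Proof. by move=> fi; exact: (integrableZl mD c fi). Qed.

Lemma integrable_subr f g : mu.-integrable D (EFin \o f) ->
  mu.-integrable D (EFin \o g) -> mu.-integrable D (EFin \o (fun x => f x - g x)).
Proof. by move=> fi gi; exact: (integrableB mD fi gi). Qed.

Lemma integrable_sumr I (s : seq I) (f : I -> T -> R) :
  (forall i, mu.-integrable D (EFin \o f i)) ->
  mu.-integrable D (EFin \o (fun x => \sum_(i <- s) f i x)).
Proof.
move=> fi; elim: s => [|i s IH].
  by under eq_fun do rewrite /= big_nil; exact: integrable0.
rewrite (_ : (fun x => _) = fun x => f i x + \sum_(j <- s) f j x).
  exact: integrable_addr.
by apply/funext => x; rewrite big_cons.
Qed.

Lemma Rintegral_sum I (s : seq I) (f : I -> T -> R) :
  (forall i, mu.-integrable D (EFin \o f i)) ->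
  \int[mu]_(x in D) (\sum_(i <- s) f i x) = \sum_(i <- s) \int[mu]_(x in D) f i x.
Proof.
move=> fi; elim: s => [|i s IH].
  by under eq_Rintegral do rewrite big_nil; rewrite big_nil /Rintegral integral0.
under eq_Rintegral do rewrite big_cons.
by rewrite big_cons RintegralD ?IH //; exact: integrable_sumr.
Qed.

Lemma le_integrable_real f g : measurable_fun D f ->
  (forall x, D x -> `|f x| <= g x) -> mu.-integrable D (EFin \o g) ->
  mu.-integrable D (EFin \o f).
Proof.
move=> mf fg gi; apply: (le_integrable mD _ _ gi).
  exact/measurable_EFinP.
move=> x Dx /=; rewrite lee_fin; apply: le_trans (fg x Dx) _; exact: ler_norm.
Qed.

End real_integrable.

Lemma powR_gauss_bounded {R : realType} (s b : R) : 0 <= s -> 0 < b ->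
  exists2 C : R, 0 < C & forall t, 0 <= t -> t `^ s * expR (- (b * t ^+ 2)) <= C.
Proof.
(* With k the integer part of s, t^s <= t^(2(k+1)) for t >= 1, and the term of order k+1 in the
   exponential series of b t^2 dominates this power. *)
move=> s0 b0; pose k := Num.truncn s; set c := k.+1`!%:R / b ^+ k.+1.
have c0 : 0 < c by rewrite divr_gt0 ?exprn_gt0 // ltr0n fact_gt0.
exists (1 + c) => [|t t0]; first by rewrite addr_gt0.
have bt0 : 0 <= b * t ^+ 2 by rewrite mulr_ge0 ?(ltW b0) ?sqr_ge0.
rewrite expRN ler_pdivrMr ?expR_gt0 //.
have [t1|t1] := leP t 1.
  apply: (@le_trans _ _ 1).
    by apply: le_trans (ge0_ler_powR s0 _ _ t1) _; rewrite ?nnegrE ?powR1.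
  rewrite mulrDl mul1r -[leLHS]addr0 lerD //.
    by rewrite -expR0 ler_expR.
  by rewrite mulr_ge0 ?expR_ge0 // ltW.
have kfact : 0 < k.+1`!%:R :> R by rewrite ltr0n fact_gt0.
have := expR_ge1Dxn k bt0; rewrite -lerBrDl ler_pdivrMr // exprMn => h.
apply: (@le_trans _ _ (t ^+ 2 ^+ k.+1)).
  apply: (@le_trans _ _ (t `^ (k.+1 * 2)%:R)).
    rewrite ler_powR ?(ltW t1) //; apply: (@le_trans _ _ k.+1%:R).
      exact/ltW/truncnS_gt.
    by rewrite ler_nat muln2 -addnn leq_addr.
  by rewrite powR_mulrn // mulnC exprM.
rewrite -(ler_pM2l (exprn_gt0 k.+1 b0)); apply: le_trans h _.
have bc : b ^+ k.+1 * c = k.+1`!%:R.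
  by rewrite /c mulrC divfK // expf_neq0 // gt_eqF.
rewrite -bc -subr_ge0.
rewrite (_ : _ - _ = b ^+ k.+1 * (expR (b * t ^+ 2) + c)); last by ring.
by rewrite mulr_ge0 ?addr_ge0 ?expR_ge0 ?exprn_ge0 ?(ltW b0) ?(ltW c0).
Qed.

Section gaussian_integrability.
Context {R : realType} {n : nat}.
Local Notation V := 'rV[R]_n.
Local Notation L := (lebesgue_space R n).
Local Notation mu := (@leb R n).
Implicit Types (x h : V).

Lemma continuous_gauss (b : R) : continuous (fun x : V => expR (- (b * dot x x))).
Proof.
have c1 : continuous (fun x : V => dot x x).
  by apply: (@dot_cts R n V id id) => x; exact: cvg_id.
have c2 : continuous (fun t : R => expR (- (b * t))).
  move=> t; apply: (@continuous_comp _ _ _ (fun t => - (b * t)) expR).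
    by apply: continuousN; apply: continuousM; [exact: cvg_cst|exact: cvg_id].
  exact: continuous_expR.
by move=> x; exact: continuous_comp (c1 x) (c2 (dot x x)).
Qed.

Lemma integrable_gauss (b : R) (z : V) : (0 < n)%N -> 0 < b ->
  mu.-integrable [set: L] (EFin \o (fun x : L => expR (- (b * dot (x + z) (x + z))))).
Proof.
move=> n0 b0.
apply: (@integrable_translate R n (fun x => expR (- (b * dot x x))) z).
have cts := @continuous_gauss b.
have [C C0 CP] := @powR_gauss_bounded R n.+1%:R b (ler0n _ _) b0.
(* The Gaussian is at most 1 in the unit ball, written as a power with exponent 0, and at most C
   |x|^-(n+1) outside it. *)
pose g (x : L) :=
  \1_([set x : V | enorm x < 1] : set L) x * enorm x `^ (- 0) +
  C * (\1_([set x : V | 1 <= enorm x] : set L) x * enorm x `^ (- n.+1%:R)).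
have ig : mu.-integrable [set: L] (EFin \o g).
  apply: (integrable_addr measurableT).
    by apply: integrable_powR_near; rewrite ?ltr0n.
  apply: (integrable_scaler measurableT).
  by apply: integrable_powR_far; rewrite ltr_nat ltnSn.
apply: (le_integrable_real measurableT _ _ ig).
  exact: continuous_measurable_leb.
move=> x _ /=; rewrite ger0_norm ?expR_ge0 //; rewrite /g !indicE.
have [x1|x1] := ltP (enorm x) 1.
  rewrite mem_set // memNset /=; last by apply/negP; rewrite -ltNge.
  rewrite mul0r mulr0 addr0 mul1r oppr0 powRr0 -expR0 ler_expR oppr_le0.
  by rewrite mulr_ge0 ?dot_ge0 ?(ltW b0).
rewrite memNset /=; last by apply/negP; rewrite -leNgt.
rewrite mem_set // mul0r add0r mul1r.
have xp : 0 < enorm x by exact: lt_le_trans x1.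
rewrite powRN ler_pdivlMr ?powR_gt0 // mulrC -sqr_enorm; apply: CP.
exact: enorm_ge0.
Qed.

End gaussian_integrability.

(** * Fractional divergence of bounded Lipschitz fields *)

Section global_continuity.
Context {R : realType} {T : topologicalType} {W : normedModType R}.

Lemma cts_add (f g : T -> W) :
  continuous f -> continuous g -> continuous (fun x => f x + g x).
Proof. by move=> cf cg x; apply: continuousD; [exact: cf|exact: cg]. Qed.

Lemma cts_sub (f g : T -> W) :
  continuous f -> continuous g -> continuous (fun x => f x - g x).
Proof. by move=> cf cg x; apply: continuousB; [exact: cf|exact: cg]. Qed.

Lemma cts_scale (f : T -> R) (g : T -> W) :
  continuous f -> continuous g -> continuous (fun x => f x *: g x).
Proof. by move=> cf cg x; apply: cvgZ; [exact: cf|exact: cg]. Qed.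

Lemma cts_mul (f g : T -> R) :
  continuous f -> continuous g -> continuous (fun x => f x * g x).
Proof. by move=> cf cg x; apply: continuousM; [exact: cf|exact: cg]. Qed.

Lemma cts_id : continuous (fun x : T => x).
Proof. by move=> x; exact: cvg_id. Qed.

End global_continuity.

Lemma cts_comp (T U W : topologicalType) (f : T -> U) (g : U -> W) :
  continuous f -> continuous g -> continuous (fun x => g (f x)).
Proof. by move=> cf cg x; apply: continuous_comp; [exact: cf|exact: cg]. Qed.

Section fractional_kernel.
Context {R : realType} {n : nat} (alpha : R).
Hypotheses (alpha0 : 0 < alpha) (alpha1 : alpha < 1) (n0 : (0 < n)%N).
Local Notation V := 'rV[R]_n.
Local Notation L := (lebesgue_space R n).
Local Notation mu := (@leb R n).
Implicit Types (x h c : V) (f g : V -> V).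

Definition order : R := n%:R + alpha + 1.

(** Integrand of div^alpha in the variable h = y - x, with [v h] in the place of the increment
    phi(x+h) - phi(x). *)
Definition kint (v : V -> V) : L -> R := fun h => dot h (v h) / enorm h `^ order.

(* [div^alpha g] without the normalising constant, after the change of variables y = x + h. *)
Definition fd g x : R := \int[mu]_h kint (fun h => g (x + h) - g x) h.

(* Any exponent strictly between alpha and 1 would do: it keeps the kernel
   [modulus |h| / |h|^(n + alpha)] integrable both at 0 and at infinity. *)
Definition modulus (t : R) : R := Num.min (t `^ ((1 + alpha) / 2)) 1.

(** This is [modulus |h| / |h|^(n + alpha)] written separately for |h| < 1 and |h| >= 1, since
    (1+alpha)/2 - (n+alpha) = -(n - (1-alpha)/2). *)
Definition majorant (x : L) : R :=
  \1_([set x : V | enorm x < 1] : set L) x * enorm x `^ (- (n%:R - (1 - alpha) / 2)) +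
  \1_([set x : V | 1 <= enorm x] : set L) x * enorm x `^ (- (n%:R + alpha)).

Lemma majorant_ge0 x : 0 <= majorant x.
Proof. by rewrite addr_ge0 // mulr_ge0 ?powR_ge0. Qed.

Lemma integrable_majorant : mu.-integrable [set: L] (EFin \o majorant).
Proof.
have n1 : 1 <= n%:R :> R by rewrite ler1n.
have a0 := alpha0; have a1 := alpha1.
apply: (integrable_addr measurableT).
  by apply: integrable_powR_near; lra.
by apply: integrable_powR_far; rewrite ltrDl.
Qed.

Lemma kint_le_majorant (A : R) (v : V -> V) h : 0 <= A ->
  enorm (v h) <= A * modulus (enorm h) -> `|kint v h| <= A * majorant h.
Proof.
move=> A0 vA; rewrite /kint.
have [->|hn0] := eqVneq h 0; first by rewrite dot0l mul0r normr0 mulr_ge0 ?majorant_ge0.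
have hp : 0 < enorm h by rewrite enorm_gt0.
have hz : enorm h != 0 by rewrite gt_eqF.
rewrite normrM normfV (ger0_norm (powR_ge0 _ _)) ler_pdivrMr ?powR_gt0 //.
apply: le_trans (cauchy_schwarz _ _) _.
apply: (le_trans (ler_wpM2l (enorm_ge0 h) vA)).
rewrite mulrCA -mulrA ler_wpM2l //.
rewrite /majorant !indicE; have [h1|h1] := ltP (enorm h) 1.
  rewrite mem_set // memNset /=; last by apply/negP; rewrite -ltNge.
  rewrite mul0r addr0 mul1r -powRD; last by rewrite hz implybT.
  apply: (@le_trans _ _ (enorm h * enorm h `^ ((1 + alpha) / 2))).
    by rewrite ler_wpM2l ?ge_min ?lexx ?(ltW hp).
  rewrite -{1}(powRr1 (ltW hp)) -powRD; last by rewrite hz implybT.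
  by rewrite le_eqVlt; apply/orP; left; apply/eqP; congr (_ `^ _); rewrite /order; field.
rewrite memNset /=; last by apply/negP; rewrite -leNgt.
rewrite mem_set // mul0r add0r mul1r -powRD; last by rewrite hz implybT.
rewrite (_ : _ + _ = 1) ?powRr1 ?(ltW hp) //; last by rewrite /order; ring.
by rewrite ler_piMr ?(ltW hp) // ge_min lexx orbT.
Qed.

Lemma measurable_kint (v : V -> V) : continuous v -> measurable_fun [set: L] (kint v).
Proof.
move=> cv; apply: measurable_funM.
  apply: continuous_measurable_leb.
  by apply: dot_cts => // t; exact: cvg_id.
rewrite (_ : (fun x => _) = (fun x : L => enorm x `^ (- order))).
  exact: measurable_enorm_powR.
by apply/funext => x; rewrite powRN.
Qed.

(** For these fields the integral [fd] converges absolutely, with the same majorant at every point.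
    The class is stable under finite sums, multiples and translations, hence contains every field
    built below. *)
Definition increments_le (A : R) g :=
  continuous g /\ forall x h, enorm (g (x + h) - g x) <= A * modulus (enorm h).

Lemma modulus_ge0 t : 0 <= modulus t.
Proof. by rewrite /modulus le_min powR_ge0 ler01. Qed.

Lemma increments_le_ge0 A g : increments_le A g -> 0 <= A.
Proof.
move=> [_ /(_ 0 (const_mx 1))].
have h1 : 0 < enorm (const_mx 1 : V).
  rewrite enorm_gt0; apply/eqP => /rowP/(_ (Ordinal n0)); rewrite !mxE => /eqP.
  by rewrite oner_eq0.
move=> /(le_trans (enorm_ge0 _)); rewrite pmulr_lge0 // /modulus lt_min ltr01 andbT.
exact: powR_gt0.
Qed.

Lemma translate_cts g x : continuous g -> continuous (fun h => g (x + h) - g x).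
Proof.
move=> cg; apply: cts_sub; last exact: cst_continuous.
by apply: cts_comp cg; apply: cts_add; [exact: cst_continuous|exact: cts_id].
Qed.

Lemma integrable_kint A g x : increments_le A g ->
  mu.-integrable [set: L] (EFin \o kint (fun h => g (x + h) - g x)).
Proof.
move=> gA; have A0 := increments_le_ge0 gA; have [cg gh] := gA.
have iA := integrable_scaler measurableT A integrable_majorant.
apply: (le_integrable_real measurableT _ _ iA).
- exact/measurable_kint/translate_cts.
- by move=> h _; exact: kint_le_majorant.
Qed.

Definition mass_majorant : R := \int[mu]_x majorant x.

Lemma mass_majorant_ge0 : 0 <= mass_majorant.
Proof. by apply: Rintegral_ge0 => x _; exact: majorant_ge0. Qed.

Lemma fd_le A g x : increments_le A g -> `|fd g x| <= A * mass_majorant.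
Proof.
move=> gA; have A0 := increments_le_ge0 gA; have [cg gh] := gA.
have gi := integrable_kint x gA.
apply: (le_trans (le_normr_Rintegral measurableT gi)).
rewrite -(RintegralZl _ measurableT integrable_majorant).
apply: le_Rintegral => //.
- exact: (integrable_norm gi).
- exact/(integrable_scaler measurableT)/integrable_majorant.
- by move=> h _; exact: kint_le_majorant.
Qed.

End fractional_kernel.

Section fractional_divergence_theory.
Context {R : realType} {n : nat} (alpha : R).
Hypotheses (alpha0 : 0 < alpha) (alpha1 : alpha < 1) (n0 : (0 < n)%N).
Local Notation V := 'rV[R]_n.
Local Notation L := (lebesgue_space R n).
Local Notation mu := (@leb R n).
Local Notation fd := (@fd R n alpha).
Local Notation K := (@mass_majorant R n alpha).
Local Notation increments_le := (@increments_le R n alpha).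
Implicit Types (x h z : V) (f g : V -> V) (A B : R).

Lemma increments_le_add A B f g : increments_le A f -> increments_le B g ->
  increments_le (A + B) (fun x => f x + g x).
Proof.
move=> [cf fA] [cg gB]; split; first exact: cts_add.
move=> x h; rewrite opprD addrACA mulrDl.
exact: le_trans (enormD _ _) (lerD (fA x h) (gB x h)).
Qed.

Lemma increments_le_scale (c : R) A g : increments_le A g ->
  increments_le (`|c| * A) (fun x => c *: g x).
Proof.
move=> [cg gA]; split; first by apply: cts_scale => //; exact: cst_continuous.
by move=> x h; rewrite -scalerBr enormZ -mulrA ler_wpM2l.
Qed.

Lemma increments_le_translate A g z : increments_le A g ->
  increments_le A (fun x => g (x - z)).
Proof.
move=> [cg gA]; split=> [|x h]; last by rewrite addrAC.
by apply: cts_comp cg; apply: cts_sub; [exact: cts_id|exact: cst_continuous].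
Qed.

Lemma increments_le0 : increments_le 0 (fun=> 0).
Proof.
by split=> [|x h]; [exact: cst_continuous|rewrite subr0 enorm0 mul0r].
Qed.

Lemma increments_le_sum I (s : seq I) (A : I -> R) (g : I -> V -> V) :
  (forall i, increments_le (A i) (g i)) ->
  increments_le (\sum_(i <- s) A i) (fun x => \sum_(i <- s) g i x).
Proof.
move=> gA; elim: s => [|i s IH].
  rewrite big_nil (_ : (fun x => _) = fun=> 0) //; first exact: increments_le0.
  by apply/funext => x; rewrite big_nil.
rewrite big_cons (_ : (fun x => _) = fun x => g i x + \sum_(j <- s) g j x).
  exact: increments_le_add.
by apply/funext => x; rewrite big_cons.
Qed.

Lemma fd_add A B f g x : increments_le A f -> increments_le B g ->
  fd (fun x => f x + g x) x = fd f x + fd g x.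
Proof.
move=> fA gB; rewrite /fd -RintegralD //; last 2 first.
- exact: integrable_kint fA.
- exact: integrable_kint gB.
apply: eq_Rintegral => h _; rewrite /kint -mulrDl -dotDr.
by rewrite opprD addrACA.
Qed.

Lemma fd_scale (c : R) A g x : increments_le A g ->
  fd (fun x => c *: g x) x = c * fd g x.
Proof.
move=> gA; rewrite /fd -RintegralZl //; last exact: integrable_kint gA.
by apply: eq_Rintegral => h _; rewrite /kint -scalerBr dotZr mulrA.
Qed.

Lemma fd_translate g x z : fd (fun y => g (y - z)) x = fd g (x - z).
Proof. by apply: eq_Rintegral => h _; rewrite /kint /= addrAC. Qed.

Lemma fd0 x : fd (fun=> 0) x = 0.
Proof.
rewrite /fd (_ : \int[mu]_h _ = \int[mu]_(h in setT) 0).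
  by rewrite /Rintegral integral0.
by apply: eq_Rintegral => h _; rewrite /kint subr0 dot0r mul0r.
Qed.

Lemma fd_sum I (s : seq I) (A : I -> R) (g : I -> V -> V) x :
  (forall i, increments_le (A i) (g i)) ->
  fd (fun x => \sum_(i <- s) g i x) x = \sum_(i <- s) fd (g i) x.
Proof.
move=> gA; elim: s => [|i s IH].
  rewrite big_nil (_ : (fun x => _) = fun=> 0) ?fd0 //.
  by apply/funext => y; rewrite big_nil.
rewrite big_cons (_ : (fun x => _) = fun x => g i x + \sum_(j <- s) g j x).
  by rewrite (fd_add _ (gA i) (increments_le_sum s gA)) IH.
by apply/funext => y; rewrite big_cons.
Qed.

Lemma frac_divE A g x : increments_le A g ->
  frac_div alpha g x = frac_const n alpha * fd g x.
Proof.
move=> gA; rewrite /frac_div; apply: (congr1 (fun t => frac_const n alpha * t)).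
pose F (y : L) : R := dot (y - x) (g y - g x) / enorm (y - x) `^ @order R n alpha.
have FE h : F (h + x) = kint alpha (fun h => g (x + h) - g x) h.
  by rewrite /F /kint addrK (addrC h x).
have Fi : mu.-integrable [set: L] (EFin \o F).
  have := integrable_translate (- x) (integrable_kint alpha0 alpha1 n0 x gA).
  apply: eq_integrable => // y _; rewrite /= -FE /F.
  by rewrite addrNK.
rewrite -[LHS](Rintegral_translate x Fi).
by apply: eq_Rintegral => h _; exact: FE.
Qed.

Definition bounded_lipschitz (M Lam : R) g :=
  (forall x, enorm (g x) <= M) /\ (forall x y, enorm (g x - g y) <= Lam * enorm (x - y)).

Lemma near_norm_lt x (e : R) : 0 < e -> \forall y \near nbhs x, `|x - y| < e.
Proof.
by move=> e0; apply/nbhs_ballP; exists e => // y; rewrite -ball_normE.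
Qed.

Lemma lipschitz_cts (Lam : R) g :
  (forall x y, enorm (g x - g y) <= Lam * enorm (x - y)) -> continuous g.
Proof.
move=> gL x; apply/(@cvgrPdist_lt R V _ (nbhs x) _ g (g x)) => e e0.
have N0 : 0 < n%:R :> R by rewrite ltr0n.
have L0 : 0 < `|Lam| * n%:R + 1 by rewrite ltr_pwDr // mulr_ge0.
near=> y; apply: le_lt_trans (norm_le_enorm _) _; apply: le_lt_trans (gL x y) _.
apply: (@le_lt_trans _ _ ((`|Lam| * n%:R + 1) * `|x - y|)).
  apply: (@le_trans _ _ (`|Lam| * (n%:R * `|x - y|))).
    apply: (@le_trans _ _ (`|Lam| * enorm (x - y))).
      by rewrite ler_wpM2r ?enorm_ge0 ?ler_norm.
    by rewrite ler_wpM2l // enorm_le_norm.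
  by rewrite mulrA ler_wpM2r // lerDl.
rewrite mulrC -ltr_pdivlMr //.
by near: y; apply: near_norm_lt; rewrite divr_gt0.
Unshelve. all: end_near. Qed.

Lemma bounded_lipschitz_incr M Lam g : bounded_lipschitz M Lam g ->
  forall x h, enorm (g (x + h) - g x) <= Lam * enorm h /\
              enorm (g (x + h) - g x) <= 2 * M.
Proof.
move=> [gM gL] x h; split; first by have := gL (x + h) x; rewrite (addrC x h) addrK.
by apply: le_trans (enormD _ _) _; rewrite enormN mulr_natl mulr2n lerD.
Qed.

(* The factor [M^((1 - alpha) / 2)] makes [fd g] small when g is uniformly small. *)
Lemma increments_le_interpolation M Lam g : bounded_lipschitz M Lam g ->
  0 <= M -> 2 * M <= Lam ->
  increments_le (Lam `^ ((1 + alpha) / 2) * (2 * M) `^ ((1 - alpha) / 2)) g.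
Proof.
move=> bl M0 ML; have M20 : 0 <= 2 * M by rewrite mulr_ge0.
have L0 : 0 <= Lam by exact: le_trans ML.
split=> [|x h]; first exact: lipschitz_cts bl.2.
have [h1 h2] := bounded_lipschitz_incr bl x h.
move: h1 h2; set v := enorm (_ - _) => h1 h2; have v0 : 0 <= v by exact: enorm_ge0.
have a0 := alpha0; have a1 := alpha1.
have b0 : 0 <= (1 + alpha) / 2 by lra.
have t0 : 0 <= (1 - alpha) / 2 by lra.
(* The Lipschitz bound is spent on the first factor and the bound 2 M on the second. Where the
   modulus is capped at 1, [2 * M <= Lam] bounds the first factor too. *)
have vE : v = v `^ ((1 + alpha) / 2) * v `^ ((1 - alpha) / 2).
  rewrite -powRD; last by apply/implyP => /eqP; lra.
  by rewrite (_ : (1 + alpha) / 2 + (1 - alpha) / 2 = 1) ?powRr1 //; field.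
rewrite vE mulrAC; apply: ler_pM; rewrite ?powR_ge0 //; last first.
  by rewrite ge0_ler_powR ?nnegrE.
rewrite /modulus; have [hh|hh] := leP (enorm h `^ ((1 + alpha) / 2)) 1.
  have Lh : 0 <= Lam * enorm h by rewrite mulr_ge0 ?enorm_ge0.
  by rewrite -powRM ?enorm_ge0 // ge0_ler_powR ?nnegrE.
by rewrite mulr1 ge0_ler_powR ?nnegrE // (le_trans h2).
Qed.

(** For |h| <= 1 one has |h| <= |h|^((1+alpha)/2), the exponent being below 1, and the Lipschitz
    bound suffices; for |h| > 1 the modulus is 1 and 2 M bounds the increment. *)
Lemma increments_le_lipschitz M Lam g : bounded_lipschitz M Lam g ->
  0 <= Lam -> increments_le (Lam + 2 * M) g.
Proof.
move=> bl L0; have M0 : 0 <= M by apply: le_trans (enorm_ge0 _) (bl.1 0).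
have M20 : 0 <= 2 * M by rewrite mulr_ge0.
split=> [|x h]; first exact: lipschitz_cts bl.2.
have [h1 h2] := bounded_lipschitz_incr bl x h.
have a0 := alpha0; have a1 := alpha1.
have b0 : 0 <= (1 + alpha) / 2 by lra.
have p1 : 1 = 1 `^ ((1 + alpha) / 2) :> R by rewrite powR1.
rewrite /modulus; case: (leP (enorm h) 1) => hh; last first.
  rewrite min_r; first by rewrite mulr1; lra.
  by rewrite [leLHS]p1 ge0_ler_powR ?nnegrE ?enorm_ge0 ?(ltW hh).
have [->|hn0] := eqVneq h 0; first by
  rewrite addr0 subrr enorm0 mulr_ge0 ?addr_ge0 ?(modulus_ge0 alpha) // le_min powR_ge0 ler01.
have hp : 0 < enorm h by rewrite enorm_gt0.
have tb : enorm h <= enorm h `^ ((1 + alpha) / 2).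
  by rewrite ger1_powR ?hp //; lra.
rewrite min_l; last first.
  by rewrite [leRHS]p1 ge0_ler_powR ?nnegrE ?enorm_ge0.
apply: le_trans h1 _; apply: (@le_trans _ _ (Lam * enorm h `^ ((1 + alpha) / 2))).
  by rewrite ler_wpM2l.
by rewrite ler_wpM2r ?powR_ge0 // lerDl.
Qed.

(* The increment [y |-> g (y + tau) - g y] is a field bounded by [Lam |tau|]. *)
Lemma fd_holder M Lam g x tau : bounded_lipschitz M Lam g -> enorm tau <= 1 ->
  0 <= Lam ->
  `|fd g (x + tau) - fd g x| <= 2 * Lam * enorm tau `^ ((1 - alpha) / 2) * K.
Proof.
move=> bl t1 L0.
have M0 : 0 <= M by apply: le_trans (enorm_ge0 _) (bl.1 0).
have bl' : bounded_lipschitz (Lam * enorm tau) (2 * Lam) (fun y => g (y + tau) - g y).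
  split=> [y|y z]; first exact: (bounded_lipschitz_incr bl y tau).1.
  rewrite opprB (addrC (g z)) addrACA (addrC (- g y)).
  apply: le_trans (enormD _ _) _; rewrite -mulrA mulr_natl mulr2n.
  apply: lerD; last by rewrite enormB bl.2.
  by have := bl.2 (y + tau) (z + tau); rewrite opprD addrACA subrr addr0.
have Mt0 : 0 <= Lam * enorm tau by rewrite mulr_ge0 ?enorm_ge0.
have inc := @increments_le_interpolation _ _ _ bl' Mt0.
(* Here |tau| <= 1 supplies the hypothesis [2 * M <= Lam] of the interpolation, for the bound Lam
   |tau| and the Lipschitz constant 2 Lam. *)
have {}inc := inc (ler_wpM2l (ler0n _ 2) (ler_piMr L0 t1)).
have incg := increments_le_lipschitz bl L0.
have incgt := increments_le_translate (- tau) incg.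
have -> : fd g (x + tau) - fd g x = fd (fun y => g (y + tau) - g y) x.
  have incN := increments_le_scale (-1) incg.
  rewrite (_ : (fun y => _) = fun y => g (y - - tau) + -1 *: g y); last first.
    by apply/funext => y; rewrite opprK scaleN1r.
  by rewrite (fd_add _ incgt incN) fd_translate opprK (fd_scale _ _ incg) mulN1r.
apply: le_trans (fd_le alpha0 alpha1 n0 x inc) _.
rewrite ler_wpM2r ?mass_majorant_ge0 //.
have a0 := alpha0; have a1 := alpha1.
rewrite (mulrA 2 Lam) [X in _ * X]powRM ?enorm_ge0 ?mulr_ge0 // mulrA ler_wpM2r ?powR_ge0 //.
have [->|Ln0] := eqVneq Lam 0.
  by rewrite mulr0 powR0 ?mul0r // gt_eqF //; lra.
have Lp : 2 * Lam != 0 by rewrite mulf_neq0.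
rewrite -powRD; last by rewrite Lp implybT.
by rewrite (_ : (1 + alpha) / 2 + (1 - alpha) / 2 = 1) ?powRr1 ?mulr_ge0 //; field.
Qed.

Lemma fd_cts M Lam g : bounded_lipschitz M Lam g -> 0 <= Lam -> continuous (fd g).
Proof.
move=> bl L0 x; have a0 := alpha0; have a1 := alpha1.
have N0 : 0 < n%:R :> R by rewrite ltr0n.
have th0 : 0 < (1 - alpha) / 2 by lra.
apply/(@cvgrPdist_le R R _ (nbhs x) _ (fd g) (fd g x)) => e e0.
pose C := 2 * Lam * K + 1.
have C0 : 0 < C by rewrite ltr_pwDr // mulr_ge0 ?mulr_ge0 ?mass_majorant_ge0.
(* The Hoelder estimate solved for |y - x|; it is valid up to distance 1, and the 1 added in [C]
   keeps the quotient meaningful when Lam is 0. *)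
pose d : R := Num.min 1 ((e / C) `^ ((1 - alpha) / 2)^-1).
have d0 : 0 < d by rewrite lt_min ltr01 powR_gt0 // divr_gt0.
near=> y.
have yd : enorm (y - x) <= d.
  apply: le_trans (enorm_le_norm _) _.
  rewrite mulrC -ler_pdivlMr // distrC ltW //.
  by near: y; apply: near_norm_lt; rewrite divr_gt0.
rewrite distrC; have y1 : enorm (y - x) <= 1 by rewrite (le_trans yd) // ge_min lexx.
have := fd_holder x bl y1 L0; rewrite [x + _]addrC subrK => /le_trans; apply.
have : enorm (y - x) `^ ((1 - alpha) / 2) <= e / C.
  apply: (@le_trans _ _ (d `^ ((1 - alpha) / 2))).
    by rewrite ge0_ler_powR ?nnegrE ?enorm_ge0 ?(ltW d0) ?(ltW th0).
  apply: (@le_trans _ _ ((e / C) `^ ((1 - alpha) / 2)^-1 `^ ((1 - alpha) / 2))).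
    by rewrite ge0_ler_powR ?nnegrE ?powR_ge0 ?(ltW d0) ?(ltW th0) // ge_min lexx orbT.
  by rewrite -powRrM mulVf ?gt_eqF // powRr1 ?divr_ge0 ?(ltW e0) ?(ltW C0).
rewrite ler_pdivlMr // => h; apply: le_trans h.
rewrite (mulrC (2 * Lam)) -mulrA ler_wpM2l ?powR_ge0 //.
by rewrite /C lerDl.
Unshelve. all: end_near. Qed.

End fractional_divergence_theory.

(** * Gaussian kernels *)

Section gaussians.
Context {R : realType} {n : nat}.
Hypothesis (n0 : (0 < n)%N).
Local Notation V := 'rV[R]_n.
Local Notation L := (lebesgue_space R n).
Local Notation mu := (@leb R n).
Implicit Types (x h z u v : V) (a b s : R).

Definition gauss a x : R := expR (- (a * dot x x)).

(** Treated as an abstract constant, whose positivity is obtained in [gauss_mass_gt0] from that of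
    the unit cube. *)
Definition gauss_mass : R := \int[mu]_x gauss 1 x.

Lemma gauss_ge0 a x : 0 <= gauss a x.
Proof. exact: expR_ge0. Qed.

Lemma gaussN a x : gauss a (- x) = gauss a x.
Proof. by rewrite /gauss dotNl dotNr opprK. Qed.

Lemma gauss_le1 a x : 0 <= a -> gauss a x <= 1.
Proof. by move=> a0; rewrite /gauss -expR0 ler_expR oppr_le0 mulr_ge0 ?dot_ge0. Qed.

Lemma integrable_gauss_translate a z : 0 < a ->
  mu.-integrable [set: L] (EFin \o (fun x : L => gauss a (x + z))).
Proof. by move=> a0; exact: integrable_gauss. Qed.

Lemma Rintegral_gauss s z : 0 < s ->
  \int[mu]_x gauss (s ^- 2) (x + z) = s ^+ n * gauss_mass.
Proof.
move=> s0; have s'0 : 0 < s^-1 by rewrite invr_gt0.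
have gi : mu.-integrable [set: L] (EFin \o (fun x : L => gauss 1 x)).
  have := integrable_gauss_translate 0 ltr01.
  by apply: eq_integrable => // x _; rewrite /= addr0.
have := Rintegral_affine (s^-1 *: z) s'0 gi; rewrite invrK => <-.
apply: eq_Rintegral => x _; rewrite /affine -scalerDr /gauss dotZl dotZr mul1r.
by rewrite mulrA -exprVn expr2.
Qed.

(** Completing the square in h: a product of two Gaussians is a constant times one translated
    Gaussian, whose integral is known. *)
Lemma gauss_mulE a b u h : a + b != 0 ->
  gauss a (u + h) * gauss b h =
  gauss (a * b / (a + b)) u * gauss (a + b) (h + (a / (a + b)) *: u).
Proof.
move=> ab; rewrite /gauss -!expRD; congr expR.
rewrite !(dotDl, dotDr, dotZl, dotZr) (dotC h u).
by field.
Qed.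

Lemma integrable_gauss_mul a b u : 0 < a -> 0 < b ->
  mu.-integrable [set: L] (EFin \o (fun h : L => gauss a (u + h) * gauss b h)).
Proof.
move=> a0 b0; have ab : 0 < a + b by rewrite addr_gt0.
rewrite (_ : (fun h => _) = fun h : L =>
  gauss (a * b / (a + b)) u * gauss (a + b) (h + (a / (a + b)) *: u)).
  exact/(integrable_scaler measurableT)/integrable_gauss_translate.
by apply/funext => h; rewrite gauss_mulE // gt_eqF.
Qed.

(** The parameter [s] names (a+b)^(-1/2), so that the mass is an integer power and no square root
    appears. *)
Lemma Rintegral_gauss_mul a b s u : 0 < a -> 0 < b -> 0 < s -> a + b = s ^- 2 ->
  \int[mu]_h (gauss a (u + h) * gauss b h) =
  gauss (a * b / (a + b)) u * (s ^+ n * gauss_mass).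
Proof.
move=> a0 b0 s0 abs; have ab : 0 < a + b by rewrite addr_gt0.
under eq_Rintegral do rewrite gauss_mulE ?gt_eqF //.
rewrite RintegralZl //; last exact: integrable_gauss_translate.
by rewrite abs Rintegral_gauss.
Qed.

(* A sum of Gaussians is an L^2 inner product of narrower Gaussians. *)
Lemma gauss_square (I : finType) (c : I -> R) (x : I -> V) a s :
  0 < a -> 0 < s -> 4 * a = s ^- 2 ->
  mu.-integrable [set: L]
    (EFin \o (fun v : L => (\sum_i c i * gauss (2 * a) (v - x i)) ^+ 2)) /\
  \int[mu]_v (\sum_i c i * gauss (2 * a) (v - x i)) ^+ 2 =
  s ^+ n * gauss_mass * \sum_i \sum_j c i * c j * gauss a (x i - x j).
Proof.
move=> a0 s0 as2; have a20 : 0 < 2 * a by rewrite mulr_gt0.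
pose F i j (v : L) := c i * c j * (gauss (2 * a) (v - x i) * gauss (2 * a) (v - x j)).
have FE i j v : F i j (v + x j) =
    c i * c j * (gauss (2 * a) ((x j - x i) + v) * gauss (2 * a) v).
  by rewrite /F addrK (addrC v) addrAC.
have Fi i j : mu.-integrable [set: L] (EFin \o F i j).
  have := integrable_translate (- x j)
    (integrable_scaler measurableT (c i * c j) (integrable_gauss_mul (x j - x i) a20 a20)).
  by apply: eq_integrable => // v _; rewrite /= -FE subrK.
have sqE v : (\sum_i c i * gauss (2 * a) (v - x i)) ^+ 2 = \sum_i \sum_j F i j v.
  rewrite expr2 mulr_suml; apply: eq_bigr => i _; rewrite mulr_sumr.
  by apply: eq_bigr => j _; rewrite /F mulrACA.
have Fii i : mu.-integrable [set: L] (EFin \o (fun v => \sum_j F i j v)).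
  exact: integrable_sumr.
rewrite (_ : (fun v : L => _ ^+ 2) = fun v => \sum_i \sum_j F i j v); last first.
  by apply/funext => v; exact: sqE.
split; first exact: integrable_sumr.
rewrite Rintegral_sum // mulr_sumr; apply: eq_bigr => i _.
rewrite Rintegral_sum // mulr_sumr; apply: eq_bigr => j _.
rewrite -[LHS](Rintegral_translate (x j) (Fi i j)).
under eq_Rintegral do rewrite FE.
rewrite RintegralZl //; last exact: integrable_gauss_mul.
rewrite (@Rintegral_gauss_mul _ _ s) // -?as2; last by ring.
(* This is why the narrow Gaussians have exponent 2 a: the product of two of them integrates to
   exponent a. *)
rewrite (_ : 2 * a * (2 * a) / (2 * a + 2 * a) = a); last first.
  have az : 2 * a + 2 * a != 0 by rewrite gt_eqF ?addr_gt0.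
  by apply: (mulIf az); rewrite mulfVK //; ring.
by rewrite -(gaussN a (x i - x j)) opprB; ring.
Qed.

Lemma gauss_positive_definite (I : finType) (c : I -> R) (x : I -> V) a :
  0 < gauss_mass -> 0 < a -> 0 <= \sum_i \sum_j c i * c j * gauss a (x i - x j).
Proof.
move=> C0 a0; have a40 : 0 < 4 * a by rewrite mulr_gt0.
pose s := (Num.sqrt (4 * a))^-1.
have s0 : 0 < s by rewrite invr_gt0 sqrtr_gt0.
have as2 : 4 * a = s ^- 2 by rewrite exprVn invrK sqr_sqrtr // ltW.
have [_ E] := gauss_square c x a0 s0 as2.
have p0 : 0 < s ^+ n * gauss_mass by rewrite mulr_gt0 ?exprn_gt0.
by rewrite -(pmulr_rge0 _ p0) -E; apply: Rintegral_ge0 => v _; exact: sqr_ge0.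
Qed.

End gaussians.

(** * One-variable derivatives and radial fields *)

Section one_variable_calculus.
Context {R : realType}.
Implicit Types (f g : R -> R) (x a b : R).

Lemma isd_cst x (c : R) : is_derive x 1 (fun=> c) 0.
Proof. exact: is_derive_cst. Qed.

Lemma isd_id x : is_derive x 1 (fun t : R => t) 1.
Proof. exact: is_derive_id. Qed.

Lemma isd_add f g x a b : is_derive x 1 f a -> is_derive x 1 g b ->
  is_derive x 1 (fun t => f t + g t) (a + b).
Proof. by move=> fa gb; exact: is_deriveD. Qed.

Lemma isd_mul f g x a b : is_derive x 1 f a -> is_derive x 1 g b ->
  is_derive x 1 (fun t => f t * g t) (f x * b + g x * a).
Proof. by move=> fa gb; exact: is_deriveM. Qed.

Lemma isd_scale (c : R) f x a : is_derive x 1 f a ->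
  is_derive x 1 (fun t => c * f t) (c * a).
Proof.
by move=> fa; apply: is_derive_eq (isd_mul (isd_cst x c) fa) _; rewrite mulr0 addr0.
Qed.

Lemma isd_comp f g x a b : is_derive (g x) 1 f a -> is_derive x 1 g b ->
  is_derive x 1 (fun t => f (g t)) (a * b).
Proof. by move=> fa gb; exact: is_derive1_comp. Qed.

Lemma isd_sum I (s : seq I) (f : I -> R -> R) x (a : I -> R) :
  (forall i, is_derive x 1 (f i) (a i)) ->
  is_derive x 1 (fun t => \sum_(i <- s) f i t) (\sum_(i <- s) a i).
Proof.
move=> fa; elim: s => [|i s IH].
  rewrite big_nil (_ : (fun t => _) = fun=> 0); first exact: isd_cst.
  by apply/funext => t; rewrite big_nil.
rewrite big_cons (_ : (fun t => _) = fun t => f i t + \sum_(j <- s) f j t).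
  exact: isd_add.
by apply/funext => t; rewrite big_cons.
Qed.

Lemma isd_cts f (df : R -> R) : (forall x, is_derive x 1 f (df x)) -> continuous f.
Proof.
by move=> fd x; apply: differentiable_continuous; apply/derivable1_diffP; have [] := fd x.
Qed.

Lemma mean_value f (df : R -> R) a b : a < b -> (forall x, is_derive x 1 f (df x)) ->
  exists2 c, a < c < b & f b - f a = df c * (b - a).
Proof.
move=> ab fd; have [c cab E] := MVT ab (fun x _ => fd x) (continuous_subspaceT (isd_cts fd)).
by exists c => //; move: cab; rewrite in_itv.
Qed.

End one_variable_calculus.

Section radial_fields.
Context {R : realType} {n : nat}.
Local Notation V := 'rV[R]_n.
Implicit Types (x y d : V) (t : R).

Lemma isd_coord y d i t : is_derive t 1 (fun t => (y + t *: d) 0 i) (d 0 i).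
Proof.
rewrite (_ : (fun t => _) = fun t => y 0 i + t * d 0 i); last first.
  by apply/funext => s; rewrite !mxE.
apply: is_derive_eq (isd_add (isd_cst t (y 0 i)) (isd_mul (isd_id t) (isd_cst t (d 0 i)))) _.
by rewrite mulr0 mulr1 !add0r.
Qed.

Lemma isd_dot y d t :
  is_derive t 1 (fun t => dot (y + t *: d) (y + t *: d)) (2 * dot d (y + t *: d)).
Proof.
have h i := isd_mul (isd_coord y d i t) (isd_coord y d i t).
apply: is_derive_eq (isd_sum (index_enum _) h) _.
by rewrite mulr_sumr; apply: eq_bigr => i _; rewrite -mulr2n mulr_natl mulrC.
Qed.

Definition radial (b : R -> R) x : V := b (dot x x) *: x.

(** Mean value theorem for each coordinate along the segment from y to x: at a point q of it the
    derivative is at most (|b| + 2 |q|^2 |b'|) |x - y|. Summing over the coordinates costs the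
    factor n. *)
Lemma radial_lipschitz (b db : R -> R) (B : R) :
  (forall t, is_derive t 1 b (db t)) ->
  (forall t, 0 <= t -> `|b t| + 2 * t * `|db t| <= B) ->
  forall x y, enorm (radial b x - radial b y) <= n%:R * B * enorm (x - y).
Proof.
move=> bd bB x y; set d := x - y.
have B0 : 0 <= B.
  by apply: le_trans (bB 0 (lexx _)); rewrite addr_ge0 ?mulr_ge0.
apply: le_trans (enorm_le_sum _) _.
rewrite -[X in X%:R]card_ord -sumr_const -mulrA mulr_suml.
apply: ler_sum => i _; rewrite mul1r.
pose p t := y + t *: d.
have pd t : is_derive t 1 (fun t => b (dot (p t) (p t)) * (p t) 0 i)
   (b (dot (p t) (p t)) * d 0 i + p t 0 i * (db (dot (p t) (p t)) * (2 * dot d (p t)))).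
  exact: (isd_mul (isd_comp (bd _) (isd_dot y d t)) (isd_coord y d i t)).
have [c _] := mean_value ltr01 pd.
have p1 : p 1 = x by rewrite /p scale1r addrC subrK.
have p0 : p 0 = y by rewrite /p scale0r addr0.
rewrite p1 p0 subr0 mulr1.
rewrite (_ : (radial b x - radial b y) 0 i = b (dot x x) * x 0 i - b (dot y y) * y 0 i).
  move=> ->; move: (p c) => q.
  apply: le_trans (ler_normD _ _) _; rewrite !normrM (ger0_norm (ler0n _ 2)).
  apply: (@le_trans _ _ ((`|b (dot q q)| + 2 * dot q q * `|db (dot q q)|) * enorm d)); last first.
    by rewrite ler_wpM2r ?enorm_ge0 // bB // dot_ge0.
  rewrite [leRHS]mulrDl lerD //; first by rewrite ler_wpM2l // coord_le_enorm.
  rewrite -sqr_enorm.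
  have h1 := coord_le_enorm q i; have h2 := cauchy_schwarz d q.
  apply: (@le_trans _ _ (enorm q * (`|db (enorm q ^+ 2)| * (2 * (enorm d * enorm q))))).
    by apply: ler_pM => //; rewrite ?mulr_ge0 // ler_wpM2l // ler_wpM2l.
  by rewrite le_eqVlt; apply/orP; left; apply/eqP; ring.
by rewrite !mxE.
Qed.

Lemma enorm_radial (b : R -> R) x : enorm (radial b x) = `|b (enorm x ^+ 2)| * enorm x.
Proof. by rewrite /radial enormZ sqr_enorm. Qed.

Lemma isd_gauss (a t : R) : is_derive t 1 (fun t => expR (- (a * t))) (- a * expR (- (a * t))).
Proof.
have h : is_derive t 1 (fun t => - (a * t)) (- a).
  rewrite (_ : (fun t => _) = fun t => - a * t); last by apply/funext => s; rewrite mulNr.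
  by apply: is_derive_eq (isd_scale (- a) (isd_id t)) _; rewrite mulr1.
by apply: is_derive_eq (isd_comp (is_derive_expR _) h) _; rewrite mulrC.
Qed.

Lemma mul_expRN_le1 (t : R) : t * expR (- t) <= 1.
Proof.
rewrite expRN ler_pdivrMr ?expR_gt0 // mul1r.
by apply: le_trans (expR_ge1Dx t); rewrite lerDr.
Qed.

Definition gauss_field (a : R) : V -> V := radial (fun t => expR (- (a * t))).

Lemma gauss_fieldE a x : gauss_field a x = gauss a x *: x.
Proof. by []. Qed.

Lemma gauss_fieldN a x : gauss_field a (- x) = - gauss_field a x.
Proof. by rewrite !gauss_fieldE gaussN scalerN. Qed.

(** Both constants come from s exp(-s) <= 1: t exp(-a t^2) <= (1 + t^2) exp(-a t^2) <= 1 + 1/a, and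
    3 = 1 + 2 bounds the quantity required by [radial_lipschitz]. *)
Lemma gauss_field_bounded_lipschitz (a : R) : 0 < a ->
  bounded_lipschitz (1 + a^-1) (n%:R * 3) (gauss_field a).
Proof.
move=> a0; split=> [x|].
  rewrite enorm_radial ger0_norm ?expR_ge0 //.
  have x0 := enorm_ge0 x; set t := enorm x in x0 *.
  apply: (@le_trans _ _ (expR (- (a * t ^+ 2)) * (1 + t ^+ 2))).
    rewrite ler_wpM2l ?expR_ge0 //; have := sqr_ge0 (t - 1); rewrite sqrrB1.
    by have := sqr_ge0 t; move: (t ^+ 2) => u; lra.
  rewrite mulrDr mulr1 lerD //.
    by rewrite -expR0 ler_expR oppr_le0 mulr_ge0 ?sqr_ge0 ?(ltW a0).
  by rewrite -[leRHS]mulr1 ler_pdivlMl // (mulrC (expR _)) mulrA mul_expRN_le1.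
apply: (radial_lipschitz (isd_gauss a)) => t t0.
rewrite normrM normrN (ger0_norm (ltW a0)) ger0_norm ?expR_ge0 //.
have := mul_expRN_le1 (a * t).
have : expR (- (a * t)) <= 1 by rewrite -expR0 ler_expR oppr_le0 mulr_ge0 ?(ltW a0).
have -> : 2 * t * (a * expR (- (a * t))) = 2 * (a * t * expR (- (a * t))) by ring.
by move=> h1 h2; apply: le_trans (lerD h1 (ler_wpM2l (ler0n _ 2) h2)) _; lra.
Qed.

End radial_fields.

(** * The energy of Gaussian fields at one scale *)

Section pair_sums.
Context {R : realType} {n : nat} (I : finType) (w : I -> R) (z : I -> 'rV[R]_n).
Hypothesis w0 : forall i, 0 <= w i.
Local Notation V := 'rV[R]_n.
Implicit Types F G : V -> R.

(** Discrete form of the double integral of F(x - y) over E x E, for masses [w i] placed at the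
    points [z i]. *)
Definition pair_sum F : R := \sum_i \sum_j w i * w j * F (z i - z j).

Lemma pair_sumN F : pair_sum (fun u => F (- u)) = pair_sum F.
Proof.
rewrite /pair_sum exchange_big; apply: eq_bigr => i _; apply: eq_bigr => j _.
by rewrite opprB (mulrC (w j)).
Qed.

Lemma pair_sumB F G : pair_sum (fun u => F u - G u) = pair_sum F - pair_sum G.
Proof.
rewrite /pair_sum -sumrB; apply: eq_bigr => i _; rewrite -sumrB.
by apply: eq_bigr => j _; rewrite mulrBr.
Qed.

Lemma pair_sumZ (c : R) F : pair_sum (fun u => c * F u) = c * pair_sum F.
Proof.
rewrite /pair_sum mulr_sumr; apply: eq_bigr => i _; rewrite mulr_sumr.
by apply: eq_bigr => j _; rewrite mulrCA.
Qed.

Lemma pair_sum_odd F : (forall u, F (- u) = - F u) -> pair_sum F = 0.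
Proof.
move=> oF; have := pair_sumN F.
(* The zero multiple brings the opposite of F into the shape of [pair_sumB]. *)
rewrite (_ : (fun u => _) = fun u => 0 * F u - F u); last first.
  by apply/funext => u; rewrite oF mul0r add0r.
rewrite pair_sumB pair_sumZ mul0r add0r; lra.
Qed.

Lemma pair_sum_le F (B : R) : (forall u, `|F u| <= B) ->
  `|pair_sum F| <= (\sum_i w i) ^+ 2 * B.
Proof.
move=> FB; rewrite /pair_sum; apply: le_trans (ler_norm_sum _ _ _) _.
rewrite expr2 -mulrA mulr_suml; apply: ler_sum => i _.
apply: le_trans (ler_norm_sum _ _ _) _.
rewrite mulrA mulr_sumr mulr_suml; apply: ler_sum => j _.
by rewrite normrM ger0_norm ?mulr_ge0 // ler_wpM2l // mulr_ge0.
Qed.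

End pair_sums.

Section energy.
Context {R : realType} {n : nat} (alpha : R).
Hypotheses (alpha0 : 0 < alpha) (alpha1 : alpha < 1) (n0 : (0 < n)%N).
Hypothesis mass0 : 0 < @gauss_mass R n.
Local Notation V := 'rV[R]_n.
Local Notation L := (lebesgue_space R n).
Local Notation mu := (@leb R n).
Local Notation m := (@order R n alpha).
Local Notation modulus := (modulus alpha).
Local Notation majorant := (@majorant R n alpha).
Implicit Types (x h u : V).

Lemma modulus_le_majorant h : enorm h * modulus (enorm h) / enorm h `^ m <= majorant h.
Proof.
have [->|hn0] := eqVneq h 0; first by rewrite enorm0 !mul0r majorant_ge0.
have hz : enorm h != 0 by rewrite enorm_eq0.
(* A radial field of length [modulus |h|]: for it the Cauchy-Schwarz step of [kint_le_majorant]
   loses nothing. *)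
pose v (h : V) : V := (modulus (enorm h) / enorm h) *: h.
have vh : enorm (v h) <= 1 * modulus (enorm h).
  rewrite enormZ ger0_norm ?divr_ge0 ?modulus_ge0 ?enorm_ge0 //.
  by rewrite divfK // mul1r.
have := kint_le_majorant ler01 vh; rewrite mul1r; apply: le_trans.
apply: le_trans (ler_norm _); rewrite /kint dotZr -sqr_enorm.
rewrite le_eqVlt; apply/orP; left; apply/eqP; congr (_ / _).
by rewrite expr2 mulrA divfK // mulrC.
Qed.

Lemma le_modulus (s t : R) : 0 <= s -> s <= t -> modulus s <= modulus t.
Proof.
move=> s0 st; have b0 : 0 <= (1 + alpha) / 2 by have a0 := alpha0; lra.
have t0 : 0 <= t by exact: le_trans st.
rewrite /modulus le_min; apply/andP; split; last by rewrite ge_min lexx orbT.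
by rewrite ge_min ge0_ler_powR ?nnegrE.
Qed.

Lemma modulus_double (t : R) : 0 <= t -> modulus (2 * t) <= 2 * modulus t.
Proof.
move=> t0; have a0 := alpha0; have a1 := alpha1.
have h2 : (2 : R) `^ ((1 + alpha) / 2) <= 2.
  rewrite -[leRHS]powRr1 // ler_powR ?ler1n //; lra.
rewrite /modulus powRM // -[2 in leRHS]/(2 : R) minr_pMr // le_min; apply/andP; split.
  by rewrite ge_min ler_wpM2r ?powR_ge0.
by rewrite mulr1 ge_min ler1n orbT.
Qed.

Variables (I : finType) (w : I -> R) (z : I -> V) (r : R).
Hypotheses (w0 : forall i, 0 <= w i) (r0 : 0 < r).
Local Notation a := (r ^- 2).
Local Notation k := (@gauss_field R n a).
Local Notation pair_sum := (pair_sum w z).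

Let a0 : 0 < a. Proof. by rewrite invr_gt0 exprn_gt0. Qed.

(** Up to a factor, the squared L^2 distance between a Gaussian regularisation of the point masses
    and its translate by x. *)
Definition gauss_defect x : R := pair_sum (fun u => gauss a u - gauss a (u + x)).
Local Notation S := gauss_defect.

(* Positive definiteness for the points z_i with weights w_i and z_i - x with weights - w_i. *)
Lemma gauss_defect_ge0 x : 0 <= S x.
Proof.
pose c (s : I + I) := match s with inl i => w i | inr i => - w i end.
pose y (s : I + I) := match s with inl i => z i | inr i => z i - x end.
have := gauss_positive_definite n0 c y mass0 a0.
(* The two diagonal blocks each give the sum at 0 and the two mixed blocks each give minus the
   shifted sum: altogether 2 S(x). *)
rewrite big_sumType /=.
under eq_bigr do rewrite big_sumType /=.
under [X in _ + X]eq_bigr do rewrite big_sumType /=.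
rewrite !big_split /=.
have -> : \sum_i \sum_j w i * w j * gauss a (z i - z j) = pair_sum (gauss a) by [].
have -> : \sum_i \sum_j w i * - w j * gauss a (z i - (z j - x)) =
   - pair_sum (fun u => gauss a (u + x)).
  rewrite -mulN1r -pair_sumZ; apply: eq_bigr => i _; apply: eq_bigr => j _.
  by rewrite opprB addrA mulrN mulN1r mulrN mulNr addrAC.
have -> : \sum_i \sum_j - w i * w j * gauss a (z i - x - z j) =
   - pair_sum (fun u => gauss a (u + x)).
  rewrite -mulN1r -pair_sumZ -pair_sumN; apply: eq_bigr => i _; apply: eq_bigr => j _.
  by rewrite mulN1r mulrN !mulNr -(gaussN a (_ + x)) opprD opprK addrAC.
have -> : \sum_i \sum_j - w i * - w j * gauss a (z i - x - (z j - x)) = pair_sum (gauss a).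
  apply: eq_bigr => i _; apply: eq_bigr => j _.
  by rewrite mulrNN opprB addrA subrK.
by rewrite /S pair_sumB; lra.
Qed.

Lemma gauss_defect_cts : continuous S.
Proof.
apply: (@sum_cts R V R^o) => i; apply: (@sum_cts R V R^o) => j.
apply: cts_mul; first exact: cst_continuous.
apply: cts_sub; first exact: cst_continuous.
apply: (@cts_comp _ _ _ (fun x => z i - z j + x) (gauss a)).
  by apply: cts_add; [exact: cst_continuous|exact: cts_id].
exact: continuous_gauss.
Qed.

Definition gauss_defect_deriv (t : R) h : R :=
  2 * a * pair_sum (fun u => dot h (k (u + t *: h))).
Local Notation DS := gauss_defect_deriv.

Lemma isd_gauss_defect (t : R) h : is_derive t 1 (fun t : R => S (t *: h)) (DS t h).
Proof.
have d1 u : is_derive t 1 (fun t => gauss a u - gauss a (u + t *: h))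
    (2 * a * dot h (k (u + t *: h))).
  have := isd_add (isd_cst t (gauss a u))
    (isd_scale (-1) (isd_comp (isd_gauss a _) (isd_dot u h t))).
  rewrite (_ : (fun t => _ + _) = fun t => gauss a u - gauss a (u + t *: h)); last first.
    by apply/funext => s; rewrite mulN1r.
  by move=> /is_derive_eq; apply; rewrite gauss_fieldE dotZr /gauss; ring.
have d2 i : is_derive t 1
    (fun t => \sum_j w i * w j * (gauss a (z i - z j) - gauss a (z i - z j + t *: h)))
    (\sum_j w i * w j * (2 * a * dot h (k (z i - z j + t *: h)))).
  by apply: isd_sum => j; apply: isd_scale; exact: d1.
apply: is_derive_eq (isd_sum (index_enum _) d2) _.
by rewrite /DS -pair_sumZ.
Qed.

Let W2 := (\sum_i w i) ^+ 2.
Let A : R := n%:R * 3 + 2 * (1 + a^-1).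

Lemma gauss_field_increments : increments_le alpha A k.
Proof.
apply: (increments_le_lipschitz alpha0 alpha1 n0); last by rewrite mulr_ge0.
exact: gauss_field_bounded_lipschitz.
Qed.

Let A0 : 0 <= A. Proof. exact: (increments_le_ge0 n0 gauss_field_increments). Qed.

(** Subtracting [k u] costs nothing, since u -> h.k(u) is odd. The increment so created is what
    makes the quotient by |h|^(n+alpha+1) integrable at 0, and at t = 1 it is the increment inside
    [fd]. *)
Lemma gauss_defect_derivE (t : R) h :
  DS t h = 2 * a * pair_sum (fun u => dot h (k (u + t *: h) - k u)).
Proof.
rewrite /DS; congr (_ * _).
rewrite [RHS](_ : _ = pair_sum (fun u => dot h (k (u + t *: h)) - dot h (k u))).
  rewrite pair_sumB [X in _ - X]pair_sum_odd ?subr0 // => u.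
  by rewrite gauss_fieldN dotNr.
by congr pair_sum; apply/funext => u; rewrite dotBr.
Qed.

Lemma gauss_defect_deriv_le (t : R) h : 0 <= t ->
  `|DS t h| <= 2 * a * W2 * A * (enorm h * modulus (t * enorm h)).
Proof.
move=> t0; rewrite gauss_defect_derivE normrM ger0_norm ?mulr_ge0 ?(ltW a0) //.
rewrite -(mulrA (2 * a) W2 A) -(mulrA (2 * a)) -(mulrA W2).
rewrite ler_wpM2l ?mulr_ge0 ?(ltW a0) //.
apply: pair_sum_le => // u; apply: le_trans (cauchy_schwarz _ _) _.
rewrite mulrCA ler_wpM2l ?enorm_ge0 //.
by have := gauss_field_increments.2 u (t *: h); rewrite enormZ ger0_norm.
Qed.

(** S vanishes at 0, so the mean value theorem along the segment from 0 to x passes the bound on the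
    derivative to S. *)
Lemma gauss_defect_le x : `|S x| <= 2 * a * W2 * A * (enorm x * modulus (enorm x)).
Proof.
have [c /andP[c0 c1]] := mean_value ltr01 (fun t => isd_gauss_defect t x).
have -> : S (0 *: x) = 0.
  rewrite /S scale0r pair_sumB; under [X in _ - pair_sum X]eq_fun do rewrite addr0.
  by rewrite subrr.
rewrite scale1r !subr0 mulr1 => ->.
apply: le_trans (gauss_defect_deriv_le _ (ltW c0)) _.
have W20 : 0 <= W2 by exact: sqr_ge0.
have a0' := ltW a0; have C0 : 0 <= 2 * a * W2 * A.
  by apply: mulr_ge0 A0; apply: mulr_ge0 W20; apply: mulr_ge0.
apply: (ler_wpM2l C0); apply: (ler_wpM2l (enorm_ge0 x)); apply: le_modulus.
  by rewrite mulr_ge0 ?enorm_ge0 ?(ltW c0).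
by rewrite ler_piMl ?enorm_ge0 ?(ltW c1).
Qed.

Let W20 : 0 <= W2. Proof. exact: sqr_ge0. Qed.

Let C0 : 0 <= 2 * a * W2 * A.
Proof. by apply: mulr_ge0 A0; apply: mulr_ge0 W20; apply: mulr_ge0 => //; exact: ltW. Qed.

Let quot (g : V -> R) : L -> R := fun h => g h / enorm h `^ m.

Let measurable_quot (g : V -> R) : continuous g -> measurable_fun [set: L] (quot g).
Proof.
move=> cg; apply: measurable_funM; first exact: continuous_measurable_leb.
rewrite (_ : (fun x => _) = (fun x : L => enorm x `^ (- m))).
  exact: measurable_enorm_powR.
by apply/funext => x; rewrite powRN.
Qed.

Let quot_le (g : V -> R) (B : R) h : 0 <= B ->
  `|g h| <= B * (enorm h * modulus (enorm h)) -> `|quot g h| <= B * majorant h.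
Proof.
move=> B0 gB; rewrite /quot normrM normfV (ger0_norm (powR_ge0 _ _)).
apply: (@le_trans _ _ (B * (enorm h * modulus (enorm h) / enorm h `^ m))).
  by rewrite mulrA ler_wpM2r ?invr_ge0 ?powR_ge0.
by rewrite ler_wpM2l // modulus_le_majorant.
Qed.

Let integrable_quot (g : V -> R) (B : R) : continuous g -> 0 <= B ->
  (forall h, `|g h| <= B * (enorm h * modulus (enorm h))) ->
  mu.-integrable [set: L] (EFin \o quot g).
Proof.
move=> cg B0 gB; have iM := integrable_majorant alpha0 alpha1 n0.
apply: (le_integrable_real measurableT _ _ (integrable_scaler measurableT B iM)).
- exact: measurable_quot.
- by move=> h _; exact: quot_le.
Qed.

(** Gives one majorant for all t in (1/2, 2), as differentiation under the integral at t = 1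
    requires. *)
Let scale_modulus (t : R) h : 0 <= t -> t <= 2 ->
  enorm h * modulus (t * enorm h) <= 2 * (enorm h * modulus (enorm h)).
Proof.
move=> t0 t2; rewrite mulrCA ler_wpM2l ?enorm_ge0 //.
apply: le_trans (modulus_double (enorm_ge0 h)); apply: le_modulus.
  by rewrite mulr_ge0 ?enorm_ge0.
by rewrite ler_wpM2r ?enorm_ge0.
Qed.

(** Since n + alpha + 1 = n + 2 s for s = (1+alpha)/2, this is up to a factor the squared Gagliardo
    seminorm of order s of the regularised masses. *)
Definition defect_energy : R := \int[mu]_h (S h / enorm h `^ m).
Local Notation Q := defect_energy.

Let integrable_S : mu.-integrable [set: L] (EFin \o quot S).
Proof.
exact: integrable_quot gauss_defect_cts C0 gauss_defect_le.
Qed.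

Lemma integrable_defect :
  mu.-integrable [set: L] (EFin \o (fun h : L => S h / enorm h `^ m)).
Proof. exact: integrable_S. Qed.

(** Substituting t h for h, the denominator contributes t^(n+alpha+1) and the volume t^(-n). *)
Let dilate (t : R) : 0 < t ->
  mu.-integrable [set: L] (EFin \o (fun h : L => S (t *: h) / enorm h `^ m)) /\
  \int[mu]_h (S (t *: h) / enorm h `^ m) = t `^ (1 + alpha) * Q.
Proof.
move=> t0.
have E (h : L) : S (t *: h) / enorm h `^ m = t `^ m * quot S (affine t 0 h).
  rewrite /quot /affine addr0 enormZ (ger0_norm (ltW t0)) powRM ?enorm_ge0 ?(ltW t0) //.
  have tm : t `^ m != 0 by rewrite gt_eqF ?powR_gt0.
  by rewrite invfM mulrCA (mulrA (t `^ m)) divff // mul1r.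
have iE := integrable_scaler measurableT (t `^ m) (integrable_affine 0 t0 integrable_S).
split; first by apply: eq_integrable iE => // h _ /=; rewrite E.
under eq_Rintegral do rewrite E.
etransitivity.
  exact: (RintegralZl (t `^ m) measurableT (integrable_affine 0 t0 integrable_S)).
rewrite (Rintegral_affine 0 t0 integrable_S) mulrA; congr (_ * _).
rewrite exprVn -powR_mulrn ?(ltW t0) // -powRN -powRD; last first.
  by rewrite (gt_eqF t0) implybT.
by congr (_ `^ _); rewrite /order; ring.
Qed.

Let F (t : R) (h : L) : R := S (t *: h) / enorm h `^ m.

Let isd_F (t : R) h : is_derive t 1 (F^~ h) (DS t h / enorm h `^ m).
Proof.
have := isd_scale (enorm h `^ m)^-1 (isd_gauss_defect t h).
rewrite mulrC; congr (is_derive _ _ _ _); apply/funext => s; exact: mulrC.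
Qed.

(* Both sides are the derivative at t = 1 of
   [int S (t h) / |h|^m dh = t^(1 + alpha) Q], obtained by differentiation under the
   integral and by scaling; this replaces an integration by parts in polar coordinates. *)
Lemma defect_energy_derivative :
  \int[mu]_h (DS 1 h / enorm h `^ m) = (1 + alpha) * Q.
Proof.
have I1 : `](1/2)%R, 2%R[%classic (1 : R) by rewrite /= in_itv /=; apply/andP; split; lra.
have iM := integrable_majorant alpha0 alpha1 n0.
have B0 : 0 <= 2 * a * W2 * A * 2 by rewrite mulr_ge0.
have := @differentiation_under_integral R _ L mu F setT measurableT 1 (1/2) 2 I1.
have h1 (t : R) : `](1/2)%R, 2%R[%classic t -> mu.-integrable [set: L] (EFin \o F t).
  rewrite /= in_itv /= => /andP[t1 _]; apply: (dilate _).1; lra.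
have h2 (t : R) (h : L) : `](1/2)%R, 2%R[%classic t -> setT h -> derivable (F^~ h) t 1.
  by move=> _ _; have [] := isd_F t h.
have h3 (t : R) (h : L) : `](1/2)%R, 2%R[%classic t -> setT h ->
    `|partial1of2 F t h| <= 2 * a * W2 * A * 2 * majorant h.
  rewrite /= in_itv /= => /andP[t1 t2] _; rewrite partial1of2E.
  have t0 : 0 <= t by lra.
  rewrite (@derive_val _ _ _ _ _ _ _ (isd_F t h)).
  apply: (quot_le (g := DS t)) => //.
  apply: le_trans (gauss_defect_deriv_le h t0) _.
  by rewrite -(mulrA _ 2) ler_wpM2l // scale_modulus // ltW.
have h4 (h : L) : 0 <= 2 * a * W2 * A * 2 * majorant h by rewrite mulr_ge0 // majorant_ge0.
move=> /(_ h1 h2 _ h4 (integrable_scaler measurableT _ iM) h3).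
rewrite derive1E => E.
rewrite (_ : \int[mu]_h _ = \int[mu]_h partial1of2 F 1 h); last first.
  by apply: eq_Rintegral => h _; rewrite partial1of2E (@derive_val _ _ _ _ _ _ _ (isd_F 1 h)).
rewrite -E.
rewrite (near_eq_derive _ (g := fun t : R => t `^ (1 + alpha) * Q)); last first.
  near=> t; apply: (dilate _).2; near: t; exact: lt_nbhsr.
have D := isd_mul (is_derive1_powR (1 + alpha) ltr01) (isd_cst 1 Q).
rewrite (@derive_val _ _ _ _ _ _ _ D) powR1 mulr0 add0r mulr1.
by rewrite mulrC.
Unshelve. all: end_near. Qed.

(** As [2 * a] times k is minus the gradient of [gauss a], the left side pairs -div^alpha grad of
    the Gaussian with the masses, a quadratic form of order 1 + alpha like the seminorm Q. The proof
    recognises the integrand of [defect_energy_derivative] as a finite sum of those of [fd]. *)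
Lemma pair_sum_fd : 2 * a * pair_sum (fd alpha k) = (1 + alpha) * Q.
Proof.
rewrite -defect_energy_derivative.
have ik i j := integrable_scaler measurableT (w i * w j)
  (integrable_kint alpha0 alpha1 n0 (z i - z j) gauss_field_increments).
have E (h : L) : DS 1 h / enorm h `^ m =
    2 * a * \sum_i \sum_j (w i * w j * kint alpha (fun h => k (z i - z j + h) - k (z i - z j)) h).
  rewrite gauss_defect_derivE scale1r -[LHS]mulrA; congr (_ * _); rewrite /pair_sum.
  rewrite mulr_suml; apply: eq_bigr => i _; rewrite mulr_suml; apply: eq_bigr => j _.
  by rewrite mulrA.
under eq_Rintegral do rewrite E.
have ik' i : mu.-integrable [set: L] (EFin \o (fun h : L =>
   \sum_j (w i * w j * kint alpha (fun h => k (z i - z j + h) - k (z i - z j)) h))).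
  exact: integrable_sumr.
rewrite RintegralZl //; last exact: integrable_sumr.
rewrite Rintegral_sum //; congr (_ * _); apply: eq_bigr => i _.
rewrite Rintegral_sum //; apply: eq_bigr => j _.
by rewrite RintegralZl //; exact: (integrable_kint alpha0 alpha1 n0 _ gauss_field_increments).
Qed.

End energy.

Section energy_lower_bound.
Context {R : realType} {n : nat} (alpha : R).
Hypotheses (alpha0 : 0 < alpha) (alpha1 : alpha < 1) (n0 : (0 < n)%N).
Hypothesis mass0 : 0 < @gauss_mass R n.
Local Notation V := 'rV[R]_n.
Local Notation L := (lebesgue_space R n).
Local Notation mu := (@leb R n).
Local Notation m := (@order R n alpha).

Definition scale_sum (I : finType) (w : I -> R) (z : I -> V) (r : R) : R :=
  r ^- n * pair_sum w z (gauss (r ^- 2)).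

(** The exponent is fixed twice: it makes the energy at scale r scale-free, see [pE] below, and the
    field of size r^alpha, see [scale_weightK]. *)
Definition scale_weight (r : R) : R := r `^ (alpha - 1 - n%:R).

Let order_ge0 : 0 <= m.
Proof. by rewrite /order !addr_ge0 // ltW. Qed.

(** With a = r^-2 and b = a/3, a b/(a+b) = a/4 is exactly the exponent of scale 2 r, and
    (a+b)^(-1/2) is half of b^(-1/2). The resulting factor 2^-n is the one between r^-n and (2
    r)^-n, so both scale sums get the same coefficient. *)
Lemma gauss_defect_integral (I : finType) (w : I -> R) (z : I -> V) (r : R) : 0 < r ->
  let b := (Num.sqrt 3 * r) ^- 2 in
  mu.-integrable [set: L] (EFin \o (fun h : L => gauss_defect w z r h * gauss b h)) /\
  \int[mu]_h (gauss_defect w z r h * gauss b h) =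
  Num.sqrt 3 ^+ n * @gauss_mass R n * r ^+ (2 * n) *
  (scale_sum w z r - scale_sum w z (2 * r)).
Proof.
move=> r0 b; set a := r ^- 2; set q := Num.sqrt 3.
have q0 : 0 < q by rewrite sqrtr_gt0.
have q2 : q ^+ 2 = 3 by rewrite sqr_sqrtr.
have rn0 : r != 0 by rewrite gt_eqF.
have qn0 : q != 0 by rewrite gt_eqF.
have a0 : 0 < a by rewrite invr_gt0 exprn_gt0.
have qr0 : 0 < q * r by rewrite mulr_gt0.
have b0 : 0 < b by rewrite invr_gt0 exprn_gt0.
have s0 : 0 < q * r / 2 by rewrite divr_gt0.
have bE : b = a / 3 by rewrite /b exprMn -/q q2 /a invfM mulrC.
have abE : a + b = (q * r / 2) ^- 2.
  by rewrite bE /a exprMn exprMn q2; field.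
have ab2 : a * b / (a + b) = (2 * r) ^- 2.
  by rewrite bE /a exprMn; field; rewrite rn0.
pose g i j (h : L) := w i * w j * (gauss a (z i - z j) * gauss b h
   - gauss a (z i - z j + h) * gauss b h).
have gb : mu.-integrable [set: L] (EFin \o (fun h : L => gauss b h)).
  have := integrable_gauss_translate n0 0 b0.
  by apply: eq_integrable => // h _; rewrite /= addr0.
have gbi : \int[mu]_h gauss b h = (q * r) ^+ n * @gauss_mass R n.
  by rewrite -(Rintegral_gauss n0 0 qr0); apply: eq_Rintegral => h _; rewrite addr0.
have i1 i j := integrable_scaler measurableT (gauss a (z i - z j)) gb.
have i2 i j := integrable_gauss_mul n0 (z i - z j) a0 b0.
have ig i j : mu.-integrable [set: L] (EFin \o g i j).
  exact: (integrable_scaler measurableT _ (integrable_subr measurableT (i1 i j) (i2 i j))).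
have gE (h : L) : gauss_defect w z r h * gauss b h = \sum_i \sum_j g i j h.
  rewrite /gauss_defect /pair_sum mulr_suml; apply: eq_bigr => i _.
  by rewrite mulr_suml; apply: eq_bigr => j _; rewrite /g -mulrBl mulrA.
have igi i : mu.-integrable [set: L] (EFin \o (fun h => \sum_j g i j h)).
  exact: integrable_sumr.
rewrite (_ : (fun h : L => _ * _) = fun h => \sum_i \sum_j g i j h); last exact/funext.
split; first exact: integrable_sumr.
rewrite Rintegral_sum //.
transitivity (\sum_i \sum_j w i * w j *
    (gauss a (z i - z j) * ((q * r) ^+ n * @gauss_mass R n)
     - gauss ((2 * r) ^- 2) (z i - z j) * ((q * r / 2) ^+ n * @gauss_mass R n))).
  apply: eq_bigr => i _; rewrite Rintegral_sum //; apply: eq_bigr => j _.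
  rewrite (RintegralZl _ measurableT (integrable_subr measurableT (i1 i j) (i2 i j))).
  congr (_ * _); rewrite (RintegralB measurableT (i1 i j) (i2 i j)).
  by rewrite (RintegralZl _ measurableT gb) gbi (Rintegral_gauss_mul n0 _ a0 b0 s0 abE) ab2.
rewrite /scale_sum mulrBr /pair_sum !mulr_sumr -sumrB; apply: eq_bigr => i _.
rewrite !mulr_sumr -sumrB; apply: eq_bigr => j _.
rewrite !exprMn exprVn mulnC exprM expr2.
by field; rewrite ?expf_neq0.
Qed.

(* [|h|^(-m) >= c r^(-m) exp(- |h|^2 / (3 r^2))] bounds the defect energy below by a Gaussian
   integral; the width sqrt 3 r is the one that turns scale r into scale 2 r. *)
Lemma energy_lower_bound : exists2 c : R, 0 < c &
  forall (I : finType) (w : I -> R) (z : I -> V) (r : R), (forall i, 0 <= w i) -> 0 < r ->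
  c * (scale_sum w z r - scale_sum w z (2 * r)) <=
  scale_weight r * pair_sum w z (fd alpha (gauss_field (r ^- 2))).
Proof.
have [|C C0 CP] := @powR_gauss_bounded R m 3^-1 order_ge0; first by rewrite invr_gt0.
pose q : R := Num.sqrt 3; set Cn := @gauss_mass R n.
have q0 : 0 < q by rewrite sqrtr_gt0.
have q2 : q ^+ 2 = 3 by rewrite sqr_sqrtr.
exists (q ^+ n * Cn / (2 * C)).
  by rewrite divr_gt0 ?mulr_gt0 ?exprn_gt0.
move=> I w z r w0 r0; have rn0 : r != 0 by rewrite gt_eqF.
set b := (q * r) ^- 2.
have S0 x := gauss_defect_ge0 n0 mass0 w z r0 x.
have [iS ES] := gauss_defect_integral w z r0.
have Qge : C^-1 * r `^ (- m) * \int[mu]_h (gauss_defect w z r h * gauss b h) <=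
    defect_energy alpha w z r.
  rewrite -(RintegralZl _ measurableT iS).
  apply: le_Rintegral => //.
  - exact: integrable_scaler.
  - exact: integrable_defect.
  - move=> h _.
    have [->|hn0] := eqVneq h 0.
      rewrite (_ : gauss_defect w z r 0 = 0) ?mul0r ?mulr0 //.
      rewrite /gauss_defect pair_sumB.
      by under [X in _ - pair_sum _ _ X]eq_fun do rewrite addr0; rewrite subrr.
    have hp : 0 < enorm h by rewrite enorm_gt0.
    rewrite mulrCA ler_wpM2l //.
    rewrite -mulrA ler_pdivrMl // ler_pdivlMr ?powR_gt0 //.
    apply: le_trans (CP (enorm h / r) _); last by rewrite divr_ge0 ?(ltW hp) ?(ltW r0).
    rewrite powRM ?(ltW hp) ?invr_ge0 ?(ltW r0) // powR_invE ?(ltW r0) //.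
    rewrite le_eqVlt; apply/orP; left; apply/eqP.
    have -> : gauss b h = expR (- (3^-1 * (enorm h / r) ^+ 2)).
      congr (expR (- _)); rewrite /b -sqr_enorm !exprMn q2 invfM exprVn.
      by rewrite -mulrA (mulrC (r ^- 2)).
    by rewrite mulrC mulrA.
have E := pair_sum_fd alpha0 alpha1 n0 z w0 r0.
have Q0 : 0 <= defect_energy alpha w z r.
  by apply: Rintegral_ge0 => h _; rewrite divr_ge0 ?powR_ge0.
have wt0 : 0 <= scale_weight r by exact: powR_ge0.
set D := pair_sum _ _ _ in E *.
(* From [pair_sum_fd], bounding the factor 1 + alpha below by 1. *)
have DQ : r ^+ 2 / 2 * defect_energy alpha w z r <= D.
  have -> : D = r ^+ 2 / 2 * (2 * r ^- 2 * D) by field; rewrite rn0.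
  rewrite E ler_wpM2l ?divr_ge0 ?sqr_ge0 // ler_peMl // lerDl ltW //.
apply: le_trans (ler_wpM2l wt0 DQ).
have r20 : 0 <= scale_weight r * (r ^+ 2 / 2) by rewrite mulr_ge0 // divr_ge0 ?sqr_ge0.
rewrite mulrA; apply: le_trans (ler_wpM2l r20 Qge).
rewrite ES -/q -/Cn /scale_weight.
(* All powers of r cancel: (alpha-1-n) - (n+alpha+1) + 2 + 2n = 0, so the constant is the same at
   every scale. *)
have pE : r `^ (alpha - 1 - n%:R) * r `^ (- m) * (r ^+ 2 * r ^+ (2 * n)) = 1.
  rewrite -powRD; last by rewrite rn0 implybT.
  rewrite -!powR_mulrn ?(ltW r0) // -powRD; last by rewrite rn0 implybT.
  rewrite -powRD; last by rewrite rn0 implybT.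
  by rewrite natrM (_ : _ + _ = 0) ?powRr0 // /order; ring.
rewrite le_eqVlt; apply/orP; left; apply/eqP.
transitivity (r `^ (alpha - 1 - n%:R) * r `^ (- m) * (r ^+ 2 * r ^+ (2 * n)) *
  (q ^+ n * Cn / (2 * C)) * (scale_sum w z r - scale_sum w z (2 * r))).
  by rewrite pE mul1r.
by field; rewrite gt_eqF.
Qed.

End energy_lower_bound.

(** * Smooth truncation *)

Section flat_functions.
Context {R : realType}.
Implicit Types (u t x : R) (m : nat).

(* The family is closed under differentiation, see [isd_flat]. *)
Definition flat m u : R := if 0 < u then u^-1 ^+ m * expR (- u^-1) else 0.

Lemma flat_ge0 m u : 0 <= flat m u.
Proof.
by rewrite /flat; case: ifP => // u0; rewrite mulr_ge0 ?expR_ge0 ?exprn_ge0 ?invr_ge0 ?ltW.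
Qed.

Lemma exprn_expRN_le m (y : R) : 0 <= y -> y ^+ m * expR (- y) <= m`!%:R.
Proof.
move=> y0; rewrite expRN ler_pdivrMr ?expR_gt0 //.
case: m => [|m]; first by rewrite expr0 mul1r -expR0 ler_expR.
have f0 : 0 < m.+1`!%:R :> R by rewrite ltr0n fact_gt0.
have := expR_ge1Dxn m y0; rewrite -lerBrDl ler_pdivrMr // mulrC => /le_trans; apply.
by rewrite ler_wpM2l ?(ltW f0) // lerBlDr lerDl.
Qed.

Lemma flat_le m u : flat m u <= m`!%:R.
Proof.
rewrite /flat; case: ifP => // u0.
by apply: exprn_expRN_le; rewrite invr_ge0 ltW.
Qed.

Lemma isd_quadratic (f : R -> R) (C : R) : f 0 = 0 -> (forall h, `|f h| <= C * h ^+ 2) ->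
  is_derive (0 : R) 1 f 0.
Proof.
move=> f0 fC.
have cv : (fun h => h^-1 *: ((f \o shift 0) (h *: (1 : R)) - f 0)) @ 0^' --> (0 : R).
  apply/(@cvgrPdist_le R R _ (0 : R)^' _) => e e0.
  have C1 : 0 < `|C| + 1 by rewrite ltr_pwDr.
  near=> h.
  have h0 : h != 0 by near: h; exact: nbhs_dnbhs_neq.
  rewrite sub0r normrN f0 subr0 /= /shift addr0 scaler1 -[_ *: _]/(h^-1 * f h).
  rewrite normrM normfV ler_pdivrMl ?normr_gt0 //.
  apply: le_trans (fC h) _; rewrite -[h ^+ 2]real_normK ?num_real // expr2 mulrA mulrC.
  rewrite ler_wpM2l //.
  apply: (@le_trans _ _ ((`|C| + 1) * `|h|)).
    by rewrite ler_wpM2r // (le_trans (ler_norm C)) // lerDl.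
  rewrite mulrC -ler_pdivlMr // ltW //.
  by near: h; apply: dnbhs0_lt; rewrite divr_gt0.
by apply: DeriveDef; [apply/cvg_ex; exists 0|exact/cvg_lim].
Unshelve. all: end_near. Qed.

Lemma isd_flat m u : is_derive u 1 (flat m) (flat m.+2 u - m%:R * flat m.+1 u).
Proof.
have [u0|u0|<-] := ltgtP 0 u.
- have un0 : u != 0 by rewrite gt_eqF.
  have Dv : is_derive u 1 (fun u : R => u^-1) (- u ^- 2).
    by apply: is_derive_eq (is_deriveV un0 (isd_id u)) _; rewrite /GRing.scale /= mulr1.
  have Dx : is_derive u 1 (fun u : R => u^-1 ^+ m) (- (m%:R * u^-1 ^+ m.+1)).
    elim: m => [|k IH].
      rewrite (_ : (fun _ => _) = fun=> 1); last by apply/funext => s; rewrite expr0.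
      by rewrite mul0r oppr0; exact: isd_cst.
    rewrite (_ : (fun _ => _) = fun u => u^-1 * u^-1 ^+ k); last first.
      by apply/funext => s; rewrite exprS.
    apply: is_derive_eq (isd_mul Dv IH) _; rewrite -exprVn -natr1 !exprS; ring.
  have De : is_derive u 1 (fun u : R => expR (- u^-1)) (u^-1 ^+ 2 * expR (- u^-1)).
    have DN := isd_scale (-1) Dv.
    rewrite (_ : (fun u => -1 * _) = fun u => - u^-1) in DN; last by apply/funext => s; rewrite mulN1r.
    by apply: is_derive_eq (isd_comp (is_derive_expR _) DN) _; rewrite mulN1r opprK mulrC exprVn.
  have D := isd_mul Dx De.
  rewrite /flat u0; apply: near_eq_is_derive (is_derive_eq D _).
    near=> v; have v0 : 0 < v by near: v; exact: lt_nbhsr.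
    by rewrite v0.
  by rewrite -(addn2 m) exprD; ring.
- rewrite /flat (ltNge 0 u) (ltW u0) /= mulr0 subr0.
  apply: near_eq_is_derive (isd_cst u 0).
  near=> v; have v0 : v < 0 by near: v; exact: lt_nbhsl.
  by rewrite ltNge (ltW v0).
(* At the origin: for h > 0, flat m h = h^2 (1/h)^(m+2) exp(-1/h) <= (m+2)! h^2, so the derivative
   is 0. *)
- rewrite /flat ltxx mulr0 subr0.
  apply: (@isd_quadratic _ (m.+2`!%:R)).
    by rewrite ltxx.
  move=> h; case: ifP => h0; last by rewrite normr0 mulr_ge0 ?sqr_ge0.
  have hn : h != 0 by rewrite gt_eqF.
  rewrite ger0_norm; last by rewrite mulr_ge0 ?expR_ge0 ?exprn_ge0 ?invr_ge0 ?ltW.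
  rewrite -ler_pdivrMr ?exprn_gt0 //.
  have hV : 0 <= h^-1 by rewrite invr_ge0 ltW.
  have := exprn_expRN_le m.+2 hV; congr (_ <= _).
  by rewrite -addn2 exprD -(exprVn h) mulrAC.
Unshelve. all: end_near. Qed.

End flat_functions.

Section smooth_fields.
Context {R : realType} {n : nat}.
Local Notation V := 'rV[R]_n.
Implicit Types (x c v : V) (f : V -> R).

(* A class of smooth functions containing the truncated Gaussians and closed under partial
   derivatives, so that smoothness needs no multivariate chain rule. *)
Inductive elementary : (V -> R) -> Prop :=
| elementary_cst (a : R) : elementary (fun=> a)
| elementary_coord i : elementary (fun x => x 0 i)
| elementary_exp (a : R) c : elementary (fun x => expR (- (a * dot (x - c) (x - c))))
| elementary_flat (m : nat) (a b : R) c :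
    elementary (fun x => flat m (b - a * dot (x - c) (x - c)))
| elementary_add f g : elementary f -> elementary g -> elementary (fun x => f x + g x)
| elementary_mul f g : elementary f -> elementary g -> elementary (fun x => f x * g x).

(** Reduces directional derivatives on row vectors to the one-variable rules. *)
Lemma is_derive_line (f : V -> R) x v (d : R) :
  is_derive (0 : R) 1 (fun t : R => f (x + t *: v)) d -> is_derive x v f d.
Proof.
have E : (fun h : R => h^-1 *: (((fun t : R => f (x + t *: v)) \o shift 0) (h *: (1 : R))
      - f (x + 0 *: v))) = (fun h => h^-1 *: ((f \o shift x) (h *: v) - f x)).
  apply/funext => h; rewrite /= /shift scale0r !addr0 (addrC (h *: v)).
  by rewrite -[h *: (1 : R)]/(h * 1) mulr1.
case=> D1 D2; apply: DeriveDef.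
  by move: D1; rewrite /derivable E.
by rewrite -D2 /derive E.
Qed.

Lemma elementary_derive f (i : 'I_n) : elementary f ->
  exists2 g, elementary g & forall x, is_derive x (delta_mx 0 i) f (g x).
Proof.
have qE c x (t : R) : x + t *: delta_mx 0 i - c = (x - c) + t *: delta_mx 0 i.
  by rewrite addrAC.
have Dq c x : is_derive (0 : R) 1 (fun t : R =>
    dot (x + t *: delta_mx 0 i - c) (x + t *: delta_mx 0 i - c)) (2 * (x 0 i - c 0 i)).
  rewrite (_ : (fun t : R => _) = fun t : R =>
    dot ((x - c) + t *: delta_mx 0 i) ((x - c) + t *: delta_mx 0 i)); last first.
    by apply/funext => t; rewrite qE.
  apply: is_derive_eq (isd_dot (x - c) (delta_mx 0 i) 0) _; congr (_ * _).
  rewrite scale0r addr0 /dot (bigD1 i) //= big1 => [|j /negPf ji].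
    by rewrite !mxE !eqxx mul1r addr0.
  by rewrite !mxE eqxx ji mul0r.
have el_q c : elementary (fun x => 2 * (x 0 i - c 0 i)).
  apply: elementary_mul; first exact: elementary_cst.
  by apply: elementary_add; [exact: elementary_coord|exact: elementary_cst].
elim=> [a|j|a c|m a b c|{}f g fe [df dfe fD] ge [dg dge gD]|{}f g fe [df dfe fD] ge [dg dge gD]].
- by exists (fun=> 0) => [|x]; [exact: elementary_cst|exact: is_derive_cst].
- exists (fun=> delta_mx (R := R) 0 i (0 : 'I_1) j) => [|x]; first exact: elementary_cst.
  by apply: is_derive_line; exact: isd_coord.
- exists (fun x => (- a * expR (- (a * dot (x - c) (x - c)))) * (2 * (x 0 i - c 0 i))).
    apply: elementary_mul (el_q c); apply: elementary_mul; first exact: elementary_cst.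
    exact: elementary_exp.
  move=> x; apply: is_derive_line.
  apply: is_derive_eq (isd_comp (isd_gauss a _) (Dq c x)) _.
  by rewrite scale0r addr0.
- exists (fun x => (flat m.+2 (b - a * dot (x - c) (x - c)) +
      (- m%:R) * flat m.+1 (b - a * dot (x - c) (x - c))) * ((- a) * (2 * (x 0 i - c 0 i)))).
    apply: elementary_mul.
      apply: elementary_add; first exact: elementary_flat.
      by apply: elementary_mul; [exact: elementary_cst|exact: elementary_flat].
    by apply: elementary_mul; [exact: elementary_cst|exact: el_q].
  move=> x; apply: is_derive_line.
  have D := isd_add (isd_cst 0 b) (isd_scale (- a) (Dq c x)).
  rewrite (_ : (fun t : R => b + _) = fun t : R =>
    b - a * dot (x + t *: delta_mx 0 i - c) (x + t *: delta_mx 0 i - c)) in D; last first.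
    by apply/funext => t; rewrite mulNr.
  apply: is_derive_eq (isd_comp (isd_flat m _) D) _.
  by rewrite scale0r addr0 add0r mulNr.
- exists (fun x => df x + dg x) => [|x]; first exact: elementary_add.
  exact: is_deriveD.
- exists (fun x => f x * dg x + g x * df x) => [|x].
    by apply: elementary_add; exact: elementary_mul.
  exact: is_deriveM.
Qed.

Lemma elementary_continuous f : elementary f -> continuous f.
Proof.
have cq c : continuous (fun x : V => dot (x - c) (x - c)).
  have cc : continuous (fun x : V => x - c).
    by apply: cts_sub; [exact: cts_id|exact: cst_continuous].
  exact: dot_cts.
elim=> [a|j|a c|m a b c|{}f g _ cf _ cg|{}f g _ cf _ cg].
- exact: cst_continuous.
- exact: coord_cts.
- exact: (cts_comp (cq c) (isd_cts (isd_gauss a))).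
- apply: (@cts_comp V R R (fun x => b - a * dot (x - c) (x - c)) (flat m)).
    apply: cts_sub; first exact: cst_continuous.
    by apply: cts_mul; [exact: cst_continuous|exact: cq].
  exact: isd_cts (isd_flat m).
- exact: cts_add.
- exact: cts_mul.
Qed.

Lemma row_cts (phi : V -> V) : (forall j, continuous (fun x => phi x 0 j)) -> continuous phi.
Proof.
move=> cphi; rewrite (_ : phi = fun x => \sum_j phi x 0 j *: delta_mx 0 j).
  by apply: sum_cts => j; apply: cts_scale => //; exact: cst_continuous.
by apply/funext => x; exact: row_sum_delta.
Qed.

(** The induction on the order runs over all fields at once, because each partial derivative of phi
    is a new field with elementary coordinates. *)
Lemma elementary_smooth (phi : V -> V) :
  (forall j, elementary (fun x => phi x 0 j)) -> smooth phi.
Proof.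
move=> ephi k; elim: k phi ephi => [|k IH] phi ephi /=.
  by split => //; apply: row_cts => j; exact: elementary_continuous.
split=> [|i]; first by apply: row_cts => j; exact: elementary_continuous.
have dphi x : derivable phi x (delta_mx 0 i).
  apply/derivable_mxP => i0 j; rewrite (ord1 i0).
  by have [g _ /(_ x) []] := elementary_derive i (ephi j).
split=> //; apply: IH => j.
have [g ge gD] := elementary_derive i (ephi j).
rewrite (_ : (fun x => _) = g) //; apply/funext => x.
by rewrite derive_mx // mxE; exact: (@derive_val _ _ _ _ _ _ _ (gD x)).
Qed.

Lemma bounded_support_compact (phi : V -> V) (M : R) :
  (forall x, phi x != 0 -> `|x| <= M) -> compactly_supported phi.
Proof.
move=> phiM.
have cM : closed [set x : V | `|x| <= M].
  rewrite (_ : [set _ | _] = (fun x : V => `|x|) @^-1` [set t | t <= M]) //.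
  apply: preimage_closed; last exact: closed_le.
  by move=> x _; exact: norm_continuous.
have sM : closure [set x | phi x != 0] `<=` [set x | `|x| <= M].
  by rewrite closureE; apply: smallest_sub => // x /= /phiM.
apply: bounded_closed_compact; last exact: closed_closure.
exists M; split; first exact: num_real.
by move=> N MN x /sM /= xM; exact: le_trans xM (ltW MN).
Qed.

End smooth_fields.

(** * Compactly supported approximations of the Gaussian field *)

Section truncated_gaussian_field.
Context {R : realType} {n : nat}.
Local Notation V := 'rV[R]_n.
Implicit Types (x c : V) (a t T : R).

(** The factor [expR 1] normalises the value at 0 to 1. There is no plateau: on t >= 0 the value 1
    is taken only at 0, and [cutoff_near1] gives closeness to 1 at a linear rate. *)
Definition cutoff t : R := expR 1 * flat 0 (1 - t).

Lemma isd_cutoff t : is_derive t 1 cutoff (- (expR 1 * flat 2 (1 - t))).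
Proof.
have D := isd_add (isd_cst t 1) (isd_scale (-1) (isd_id t)).
rewrite (_ : (fun t : R => 1 + _) = fun t : R => 1 - t) in D; last first.
  by apply/funext => s; rewrite mulN1r.
apply: is_derive_eq (isd_scale (expR 1) (isd_comp (isd_flat 0 _) D)) _.
by rewrite mul0r subr0 mulr1 add0r mulrN1 mulrN.
Qed.

Lemma cutoff_ge0 t : 0 <= cutoff t.
Proof. by rewrite mulr_ge0 ?expR_ge0 ?flat_ge0. Qed.

Lemma cutoff_eq0 t : 1 <= t -> cutoff t = 0.
Proof. by move=> t1; rewrite /cutoff /flat subr_gt0 ltNge t1 mulr0. Qed.

Lemma cutoff_le1 t : 0 <= t -> cutoff t <= 1.
Proof.
move=> t0; rewrite /cutoff /flat subr_gt0; case: ifP => t1; last by rewrite mulr0.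
rewrite expr0 mul1r -expRD -[leRHS]expR0 ler_expR subr_le0 -[leLHS]invr1 lef_pV2 ?posrE //.
  by rewrite gerBl.
by rewrite subr_gt0.
Qed.

Lemma cutoff_deriv_le t : `|- (expR 1 * flat 2 (1 - t))| <= 2 * expR 1.
Proof.
rewrite normrN ger0_norm ?mulr_ge0 ?expR_ge0 ?flat_ge0 // mulrC.
by rewrite ler_wpM2r ?expR_ge0 // (le_trans (flat_le _ _)).
Qed.

Lemma cutoff_near1 t : 0 <= t -> `|1 - cutoff t| <= 2 * expR 1 * t.
Proof.
rewrite le_eqVlt => /orP[/eqP <-|t0].
  rewrite /cutoff /flat subr0 ltr01 expr0 mul1r invr1 -expRD subrr expR0 subrr.
  by rewrite normr0 mulr0.
have [c _] := mean_value t0 isd_cutoff.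
have -> : cutoff 0 = 1.
  by rewrite /cutoff /flat subr0 ltr01 expr0 mul1r invr1 -expRD subrr expR0.
rewrite -normrN opprB subr0 => ->.
by rewrite normrM (ger0_norm (ltW t0)) ler_wpM2r ?(ltW t0) ?cutoff_deriv_le.
Qed.

(** T is measured in the units of the Gaussian exponent: the field lives where a |x|^2 < T. *)
Definition truncated_field a T : V -> V :=
  radial (fun t => expR (- (a * t)) * cutoff (a / T * t)).

Lemma truncated_field_elementary a T c j :
  elementary (fun x => truncated_field a T (x - c) 0 j).
Proof.
rewrite (_ : (fun x => _) = fun x => (expR (- (a * dot (x - c) (x - c))) *
   (expR 1 * flat 0 (1 - a / T * dot (x - c) (x - c)))) * (x 0 j - c 0 j)).
  apply: elementary_mul.
    apply: elementary_mul; first exact: elementary_exp.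
    by apply: elementary_mul; [exact: elementary_cst|exact: elementary_flat].
  by apply: elementary_add; [exact: elementary_coord|exact: elementary_cst].
by apply/funext => x; rewrite !mxE.
Qed.

Lemma truncated_field_eq0 a T x : 0 < a -> 0 < T -> T / a <= dot x x ->
  truncated_field a T x = 0.
Proof.
move=> a0 T0; rewrite ler_pdivrMr // => xT.
rewrite /truncated_field /radial cutoff_eq0 ?mulr0 ?scale0r //.
by rewrite mulrAC ler_pdivlMr // mul1r mulrC.
Qed.

Lemma truncated_field_le a T x : 0 < a -> 0 < T ->
  enorm (truncated_field a T x) <= enorm (gauss_field a x).
Proof.
move=> a0 T0; rewrite !enorm_radial ler_wpM2r ?enorm_ge0 //.
rewrite normrM ler_piMr // ger0_norm ?cutoff_ge0 // cutoff_le1 //.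
by rewrite mulr_ge0 ?sqr_ge0 // divr_ge0 ?(ltW a0) ?(ltW T0).
Qed.

(** The point is that the constants do not depend on T, so T can be sent to infinity with a fixed
    Lipschitz bound. Since |p'| / T <= 2 e for T >= 1, the constant is 1 + 2 (2 e + 1). *)
Lemma truncated_field_bounded_lipschitz a T : 0 < a -> 1 <= T ->
  bounded_lipschitz (1 + a^-1) (n%:R * (4 * expR 1 + 3)) (truncated_field a T).
Proof.
move=> a0 T1; have T0 : 0 < T by exact: lt_le_trans T1.
split=> [x|].
  apply: le_trans (truncated_field_le x a0 T0) _.
  exact: (gauss_field_bounded_lipschitz a0).1.
have Dc t : is_derive t 1 (fun t : R => cutoff (a / T * t))
    (- (expR 1 * flat 2 (1 - a / T * t)) * (a / T)).
  have D := isd_scale (a / T) (isd_id t); rewrite mulr1 in D.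
  exact: (isd_comp (isd_cutoff _) D).
apply: (radial_lipschitz (fun t => isd_mul (isd_gauss a t) (Dc t))) => t t0.
have aT0 : 0 <= a / T * t by rewrite mulr_ge0 // divr_ge0 ?(ltW a0) ?(ltW T0).
set E := expR (- (a * t)); set p := cutoff _; set p' := - _.
have E0 : 0 <= E by exact: expR_ge0.
have E1 : E <= 1 by rewrite /E -expR0 ler_expR oppr_le0 mulr_ge0 ?(ltW a0).
have p0 : 0 <= p by exact: cutoff_ge0.
have p1 : p <= 1 by exact: cutoff_le1.
have p'e : `|p'| <= 2 * expR 1 by exact: cutoff_deriv_le.
have tE : a * t * E <= 1 by exact: mul_expRN_le1.
have at0 : 0 <= a * t by rewrite mulr_ge0 ?(ltW a0).
have e0 : 0 <= expR 1 :> R by exact: expR_ge0.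
clearbody E p p'; have h1 : `|E * p| <= 1.
  by rewrite ger0_norm; [exact: mulr_ile1|exact: mulr_ge0].
have h2 : t * `|E * (p' * (a / T)) + p * (- a * E)| <= 2 * expR 1 + 1.
  apply: (@le_trans _ _ (a * t * E * (`|p'| / T + p))).
    rewrite (_ : _ * E * _ = t * (E * (`|p'| * (a / T)) + p * (a * E))); last by ring.
    rewrite ler_wpM2l // (le_trans (ler_normD _ _)) // !normrM normrN normfV //.
    by rewrite (ger0_norm E0) (ger0_norm p0) (ger0_norm (ltW a0)) (ger0_norm (ltW T0)).
  rewrite -[leRHS]mul1r; apply: ler_pM => //.
  - by rewrite mulr_ge0.
  - by rewrite addr_ge0 // divr_ge0 // (ltW T0).
  - by rewrite lerD // ler_pdivrMr // (le_trans p'e) // ler_peMr // mulr_ge0.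
rewrite -mulrA; apply: le_trans (lerD h1 (ler_wpM2l (ler0n _ 2) h2)) _.
by rewrite le_eqVlt; apply/orP; left; apply/eqP; ring.
Qed.

(** The cutoff differs from 1 by at most 2 e a |x|^2 / T, and |x|^3 exp(-a |x|^2) is bounded. *)
Lemma truncated_field_close a : 0 < a -> exists2 C : R, 0 <= C &
  forall T x, 1 <= T -> enorm (gauss_field a x - truncated_field a T x) <= C / T.
Proof.
move=> a0; have [C C0 CP] := powR_gauss_bounded (ler0n R 3) a0.
have e0 : 0 <= 2 * expR 1 * a by rewrite !mulr_ge0 ?expR_ge0 ?(ltW a0).
exists (2 * expR 1 * a * C) => [|T x T1]; first by rewrite mulr_ge0 // ltW.
have T0 : 0 < T by exact: lt_le_trans T1.
rewrite /gauss_field /truncated_field /radial -scalerBl enormZ -[X in X - _]mulr1 -mulrBr.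
rewrite -sqr_enorm; have x0 := enorm_ge0 x; set t := enorm x in x0 *.
rewrite normrM (ger0_norm (expR_ge0 _)).
have at0 : 0 <= a / T * t ^+ 2 by rewrite mulr_ge0 ?sqr_ge0 // divr_ge0 ?(ltW a0) ?(ltW T0).
apply: (@le_trans _ _ (expR (- (a * t ^+ 2)) * (2 * expR 1 * (a / T * t ^+ 2)) * t)).
  by rewrite ler_wpM2r // ler_wpM2l ?expR_ge0 // cutoff_near1.
rewrite (_ : _ * t = 2 * expR 1 * a / T * (t ^+ 3 * expR (- (a * t ^+ 2)))); last by ring.
rewrite [leRHS]mulrAC ler_wpM2l ?divr_ge0 ?(ltW T0) //.
by rewrite -(powR_mulrn 3 x0); exact: CP.
Qed.

End truncated_gaussian_field.

(** * Decomposition into small pieces *)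

Section pieces.
Context {R : realType} {n : nat}.
Hypothesis n0 : (0 < n)%N.
Local Notation V := 'rV[R]_n.
Local Notation L := (lebesgue_space R n).
Local Notation mu := (@leb R n).
Implicit Types (A E : set L).

Definition vol A : R := fine (mu A).

Lemma vol_ge0 A : 0 <= vol A.
Proof. by rewrite fine_ge0. Qed.

Lemma volK A : (mu A < +oo)%E -> (vol A)%:E = mu A.
Proof. by move=> Aoo; rewrite fineK // ge0_fin_numE. Qed.

Lemma leb_lty_sub A E : A `<=` E -> (mu E < +oo)%E -> (mu A < +oo)%E.
Proof. by move=> AE; apply: le_lt_trans; exact: le_outer_measure. Qed.

Lemma integrable_indicator A : measurable A -> (mu A < +oo)%E ->
  mu.-integrable [set: L] (EFin \o (\1_A : L -> R)).
Proof.
move=> mA Aoo; apply/integrableP; split.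
  by apply/measurable_EFinP; exact: measurable_indic.
rewrite (eq_integral (fun x => (\1_A x : R)%:E)) => [|x _]; last by rewrite /= ger0_norm.
by rewrite integral_indic // setIT.
Qed.

Lemma Rintegral_indicator A : measurable A -> \int[mu]_x (\1_A x : R) = vol A.
Proof. by move=> mA; rewrite /Rintegral integral_indic // setIT. Qed.

Lemma integrable_cst_on (c : R) E : measurable E -> (mu E < +oo)%E ->
  mu.-integrable E (EFin \o (fun _ : L => c)).
Proof.
move=> mE Eoo; apply/integrableP; split.
  by apply/measurable_EFinP; exact: measurable_cst.
rewrite (eq_integral (cst `|c|%:E)) // integral_cst //.
by rewrite lte_mul_pinfty // lee_fin.
Qed.

(* d bounds the radius of the pieces and t the measure of the part of E left uncovered. *)
Definition pieces E (I : finType) (F : I -> set L) (z : I -> V) (d t : R) :=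
  [/\ forall i, measurable (F i) /\ F i `<=` E, trivIset setT F,
      forall i x, F i x -> enorm (x - z i) <= d
    & (mu (E `\` \bigcup_i F i) <= t%:E)%E].

(** Continuity from above: E minus the first N sets decreases to the empty set within a set of
    finite measure. *)
Lemma exhaust E (B : nat -> set L) (t : R) : measurable E -> (mu E < +oo)%E ->
  (forall k, measurable (B k)) -> E `<=` \bigcup_k B k -> 0 < t ->
  exists N, (mu (E `\` \big[setU/set0]_(i < N) B i) <= t%:E)%E.
Proof.
move=> mE Eoo mB EB t0; pose G k := E `\` \big[setU/set0]_(i < k) B i.
have mG k : measurable (G k) by apply: measurableD => //; exact: bigsetU_measurable.
have G0 : \bigcap_k G k = set0.
  apply/seteqP; split => // x Gx; have Ex := (Gx 0%N Logic.I).1.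
  have [k _ xk] := EB _ Ex; have [_] := Gx k.+1 Logic.I; apply.
  by rewrite big_ord_recr /=; right.
have cv : (mu \o G) x @[x --> \oo] --> mu (\bigcap_n G n).
  apply: nonincreasing_cvg_mu => //.
  - by apply: leb_lty_sub Eoo => x [].
  - by rewrite G0.
  - move=> k l kl; apply/subsetPset => x [Ex xl]; split => // xk; apply: xl.
    by apply: subset_bigsetU xk.
have := cv; rewrite G0 measure0 => /fine_cvgP[_ /cvgrPdist_le/(_ t t0)[N _ NP]].
exists N; have := NP N (leqnn _); rewrite /= sub0r normrN ger0_norm ?fine_ge0 //.
rewrite -lee_fin fineK // ge0_fin_numE //.
by apply: leb_lty_sub Eoo => x [].
Qed.

(** Balls of radius d around the rational points cover the space; they are intersected with E, made
    disjoint by [seqDU] and reduced to finitely many by [exhaust]. *)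
Lemma exists_pieces E (d t : R) : measurable E -> (mu E < +oo)%E -> 0 < d -> 0 < t ->
  exists N (F : 'I_N -> set L) (z : 'I_N -> V), pieces E F z d t.
Proof.
move=> mE Eoo d0 t0.
pose z k : V := if unpickle k is Some q then map_mx ratr (q : 'rV[rat]_n) else 0.
pose B k : set L := E `&` [set x | enorm (x - z k) < d].
have mB k : measurable (B k).
  apply: measurableI => //; apply: open_measurable_leb.
  have c : continuous (fun x : V => enorm (x - z k)).
    apply: (cts_comp _ (@enorm_cts R n)).
    by apply: cts_sub; [exact: cts_id|exact: cst_continuous].
  by move/continuousP : c => /(_ [set s | s < d]); apply; exact: open_lt.
have cover x : exists k, enorm (x - z k) < d.
  have dn0 : 0 < d / n%:R by rewrite divr_gt0 // ltr0n.
  (* Only the density of the centres is taken from the rational boxes; passing from the sup norm to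
     the Euclidean one costs the factor n. *)
  have [p [_ px]] := ratbox_small x dn0.
  exists (pickle p.1); rewrite /z pickleK.
  apply: le_lt_trans (enorm_le_norm _) _.
  rewrite mulrC -ltr_pdivlMr ?ltr0n //; apply: px => i; rewrite !mxE.
  have : 0 < p.2.+1%:R^-1 :> R by rewrite invr_gt0 ltr0n.
  by move: (ratr _) (_^-1) => u v v0; apply/andP; split; lra.
have EB : E `<=` \bigcup_k B k by move=> x Ex; have [k xk] := cover x; exists k.
have [N GN] := exhaust mE Eoo mB EB t0.
exists N, (fun i => seqDU B i), (fun i => z i); split.
- move=> i; split; first exact: seqDU_measurable.
  by move=> x xi; have [] := @subset_seqDU _ B i x xi.
- apply/trivIsetP => i j _ _ ij; have /trivIsetP := trivIset_seqDU B; apply => //.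
- by move=> i x xi; have [_ /ltW] := @subset_seqDU _ B i x xi.
- apply: le_trans GN; apply: le_outer_measure => x [Ex xF]; split => //.
  rewrite bigsetU_seqDU => xN; apply: xF; move: xN.
  by rewrite -bigcup_mkord => -[i /= iN xi]; exists (Ordinal iN).
Qed.

Lemma integral_ge_pieces E (I : finType) (F : I -> set L) (z : I -> V) (d t : R)
    (Psi : V -> R) (a : I -> R) (B C : R) :
  measurable E -> (mu E < +oo)%E -> pieces E F z d t -> continuous Psi ->
  (forall x, `|Psi x| <= C) -> 0 <= B -> (forall x, E x -> - B <= Psi x) ->
  (forall i x, F i x -> a i <= Psi x) ->
  mu.-integrable E (EFin \o (Psi : L -> R)) /\
  \sum_i vol (F i) * a i - B * t <= \int[mu]_(x in E) Psi x.
Proof.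
move=> mE Eoo [mF tF _ rest] cPsi PsiC B0 PsiB Psia.
have iE : mu.-integrable E (EFin \o (Psi : L -> R)).
  apply: (le_integrable_real mE _ _ (integrable_cst_on C mE Eoo)).
    by apply: measurable_funTS; exact: continuous_measurable_leb.
  by move=> x _; exact: PsiC.
split=> //; set U := E `\` _ in rest.
have mFi i := (mF i).1; have FE i := (mF i).2.
have mU : measurable U.
  apply: measurableD => //; apply: fin_bigcup_measurable => // i _; exact: mFi.
have Uoo : (mu U < +oo)%E by apply: leb_lty_sub Eoo => x [].
have Foo i : (mu (F i) < +oo)%E by exact: leb_lty_sub (FE i) Eoo.
(* A simple function below Psi on E and 0 outside: [a i] on the piece [F i], -B on the part U left
   uncovered. *)
pose g (x : L) : R := \sum_i a i * \1_(F i) x - B * \1_U x.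
have iFi i := integrable_scaler measurableT (a i) (integrable_indicator (mFi i) (Foo i)).
have iU := integrable_scaler measurableT B (integrable_indicator mU Uoo).
have iS : mu.-integrable [set: L] (EFin \o (fun x => \sum_i a i * \1_(F i) x)).
  exact: integrable_sumr.
have ig : mu.-integrable [set: L] (EFin \o g) by exact: integrable_subr.
apply: (@le_trans _ _ (\int[mu]_x g x)).
  rewrite (RintegralB measurableT iS iU) (Rintegral_sum measurableT _ iFi).
  rewrite (RintegralZl _ measurableT (integrable_indicator mU Uoo)) Rintegral_indicator //.
  apply: lerB; last by rewrite ler_wpM2l // -lee_fin volK.
  rewrite le_eqVlt; apply/orP; left; apply/eqP; apply: eq_bigr => i _.
  rewrite (RintegralZl _ measurableT (integrable_indicator (mFi i) (Foo i))).
  by rewrite Rintegral_indicator // mulrC.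
rewrite [leRHS]Rintegral_mkcond; apply: le_Rintegral => //.
  by rewrite -restrict_EFin; exact: (iffLR (integrable_mkcond _ mE)).
move=> x _; rewrite /g.
have [[i xi]|noF] := pselect (exists i, F i x).
  have Ex : E x by exact: FE xi.
  rewrite patchE mem_set //.
  rewrite indicE memNset ?mulr0 ?subr0; last by case=> _; apply; exists i.
  rewrite (bigD1 i) //= indicE mem_set // mulr1 big1 ?addr0; first exact: Psia.
  move=> j ji; rewrite indicE memNset ?mulr0 // => xj.
  have /trivIsetP/(_ i j Logic.I Logic.I) := tF; rewrite eq_sym => /(_ ji)/seteqP[+ _].
  by move=> /(_ x); apply.
rewrite big1 ?sub0r => [|i _]; last by rewrite indicE memNset ?mulr0 // => xi; apply: noF; exists i.
rewrite patchE indicE; have [Ex|nEx] := pselect (E x).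
  rewrite mem_set; last by split => // -[i _ xi]; apply: noF; exists i.
  by rewrite mulr1 (mem_set Ex) PsiB.
by rewrite (memNset nEx) memNset ?mulr0 ?oppr0 // => -[].
Qed.

End pieces.

(** * Enlargements of E and the lower bound at the smallest scale *)

Section covering.
Context {R : realType} {n : nat}.
Hypothesis n0 : (0 < n)%N.
Local Notation V := 'rV[R]_n.
Local Notation L := (lebesgue_space R n).
Local Notation mu := (@leb R n).
Implicit Types (A E : set L).

Definition grow (e : R) (B : V * V) : V * V := (B.1 - const_mx e, B.2 + const_mx e).

Lemma prod_cts (T : topologicalType) I (s : seq I) (f : I -> T -> R) :
  (forall i, continuous (f i)) -> continuous (fun t => \prod_(i <- s) f i t).
Proof.
move=> cf; elim: s => [|i s IH].
  by rewrite (_ : (fun t => _) = fun=> 1); [exact: cst_continuous|apply/funext => t; rewrite big_nil].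
rewrite (_ : (fun t => _) = fun t => f i t * \prod_(j <- s) f j t).
  exact: cts_mul.
by apply/funext => u; rewrite big_cons.
Qed.

Lemma box_volume_grow_cts B : continuous (fun e => box_volume (grow e B)).
Proof.
apply: prod_cts => i.
(* The positive part is written as (s + |s|)/2, so that its continuity follows from that of the
   norm. *)
rewrite (_ : (fun t : R => _) = fun t : R =>
   (B.2 0 i - B.1 0 i + 2 * t + `|B.2 0 i - B.1 0 i + 2 * t|) * 2^-1).
  have c : continuous (fun t : R => B.2 0 i - B.1 0 i + 2 * t).
    apply: (@cts_add R R R); first exact: cst_continuous.
    by apply: cts_mul; [exact: cst_continuous|exact: cts_id].
  apply: cts_mul; last exact: cst_continuous.
  apply: (@cts_add R R R) => //.
  by apply: (cts_comp c); exact: norm_continuous.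
apply/funext => t; rewrite maxr_absE add0r sub0r normrN !mxE.
by rewrite (_ : B.2 0 i + t - (B.1 0 i - t) = B.2 0 i - B.1 0 i + 2 * t) //; ring.
Qed.

Lemma grow0 B : grow 0 B = B.
Proof.
rewrite /grow (_ : const_mx 0 = 0 :> V); last by apply/rowP => i; rewrite !mxE.
by rewrite subr0 addr0; case: B.
Qed.

(* E is covered by countably many boxes of total volume at most 2 |E|; E' is the union of
   finitely many of them, and A the union of the same boxes slightly enlarged. *)
Lemma exists_enlargement E : measurable E -> (mu E < +oo)%E -> 0 < vol E ->
  exists2 E' : set L, measurable E' /\ (mu (E `\` E') <= (vol E / 4)%:E)%E &
  exists2 e0 : R, 0 < e0 & forall e, 0 < e -> e <= e0 ->
    exists A, [/\ measurable A, (mu A < +oo)%E, vol A <= 3 * vol E &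
      forall x y : V, E' x -> (forall i, `|y 0 i - x 0 i| <= e) -> A y].
Proof.
move=> mE Eoo E0.
have Efin : lebesgue_outer (E : set V) \is a fin_num by rewrite ge0_fin_numE ?outer_measure_ge0.
have [_ [[D B] /= cB <-] sumB] := lb_ereal_inf_adherent E0 Efin.
pose F k : set L := if k \in D then box (B k) else set0.
have mF k : measurable (F k).
  by rewrite /F; case: ifP => _; [exact: measurable_box|exact: measurable0].
have EF : E `<=` \bigcup_k F k.
  by move=> x /cB[k Dk xk]; exists k => //; rewrite /F mem_set.
have E40 : 0 < vol E / 4 by rewrite divr_gt0.
have [N EN] := exhaust mE Eoo mF EF E40.
exists (\big[setU/set0]_(k < N) F k).
  by split=> //; exact: bigsetU_measurable.
pose v e k : R := if k \in D then box_volume (grow e (B k)) else 0.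
have v0 e k : 0 <= v e k by rewrite /v; case: ifP => // _; exact: box_volume_ge0.
have vN : \sum_(k < N) v 0 k < 3 * vol E.
  rewrite -lte_fin -sumEFin.
  apply: (@le_lt_trans _ _ (\esum_(k in D) (box_volume (B k))%:E)%E).
    rewrite esum_mkcond -nneseries_esumT => [|k]; last first.
      by case: ifP => // _; rewrite lee_fin box_volume_ge0.
    apply: le_trans (nneseries_lim_ge N _); last first.
      by move=> k _ _; case: ifP => // _; rewrite lee_fin box_volume_ge0.
    rewrite big_mkord; apply: lee_sum => k _; rewrite /v grow0.
    by case: ifP.
  apply: lt_le_trans sumB _; rewrite -[X in (X + _ <= _)%E]volK // -EFinD lee_fin.
  by move: E0; move: (vol E) => u; lra.
have cv : continuous (fun e => \sum_(k < N) v e k).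
  apply: (@sum_cts R R R^o) => k; have [kD|kD] := boolP (nat_of_ord k \in D).
    rewrite (_ : (fun e => v e k) = fun e => box_volume (grow e (B k))).
      exact: box_volume_grow_cts.
    by apply/funext => e; rewrite /v kD.
  rewrite (_ : (fun e => v e k) = fun=> 0); first exact: cst_continuous.
  by apply/funext => e; rewrite /v (negbTE kD).
(* The cover was chosen with slack |E| above the infimum |E|, so its total volume is below 2 |E|.
   Finitely many volumes depend continuously on the enlargement and stay below 3 |E| when it is
   small. *)
have gap : 0 < 3 * vol E - \sum_(k < N) v 0 k by rewrite subr_gt0.
have [e0 /= e0p eP] := (iffLR (@nbhs_ballP _ R 0 _)) (iffLR (cvgrPdist_lt _ _) (cv 0) _ gap).
exists (e0 / 2); first by rewrite divr_gt0.
move=> e ep ee0.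
have vE : \sum_(k < N) v e k <= 3 * vol E.
  have : ball (0 : R) e0 e.
    by rewrite -ball_normE /= sub0r normrN gtr0_norm //; lra.
  move=> /eP; rewrite ltr_norml => /andP[+ _]; rewrite /=.
  by move: (\sum_(_ < _) v 0 _) (\sum_(_ < _) v e _) => s s'; lra.
pose A k : set L := if k \in D then box (grow e (B k)) else set0.
have Av k : (mu (A k) <= (v e k)%:E)%E.
  rewrite /A /v; case: ifP => _; first exact: lebesgue_outer_box_le.
  by rewrite measure0.
have muA : (mu (\big[setU/set0]_(k < N) A k) <= (3 * vol E)%:E)%E.
  apply: le_trans (outer_measure_subadditive _ _ _) _.
  move: vE; rewrite -lee_fin -sumEFin; apply: le_trans.
  by apply: lee_sum => k _; exact: Av.
have Aoo : (mu (\big[setU/set0]_(k < N) A k) < +oo)%E by apply: le_lt_trans muA (ltry _).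
exists (\big[setU/set0]_(k < N) A k); split => //.
- apply: bigsetU_measurable => k _.
  by rewrite /A; case: ifP => _; [exact: measurable_box|exact: measurable0].
- by rewrite -lee_fin volK.
- move=> x y; rewrite -!bigcup_mkord => -[k /= kN]; rewrite /F; case: ifP => // kD xk yx.
  exists k => //=; rewrite /A kD => i; rewrite !mxE.
  have /andP[h1 h2] := xk i; have := yx i; rewrite ler_norml => /andP[h3 h4].
  by apply/andP; split; move: h1 h2 h3 h4; move: (_ 0 i) (_ 0 i) (_ 0 i) (_ 0 i) => *; lra.
Qed.

End covering.

Section packing.
Context {R : realType} {n : nat}.
Hypothesis n0 : (0 < n)%N.
Local Notation V := 'rV[R]_n.
Local Notation L := (lebesgue_space R n).
Local Notation mu := (@leb R n).
Implicit Types (A E : set L).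

(* Lebesgue measure is never normalised: if the unit cube were null, the measure would
   vanish by scaling, and the isoperimetric inequality would be trivial. *)
Definition unit_vol : R := vol (box (cube 1) : set L).

Definition cube_at (z : V) (r : R) : set L := [set x | box (cube r) (x - z)].

Lemma cube_atE z r : 0 < r -> cube_at z r = affine r^-1 (- (r^-1 *: z)) @^-1` box (cube 1).
Proof.
move=> r0; apply/seteqP; split => x /= h i; have := h i; rewrite /affine !mxE => /andP[h1 h2].
- apply/andP; rewrite -mulrN -mulrDr mulrC; split; first by rewrite ler_pdivlMr // mulN1r.
  by rewrite ltr_pdivrMr // mul1r.
- move: h1 h2; rewrite -mulrN -mulrDr mulrC ler_pdivlMr // mulN1r ltr_pdivrMr // mul1r.
  by move=> -> ->.
Qed.

Lemma unit_volK : unit_vol%:E = mu (box (cube 1)).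
Proof.
rewrite volK //; apply: le_lt_trans (lebesgue_outer_box_le _) _; exact: ltry.
Qed.

Lemma leb_cube_at z r : 0 < r -> mu (cube_at z r) = (r ^+ n * unit_vol)%:E.
Proof.
move=> r0; rewrite cube_atE // [LHS]lebesgue_outer_affine ?invr_gt0 //.
by rewrite invrK EFinM unit_volK.
Qed.

Lemma measurable_cube_at z r : 0 < r -> measurable (cube_at z r).
Proof.
move=> r0; rewrite cube_atE //.
have r1 : 0 < r^-1 by rewrite invr_gt0.
have := measurable_affine (- (r^-1 *: z)) r1 measurableT (measurable_box (cube (1 : R))).
by rewrite setTI.
Qed.

Lemma leb_eq0 A : unit_vol = 0 -> mu A = 0.
Proof.
move=> u0; apply/eqP; rewrite eq_le outer_measure_ge0 andbT.
have AB : A `<=` \bigcup_k cube_at 0 k.+1%:R.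
  move=> x _; exists (Num.truncn (enorm x)) => //=; rewrite /cube_at /= subr0.
  by apply: cube_enorm; exact: truncnS_gt.
apply: le_trans (le_outer_measure lebesgue_outer _ _ AB) _.
apply: le_trans (outer_measure_sigma_subadditive _ _) _.
rewrite eseries0 // => k _ _.
by rewrite [LHS]leb_cube_at ?ltr0n // u0 mulr0.
Qed.

Lemma unit_vol_ge0 : 0 <= unit_vol.
Proof. exact: vol_ge0. Qed.

Lemma dot_cube (r : R) (x : V) : 0 <= r -> box (cube r) x -> dot x x <= n%:R * r ^+ 2.
Proof.
move=> r0 xr; rewrite /dot; apply: (@le_trans _ _ (\sum_(i < n) r ^+ 2)).
  apply: ler_sum => i _; have := xr i; rewrite !mxE => /andP[h1 h2].
  by move: h1 h2; move: (x 0 i) => u h1 h2; nra.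
by rewrite sumr_const card_ord mulr_natl.
Qed.

Lemma gauss_mass_gt0 : 0 < unit_vol -> 0 < @gauss_mass R n.
Proof.
move=> u0; have C0 : cube_at 0 1 = box (cube 1).
  by apply/funext => x; rewrite /cube_at /= subr0.
have mC : measurable (cube_at 0 1) by apply: measurable_cube_at.
have Coo : (mu (cube_at 0 1) < +oo)%E by rewrite leb_cube_at // ltry.
have iC := integrable_scaler measurableT (expR (- n%:R)) (integrable_indicator mC Coo).
apply: (@lt_le_trans _ _ (\int[mu]_x (expR (- n%:R) * \1_(cube_at 0 1) x))).
  rewrite (RintegralZl _ measurableT (integrable_indicator mC Coo)) Rintegral_indicator //.
  by rewrite C0 mulr_gt0 ?expR_gt0.
have ig := @integrable_gauss_translate R n n0 1 0 ltr01.
have -> : @gauss_mass R n = \int[mu]_x gauss 1 (x + 0).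
  by apply: eq_Rintegral => x _; rewrite addr0.
apply: le_Rintegral => // x _; rewrite addr0.
rewrite indicE; have [xC|xC] := pselect (cube_at 0 1 x); last first.
  by rewrite memNset // mulr0 gauss_ge0.
rewrite mem_set // mulr1 /gauss ler_expR mul1r lerN2.
by move: xC; rewrite C0 => /(dot_cube ler01); rewrite expr1n mulr1.
Qed.

(** E is covered by the part outside the pieces, the part outside E', and the pieces that meet E';
    the first two have measure at most t each. *)
Lemma good_pieces E E' (I : finType) (F : I -> set L) (z : I -> V) (d t : R) :
  measurable E -> (mu E < +oo)%E -> measurable E' -> pieces E F z d t ->
  (mu (E `\` E') <= t%:E)%E ->
  vol E - 2 * t <= \sum_(i | `[< exists x, F i x /\ E' x >]) vol (F i).
Proof.
move=> mE Eoo mE' [mF _ _ rest] EE'.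
have Foo i : (mu (F i) < +oo)%E by exact: leb_lty_sub (mF i).2 Eoo.
pose P i := `[< exists x, F i x /\ E' x >].
pose U := \big[setU/set0]_(i | P i) F i.
have EU : E `<=` (E `\` \bigcup_i F i) `|` ((E `\` E') `|` U).
  move=> x Ex; have [[i _ xi]|xF] := pselect ((\bigcup_i F i) x); last by left.
  right; have [E'x|nE'] := pselect (E' x); last by left.
  right; rewrite /U -bigcup_seq_cond; exists i => //=.
  by rewrite mem_index_enum; apply/asboolP; exists x.
have := le_outer_measure lebesgue_outer _ _ EU.
have h1 := outer_measureU2 lebesgue_outer (E `\` \bigcup_i F i) ((E `\` E') `|` U).
have h2 := outer_measureU2 lebesgue_outer (E `\` E') U.
have h3 : (lebesgue_outer U <= (\sum_(i | P i) vol (F i))%:E)%E.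
  apply: (big_ind2 (fun A b => (lebesgue_outer A <= b%:E)%E)).
  - by rewrite outer_measure0.
  - move=> A a B b Aa Bb; apply: le_trans (outer_measureU2 _ _ _) _.
    by rewrite EFinD; exact: leeD.
  - by move=> i _; rewrite volK.
move=> /le_trans/(_ h1)/le_trans/(_ (leeD rest (le_trans h2 (leeD EE' h3)))).
rewrite -[X in (X <= _)%E -> _]volK // -!EFinD lee_fin.
by move: (vol E) (\sum_(_ | _) _) => u v; lra.
Qed.

End packing.

(** * Bounds on the scale sums *)

Section scale_sum_bounds.
Context {R : realType} {n : nat}.
Hypothesis n0 : (0 < n)%N.
Hypothesis unit_vol_gt0 : 0 < @unit_vol R n.
Local Notation V := 'rV[R]_n.
Local Notation L := (lebesgue_space R n).
Local Notation mu := (@leb R n).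
Implicit Types (A E : set L).

(** Final computation of [scale_sum_ge], with M = [gauss_mass], X = e^n, N = 2^n, u = |E|, a = |A|,
    s the mass of the good pieces, S the Gaussian pair sum, X b = t and 6 N b / q the volume of the
    unit cube. *)
Let packing_arithmetic (M X N q b u a s S : R) :
  0 < M -> 0 < X -> 0 < N -> 0 < b -> 0 < q -> u / 2 <= s -> a <= 3 * u -> 0 < u ->
  2 * (X * b) * q * (s * (X / N * (6 * N * b / q))) - (X * b) ^+ 2 * a <= X / N * M * S ->
  3 * b ^+ 2 * N / M * u <= X^-1 * S.
Proof.
move=> M0 X0 N0 b0 q0 good A3 u0 key.
have e1' : 2 * (X * b) * q * (s * (X / N * (6 * N * b / q))) = 12 * (X * b) ^+ 2 * s.
  by field; rewrite (lt0r_neq0 N0) (lt0r_neq0 q0).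
move: key; rewrite e1' => key.
have : 3 * (X * b) ^+ 2 * u <= X / N * M * S.
  apply: le_trans key; have := mulr_gt0 X0 b0; move: (X * b) => Y Y0.
  have : 0 <= Y ^+ 2 by exact: sqr_ge0.
  by move: (Y ^+ 2) => Z Z0; nra.
rewrite (_ : 3 * b ^+ 2 * N / M * u = 3 * b ^+ 2 * N * u / M); last by rewrite mulrAC.
rewrite ler_pdivrMr //.
rewrite (_ : X / N * M * S = X ^+ 2 / N * (X^-1 * S * M)); last first.
  by field; rewrite (lt0r_neq0 N0) (lt0r_neq0 X0).
rewrite (_ : 3 * (X * b) ^+ 2 * u = X ^+ 2 / N * (3 * b ^+ 2 * N * u)); last first.
  by field; rewrite lt0r_neq0.
by rewrite ler_pM2l // divr_gt0 // exprn_gt0.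
Qed.

Lemma scale_sum_ge : exists2 c : R, 0 < c & forall E, measurable E ->
  (mu E < +oo)%E -> 0 < vol E -> exists2 e1 : R, 0 < e1 &
  forall (I : finType) (F : I -> set L) (z : I -> V) (e : R), 0 < e -> e <= e1 ->
    pieces E F z (e / 2) (vol E / 4) -> c * vol E <= scale_sum (vol \o F) z e.
Proof.
have M0 := gauss_mass_gt0 n0 unit_vol_gt0.
(* Lower bound of the narrow Gaussian exp(-2 |v|^2 / e^2) on the cube of half-side e/2, where |v|^2
   <= n e^2 / 4. *)
pose q : R := expR (- (n%:R / 2)).
(* The 6 makes t = e^n b a good level: the linear term is 12 t^2 s >= 6 t^2 |E|, twice the bound 3
   t^2 |E| on the subtracted term t^2 |A|. *)
pose b := q * @unit_vol R n / (6 * 2 ^+ n).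
have q0 : 0 < q by exact: expR_gt0.
have b0 : 0 < b by rewrite divr_gt0 ?mulr_gt0 ?exprn_gt0.
exists (3 * b ^+ 2 * 2 ^+ n / @gauss_mass R n).
  by rewrite divr_gt0 // !mulr_gt0 ?exprn_gt0.
move=> E mE Eoo E0.
have [E' [mE' EE'] [e1 e10 cover]] := exists_enlargement mE Eoo E0.
exists e1 => // I F z e e0 ee1 PF.
have [A [mA Aoo A3 E'A]] := cover e e0 ee1.
pose P i := `[< exists x, F i x /\ E' x >].
have good : vol E / 2 <= \sum_(i | P i) vol (F i).
  apply: le_trans (good_pieces mE Eoo mE' PF EE').
  by move: (vol E) => u; lra.
have e20 : 0 < e / 2 by rewrite divr_gt0.
pose Q i := cube_at (z i) (e / 2).
have mQ i : measurable (Q i) by exact: measurable_cube_at.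
have Qoo i : (mu (Q i) < +oo)%E by rewrite leb_cube_at // ltry.
have volQ i : vol (Q i) = (e / 2) ^+ n * @unit_vol R n.
  by rewrite /vol leb_cube_at.
(* A good piece has a point of E' within e/2 of its centre, so the cube of half-side e/2 lies within
   sup distance e of that point, hence inside the enlargement A. *)
have QA i y : P i -> Q i y -> A y.
  move=> /asboolP[x [Fx E'x]] Qy; apply: (E'A x) => // k.
  have [_ _ zd _] := PF.
  have := le_trans (coord_le_enorm _ k) (zd i x Fx).
  have := Qy k; rewrite !mxE => /andP[h1 h2]; rewrite ler_norml => /andP[h3 h4].
  rewrite ler_norml; apply/andP; split; move: h1 h2 h3 h4;
    by move: (x 0 k) (y 0 k) (z i 0 k) => u v w; lra.
have a0 : 0 < e ^- 2 by rewrite invr_gt0 exprn_gt0.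
have a4 : 4 * e ^- 2 = (e / 2) ^- 2.
  by field; exact: lt0r_neq0.
have [ig2 eg2] := gauss_square n0 (vol \o F) z a0 e20 a4.
pose g (v : L) : R := \sum_i vol (F i) * gauss (2 * e ^- 2) (v - z i).
pose H (v : L) : R := \sum_(i | P i) vol (F i) * \1_(Q i) v.
have H0 v : 0 <= H v by apply: sumr_ge0 => i _; rewrite mulr_ge0 ?vol_ge0.
have gH v : q * H v <= g v.
  rewrite /H mulr_sumr /g big_mkcond /=; apply: ler_sum => i _.
  case: ifP => _; last by rewrite mulr_ge0 ?vol_ge0 ?gauss_ge0.
  rewrite mulrCA ler_wpM2l ?vol_ge0 // indicE.
  have [Qv|Qv] := pselect (Q i v); last by rewrite memNset // mulr0 gauss_ge0.
  rewrite mem_set // mulr1 /q /gauss ler_expR lerN2.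
  apply: le_trans (ler_wpM2l _ (dot_cube (ltW e20) Qv)) _.
    by rewrite mulr_ge0 // ltW.
  rewrite le_eqVlt; apply/orP; left; apply/eqP; field.
  exact: lt0r_neq0.
pose t : R := e ^+ n * b.
have t0 : 0 <= t by rewrite mulr_ge0 ?exprn_ge0 ?ltW.
have iQ i := integrable_scaler measurableT (vol (F i)) (integrable_indicator (mQ i) (Qoo i)).
have HE : H = fun v => \sum_i (if P i then vol (F i) else 0) * \1_(Q i) v.
  by apply/funext => v; rewrite /H big_mkcond; apply: eq_bigr => i _; case: ifP; rewrite ?mul0r.
have iQ' i := integrable_scaler measurableT (if P i then vol (F i) else 0)
  (integrable_indicator (mQ i) (Qoo i)).
have iH : mu.-integrable [set: L] (EFin \o H) by rewrite HE; exact: integrable_sumr.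
have IH : \int[mu]_x H x = (\sum_(i | P i) vol (F i)) * ((e / 2) ^+ n * @unit_vol R n).
  rewrite HE (Rintegral_sum measurableT _ iQ') mulr_suml [RHS]big_mkcond.
  apply: eq_bigr => i _.
  rewrite (RintegralZl _ measurableT (integrable_indicator (mQ i) (Qoo i))).
  by rewrite Rintegral_indicator // volQ; case: ifP; rewrite ?mul0r.
have iA := integrable_indicator mA Aoo.
have i1 := integrable_scaler measurableT (2 * t * q) iH.
have i2 := integrable_scaler measurableT (t ^+ 2) iA.
(* [g^2 >= 2 t g - t^2], used on A only, is the needed form of Cauchy-Schwarz. *)
have key : \int[mu]_x (2 * t * q * H x - t ^+ 2 * \1_A x) <= \int[mu]_x (g x ^+ 2).
  apply: le_Rintegral => //; first exact: integrable_subr.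
  move=> v _; have := gH v; have := H0 v.
  have [Av|nAv] := pselect (A v).
    rewrite indicE mem_set // mulr1 => Hv gv.
    have tg : t * (q * H v) <= t * g v by rewrite ler_wpM2l.
    rewrite (_ : 2 * t * q * H v = 2 * (t * (q * H v))); last by ring.
    move: tg; move: (q * H v) (g v) (t) => u w x tg.
    by have := sqr_ge0 (w - x); nra.
  rewrite (_ : H v = 0); last first.
    rewrite /H big1 // => i Pi; rewrite indicE memNset ?mulr0 // => Qv.
    by apply: nAv; exact: QA Qv.
  by rewrite indicE memNset // !mulr0 subr0 sqr_ge0.
move: key; rewrite (RintegralB measurableT i1 i2) (RintegralZl _ measurableT iH).
rewrite (RintegralZl _ measurableT iA) Rintegral_indicator // IH eg2.
rewrite -[X in _ -> _ <= X]/(e ^- n * pair_sum (vol \o F) z (gauss (e ^- 2))).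
rewrite -[X in _ <= _ * _ * X]/(pair_sum (vol \o F) z (gauss (e ^- 2))).
move: (pair_sum _ _ _) => S; rewrite expr_div_n.
have E0' : 0 < e ^+ n by rewrite exprn_gt0.
have N0' : 0 < 2 ^+ n :> R by rewrite exprn_gt0.
have uE : @unit_vol R n = 6 * 2 ^+ n * b / q.
  by rewrite /b; field; rewrite (lt0r_neq0 N0') (lt0r_neq0 q0).
rewrite uE /t.
exact: packing_arithmetic.
Qed.

Lemma scale_sum_le (I : finType) (w : I -> R) (z : I -> V) (r : R) :
  (forall i, 0 <= w i) -> 0 < r ->
  scale_sum w z r <= r ^- n * (\sum_i w i) ^+ 2.
Proof.
move=> w0 r0; rewrite /scale_sum ler_wpM2l ?invr_ge0 ?exprn_ge0 ?(ltW r0) //.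
apply: le_trans (ler_norm _) _; rewrite -[leRHS]mulr1.
apply: pair_sum_le => // u; rewrite ger0_norm ?gauss_ge0 //.
by rewrite gauss_le1 // invr_ge0 exprn_ge0 ?(ltW r0).
Qed.
End scale_sum_bounds.

Section gaussian_sums_over_pieces.
Context {R : realType} {n : nat}.
Hypothesis n0 : (0 < n)%N.
Local Notation V := 'rV[R]_n.
Local Notation L := (lebesgue_space R n).
Local Notation mu := (@leb R n).
Implicit Types (A E : set L).

(** Half of the exponent absorbs the linear factor: s <= exp(s^2/2) with s = |x|/r. *)
Lemma enorm_gauss_field_le (r : R) (x : V) : 0 < r ->
  enorm (gauss_field (r ^- 2) x) <= r * gauss (r ^- 2 / 2) x.
Proof.
move=> r0; rewrite gauss_fieldE enormZ ger0_norm ?gauss_ge0 //.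
rewrite /gauss -sqr_enorm; set u := enorm x.
have -> : r ^- 2 * u ^+ 2 = r ^- 2 / 2 * u ^+ 2 + r ^- 2 / 2 * u ^+ 2.
  by field; exact: lt0r_neq0.
rewrite opprD expRD [leRHS]mulrC -[leLHS]mulrA ler_wpM2l ?expR_ge0 //.
rewrite expRN mulrC ler_pdivrMr ?expR_gt0 // -ler_pdivrMl //.
apply: le_trans (expR_ge1Dx _).
rewrite (_ : r ^- 2 / 2 * u ^+ 2 = (r^-1 * u) ^+ 2 / 2); last by field; exact: lt0r_neq0.
by move: (r^-1 * u) => s; have := sqr_ge0 (s - 1); nra.
Qed.

(** Moving the centre within a piece costs a wider Gaussian and a constant: u/r <= v/r + 1 gives
    (u/r)^2/4 <= (v/r)^2/2 + 1/2. *)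
Lemma gauss_piece_le (r : R) (x y z : V) : 0 < r -> enorm (x - z) <= r ->
  gauss (r ^- 2 / 2) (y - z) <= expR (1 / 2) * gauss ((2 * r) ^- 2) (x - y).
Proof.
move=> r0 xz; rewrite /gauss -expRD ler_expR -!sqr_enorm.
have h : enorm (x - y) <= enorm (y - z) + r.
  rewrite enormB (_ : y - x = (y - z) - (x - z)); last by rewrite opprB addrA subrK.
  apply: le_trans (enormD _ _) _; rewrite enormN lerD2l //.
have := enorm_ge0 (x - y); have := enorm_ge0 (y - z); move: h.
move: (enorm (x - y)) (enorm (y - z)) => u v h v0 u0.
rewrite (_ : (2 * r) ^- 2 * u ^+ 2 = (u / r) ^+ 2 / 4); last by field; exact: lt0r_neq0.
rewrite (_ : r ^- 2 / 2 * v ^+ 2 = (v / r) ^+ 2 / 2); last by field; exact: lt0r_neq0.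
have h' : u / r <= v / r + 1.
  by rewrite ler_pdivrMr // mulrDl divfK ?mul1r // lt0r_neq0.
have : 0 <= u / r by rewrite divr_ge0 // ltW.
have : 0 <= v / r by rewrite divr_ge0 // ltW.
move: h'; move: (u / r) (v / r) => a b h1 b0 a0; have := sqr_ge0 (b - 1); nra.
Qed.

(* Averaging over pieces of radius at most r turns the sum into a Gaussian integral. *)
Lemma gauss_sum_pieces_le E (I : finType) (F : I -> set L) (z : I -> V) (d t r : R) (y : V) :
  (mu E < +oo)%E -> pieces E F z d t -> 0 < r -> d <= r ->
  \sum_i vol (F i) * gauss (r ^- 2 / 2) (y - z i) <=
  expR (1 / 2) * 2 ^+ n * @gauss_mass R n * r ^+ n.
Proof.
move=> Eoo [mF tF zd _] r0 dr.
have r20 : 0 < (2 * r) ^- 2 by rewrite invr_gt0 exprn_gt0 // mulr_gt0.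
have mFi i := (mF i).1.
have Foo i : (mu (F i) < +oo)%E by exact: leb_lty_sub (mF i).2 Eoo.
pose g i := gauss (r ^- 2 / 2) (y - z i).
have iF i := integrable_scaler measurableT (g i) (integrable_indicator (mFi i) (Foo i)).
have iG := integrable_scaler measurableT (expR (1 / 2)) (integrable_gauss_translate n0 (- y) r20).
have -> : expR (1 / 2) * 2 ^+ n * @gauss_mass R n * r ^+ n =
    \int[mu]_x (expR (1 / 2) * gauss ((2 * r) ^- 2) (x - y)).
  rewrite (RintegralZl _ measurableT (integrable_gauss_translate n0 (- y) r20)).
  by rewrite Rintegral_gauss ?mulr_gt0 // exprMn; ring.
have -> : \sum_i vol (F i) * gauss (r ^- 2 / 2) (y - z i) =
    \int[mu]_x (\sum_i g i * \1_(F i) x).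
  rewrite (Rintegral_sum measurableT _ iF); apply: eq_bigr => i _.
  rewrite (RintegralZl _ measurableT (integrable_indicator (mFi i) (Foo i))).
  by rewrite Rintegral_indicator // mulrC.
apply: le_Rintegral => //; first exact: integrable_sumr.
move=> x _; have [[i xi]|noF] := pselect (exists i, F i x); last first.
  rewrite big1 ?mulr_ge0 ?expR_ge0 // => i _.
  by rewrite indicE memNset ?mulr0 // => xi; apply: noF; exists i.
rewrite (bigD1 i) //= indicE mem_set // mulr1 big1 ?addr0 => [|j ji].
  by apply: gauss_piece_le => //; exact: le_trans (zd i x xi) dr.
rewrite indicE memNset ?mulr0 // => xj.
have /trivIsetP/(_ i j Logic.I Logic.I) := tF; rewrite eq_sym => /(_ ji)/seteqP[+ _].
by move=> /(_ x); apply.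
Qed.

(** [integral_ge_pieces] for the constant function 1, with B = 0. *)
Lemma sum_vol_pieces_le E (I : finType) (F : I -> set L) (z : I -> V) (d t : R) :
  measurable E -> (mu E < +oo)%E -> pieces E F z d t -> \sum_i vol (F i) <= vol E.
Proof.
move=> mE Eoo PF; have [mF _ _ _] := PF.
have c1 : continuous ((fun=> 1) : V -> R) by exact: cst_continuous.
have Z := @integral_ge_pieces R n E I F z d t (fun=> 1) (fun=> 1) 0 1 mE Eoo PF c1.
have [|//|x _|//|_] := Z; [by rewrite normr1| by rewrite oppr0|].
rewrite mul0r subr0 (eq_bigr (fun i => vol (F i))) => [|i _]; last by rewrite mulr1.
by rewrite Rintegral_cst // mul1r.
Qed.

End gaussian_sums_over_pieces.

Lemma powR_small {R : realType} (s e : R) : 0 < s -> 0 < e ->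
  exists2 d : R, 0 < d & forall t, 0 <= t -> t <= d -> t `^ s <= e.
Proof.
move=> s0 e0; exists (e `^ s^-1); first exact: powR_gt0.
move=> t t0 td; apply: (@le_trans _ _ ((e `^ s^-1) `^ s)).
  by rewrite ge0_ler_powR ?nnegrE ?powR_ge0 ?(ltW s0).
by rewrite -powRrM mulVf ?lt0r_neq0 // powRr1 // ltW.
Qed.

(** * Error of truncation and of moving the evaluation point *)

Section truncation_error.
Context {R : realType} {n : nat} (alpha : R).
Hypotheses (alpha0 : 0 < alpha) (alpha1 : alpha < 1) (n0 : (0 < n)%N).
Local Notation V := 'rV[R]_n.
Local Notation fd := (@fd R n alpha).
Local Notation K := (@mass_majorant R n alpha).

Lemma fd_sub A B (f g : V -> V) x : increments_le alpha A f -> increments_le alpha B g ->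
  fd (fun y => f y - g y) x = fd f x - fd g x.
Proof.
move=> fA gB; have hN := increments_le_scale (-1) gB.
rewrite (_ : (fun y => f y - g y) = fun y => f y + -1 *: g y); last first.
  by apply/funext => y; rewrite scaleN1r.
rewrite (fd_add alpha0 alpha1 n0 x fA hN) (fd_scale alpha0 alpha1 n0 (-1) x gB).
by rewrite mulN1r.
Qed.

Lemma bounded_lipschitz_sub M M' Lam Lam' (f g : V -> V) (C : R) :
  bounded_lipschitz M Lam f -> bounded_lipschitz M' Lam' g ->
  (forall x, enorm (f x - g x) <= C) ->
  bounded_lipschitz C (Lam + Lam') (fun x => f x - g x).
Proof.
move=> [_ fL] [_ gL] fgC; split=> // x y.
rewrite (_ : f x - g x - (f y - g y) = (f x - f y) - (g x - g y)); last first.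
  by rewrite !opprB addrACA [RHS]addrACA; congr (_ + _); rewrite addrC.
apply: le_trans (enormD _ _) _; rewrite enormN mulrDl; exact: lerD.
Qed.

(** The order of the quantifiers matters: B is fixed before eta, because the mass left uncovered
    will be chosen from B, while the radius of the pieces will be chosen from delta. Truncation is
    handled by interpolation, displacement by [fd_holder], with half of eta for each. *)
Lemma truncated_fd_approx (a : R) : 0 < a -> exists2 B : R, 0 <= B &
  forall eta : R, 0 < eta -> exists T delta : R,
  [/\ 1 <= T, 0 < delta,
      forall x, `|fd (truncated_field a T) x| <= B &
      forall x tau, enorm tau <= delta ->
        `|fd (truncated_field a T) (x + tau) - fd (gauss_field a) x| <= eta].
Proof.
move=> a0; have [C C0 close] := @truncated_field_close R n a a0.
pose M := 1 + a^-1; pose Lam : R := n%:R * (4 * expR 1 + 3).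
have aV : 0 < a^-1 by rewrite invr_gt0.
have M0 : 0 <= M by rewrite /M; lra.
have e1 : 0 < expR (1 : R) by exact: expR_gt0.
have L0 : 0 < Lam by rewrite mulr_gt0 ?ltr0n // addr_gt0 // mulr_gt0.
have s0 : 0 < (1 - alpha) / 2 by rewrite divr_gt0 // subr_gt0.
have K0 : 0 <= K by exact: mass_majorant_ge0.
have HT T : 1 <= T -> bounded_lipschitz M Lam (@truncated_field R n a T).
  exact: truncated_field_bounded_lipschitz.
have HG := @gauss_field_bounded_lipschitz R n a a0.
exists ((Lam + 2 * M) * K).
  by rewrite mulr_ge0 // addr_ge0 ?(ltW L0) // mulr_ge0.
move=> eta eta0; pose eta2 := eta / 2.
have eta20 : 0 < eta2 by rewrite divr_gt0.
pose Lam' := n%:R * 3 + Lam.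
have L'0 : 0 < Lam' by rewrite addr_gt0 // mulr_gt0 // ltr0n.
pose D' := Lam' `^ ((1 + alpha) / 2) * K + 1.
have D'0 : 0 < D' by rewrite ltr_wpDl // mulr_ge0 // powR_ge0.
have [rho rho0 rhoP] := powR_small s0 (divr_gt0 eta20 D'0).
pose D := 2 * Lam * K + 1.
have D0 : 0 < D by rewrite ltr_wpDl // !mulr_ge0 // ltW.
have [dl dl0 dlP] := powR_small s0 (divr_gt0 eta20 D0).
pose rho' := Num.min rho Lam'.
have rho'0 : 0 < rho' by rewrite lt_min rho0.
(* Then 2 C / T is below both [rho], which makes the interpolated bound small, and [Lam'], which the
   interpolation lemma requires. *)
pose T := Num.max 1 (2 * C / rho').
have T1 : 1 <= T by rewrite le_max lexx.
have T0 : 0 < T by exact: lt_le_trans T1.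
have CT : 2 * (C / T) <= rho'.
  by rewrite mulrA ler_pdivrMr // [leRHS]mulrC -ler_pdivrMr // le_max lexx orbT.
exists T, (Num.min 1 dl); split => //.
- by rewrite lt_min ltr01.
- move=> x; apply: fd_le => //.
  exact: (increments_le_lipschitz alpha0 alpha1 n0 (HT T T1) (ltW L0)).
move=> x tau; rewrite le_min => /andP[tau1 taud].
have h1 : `|fd (truncated_field a T) (x + tau) - fd (truncated_field a T) x| <= eta2.
  apply: le_trans (fd_holder alpha0 alpha1 n0 x (HT T T1) tau1 (ltW L0)) _.
  have := dlP _ (enorm_ge0 tau) taud.
  rewrite ler_pdivlMr //; apply: le_trans.
  rewrite mulrAC mulrC ler_wpM2l ?powR_ge0 //.
  by rewrite /D lerDl.
have HD := bounded_lipschitz_sub HG (HT T T1) (close T ^~ T1).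
have CT0 : 0 <= C / T by rewrite divr_ge0 // ltW.
have CL : 2 * (C / T) <= Lam' by apply: le_trans CT _; rewrite ge_min lexx orbT.
have iD := increments_le_interpolation alpha0 alpha1 n0 HD CT0 CL.
have iG := increments_le_lipschitz alpha0 alpha1 n0 HG (mulr_ge0 (ler0n _ _) (ler0n _ _)).
have iT := increments_le_lipschitz alpha0 alpha1 n0 (HT T T1) (ltW L0).
have h2 : `|fd (gauss_field a) x - fd (truncated_field a T) x| <= eta2.
  rewrite -(fd_sub x iG iT); apply: le_trans (fd_le alpha0 alpha1 n0 x iD) _.
  have CTr : 2 * (C / T) <= rho by apply: le_trans CT _; rewrite ge_min lexx.
  have := rhoP _ (mulr_ge0 (ler0n _ 2) CT0) CTr.
  rewrite ler_pdivlMr //; apply: le_trans.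
  rewrite mulrAC mulrC ler_wpM2l ?powR_ge0 //.
  by rewrite /D' lerDl.
have midpoint (u v w : R) : u - w = (u - v) - (w - v) by ring.
rewrite (midpoint _ (fd (truncated_field a T) x)).
apply: le_trans (ler_normB _ _) _.
by apply: le_trans (lerD h1 h2) _; rewrite /eta2 -splitr.
Qed.

End truncation_error.

(** * The test field *)

Section multiscale_field.
Context {R : realType} {n : nat} (alpha : R).
Hypotheses (alpha0 : 0 < alpha) (alpha1 : alpha < 1) (n0 : (0 < n)%N).
Local Notation V := 'rV[R]_n.
Local Notation L := (lebesgue_space R n).
Local Notation mu := (@leb R n).
Local Notation fd := (@fd R n alpha).
Local Notation W := (@scale_weight R n alpha).

Lemma elementary_sum I (s : seq I) (f : I -> V -> R) :
  (forall i, elementary (f i)) -> elementary (fun x => \sum_(i <- s) f i x).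
Proof.
move=> ef; elim: s => [|i s IH].
  rewrite (_ : (fun x => _) = fun=> 0); first exact: elementary_cst.
  by apply/funext => x; rewrite big_nil.
rewrite (_ : (fun x => _) = fun x => f i x + \sum_(j <- s) f j x).
  exact: elementary_add.
by apply/funext => x; rewrite big_cons.
Qed.

(** The shift to [j.+1] makes 2 r_0 = rho and 2 r_(j+1) = r_j, so that the differences telescope
    starting from scale rho. *)
Definition radius (rho : R) (j : nat) : R := rho / 2 ^+ j.+1.

Lemma radius_gt0 (rho : R) j : 0 < rho -> 0 < radius rho j.
Proof. by move=> rho0; rewrite divr_gt0 // exprn_gt0. Qed.

Variables (I : finType) (w : I -> R) (z : I -> V) (rho : R) (J : nat) (T : 'I_J -> R).
Hypotheses (rho0 : 0 < rho) (T1 : forall j, 1 <= T j).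
Local Notation r := (radius rho).
Local Notation k := (fun j : 'I_J => truncated_field (r j ^- 2) (T j) : V -> V).

Definition multiscale (y : V) : V :=
  \sum_i w i *: \sum_(j < J) W (r j) *: truncated_field (r j ^- 2) (T j) (y - z i).

Let a0 j : 0 < r j ^- 2.
Proof. by rewrite invr_gt0 exprn_gt0 // radius_gt0. Qed.

Lemma multiscale_elementary (c : R) i : elementary (fun y => (c *: multiscale y) 0 i).
Proof.
rewrite (_ : (fun y => _) = fun y => c * \sum_p w p *
    \sum_(j < J) W (r j) * truncated_field (r j ^- 2) (T j) (y - z p) 0 i).
  apply: elementary_mul; first exact: elementary_cst.
  apply: elementary_sum => p; apply: elementary_mul; first exact: elementary_cst.
  apply: elementary_sum => j; apply: elementary_mul; first exact: elementary_cst.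
  exact: truncated_field_elementary.
apply/funext => y; rewrite mxE summxE; congr (_ * _); apply: eq_bigr => p _.
by rewrite mxE summxE; congr (_ * _); apply: eq_bigr => j _; rewrite mxE.
Qed.

Lemma multiscale_support : exists M : R, forall y, multiscale y != 0 -> `|y| <= M.
Proof.
exists (\sum_i enorm (z i) + \sum_(j < J) Num.sqrt (T j / r j ^- 2)) => y.
apply: contraNT; rewrite -ltNge => yM; apply/eqP.
rewrite /multiscale big1 // => i _; rewrite big1 ?scaler0 // => j _.
have T0 : 0 < T j by exact: lt_le_trans (T1 j).
rewrite truncated_field_eq0 ?scaler0 // -sqr_enorm.
have Tr0 : 0 <= T j / r j ^- 2 by rewrite divr_ge0 // ltW.
rewrite -(sqr_sqrtr Tr0) ler_pXn2r ?nnegrE ?sqrtr_ge0 ?enorm_ge0 //.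
have h1 : enorm (z i) <= \sum_i enorm (z i).
  by rewrite (bigD1 i) //= lerDl sumr_ge0 // => ? _; exact: enorm_ge0.
have h2 : Num.sqrt (T j / r j ^- 2) <= \sum_(j < J) Num.sqrt (T j / r j ^- 2).
  by rewrite (bigD1 j) //= lerDl sumr_ge0 // => ? _; exact: sqrtr_ge0.
have h3 := norm_le_enorm y; have h4 := enormD (y - z i) (z i); rewrite subrK in h4.
move: yM h1 h2 h3 h4; move: (\sum_i _) (\sum_(j < J) _) (enorm (z i)) (enorm y) (enorm _) `|y|.
by move: (Num.sqrt _) => *; lra.
Qed.

Let BL (j : 'I_J) := truncated_field_bounded_lipschitz (n := n) (a0 j) (T1 j).
Let Lam0 : 0 <= n%:R * (4 * expR 1 + 3) :> R.
Proof. by rewrite mulr_ge0 // addr_ge0 // mulr_ge0 // expR_ge0. Qed.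
Let IL (j : 'I_J) := increments_le_lipschitz alpha0 alpha1 n0 (BL j) Lam0.
Let IT i (j : 'I_J) := increments_le_scale (W (r j)) (increments_le_translate (z i) (IL j)).
Let IS i := increments_le_sum (index_enum 'I_J) (IT i).
Let IW i := increments_le_scale (w i) (IS i).

Lemma multiscale_increments : exists A, increments_le alpha A multiscale.
Proof.
have h := increments_le_sum (index_enum I) IW.
by eexists; exact: h.
Qed.

Lemma fd_multiscale x :
  fd multiscale x = \sum_i w i * \sum_(j < J) W (r j) * fd (k j) (x - z i).
Proof.
rewrite [LHS](fd_sum alpha0 alpha1 n0 _ x IW); apply: eq_bigr => i _.
rewrite (fd_scale alpha0 alpha1 n0 _ x (IS i)); congr (_ * _).
rewrite (fd_sum alpha0 alpha1 n0 _ x (IT i)); apply: eq_bigr => j _.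
rewrite (fd_scale alpha0 alpha1 n0 _ x (increments_le_translate (z i) (IL j))).
by rewrite fd_translate.
Qed.

Lemma fd_multiscale_cts : continuous (fd multiscale).
Proof.
rewrite (_ : fd multiscale = fun x => \sum_i w i * \sum_(j < J) W (r j) * fd (k j) (x - z i)).
  apply: (@sum_cts R V R^o) => i; apply: cts_mul; first exact: cst_continuous.
  apply: (@sum_cts R V R^o) => j; apply: cts_mul; first exact: cst_continuous.
  apply: cts_comp (fd_cts alpha0 alpha1 n0 (BL j) Lam0).
  by apply: cts_sub; [exact: cts_id|exact: cst_continuous].
by apply/funext => x; rewrite fd_multiscale.
Qed.

End multiscale_field.

(** * Sup norm and energy of the multiscale field *)

Section multiscale_estimates.
Context {R : realType} {n : nat} (alpha : R).
Hypotheses (alpha0 : 0 < alpha) (alpha1 : alpha < 1) (n0 : (0 < n)%N).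
Local Notation V := 'rV[R]_n.
Local Notation L := (lebesgue_space R n).
Local Notation mu := (@leb R n).
Local Notation fd := (@fd R n alpha).
Local Notation W := (@scale_weight R n alpha).

Lemma scale_weightK (r : R) : 0 < r -> W r * (r * r ^+ n) = r `^ alpha.
Proof.
move=> r0; rewrite -exprS -powR_mulrn ?(ltW r0) // /scale_weight -powRD.
  by congr (_ `^ _); rewrite -natr1; ring.
by apply/implyP => _; rewrite lt0r_neq0.
Qed.

(** A geometric sum with ratio 2^-alpha < 1. The bound is uniform in J, which depends on E. *)
Lemma sum_radius_powR (rho : R) J : 0 < rho ->
  \sum_(j < J) radius rho j `^ alpha <= rho `^ alpha / (1 - (2 `^ alpha)^-1).
Proof.
move=> rho0; set q := (2 `^ alpha)^-1.
have p1 := powR2_gt1 alpha0.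
have p0 : 0 < 2 `^ alpha :> R by exact: lt_trans p1.
have q0 : 0 <= q by rewrite invr_ge0 ltW.
have q1 : q < 1 by rewrite invf_lt1.
have rE j : radius rho j `^ alpha = rho `^ alpha * q ^+ j.+1.
  rewrite /radius powRM ?invr_ge0 ?exprn_ge0 ?(ltW rho0) // powR_invE ?exprn_ge0 //.
  by rewrite powRN powR_exprn // exprVn.
rewrite ler_pdivlMr ?subr_gt0 //.
apply: (@le_trans _ _ (rho `^ alpha * (\sum_(j < J) q ^+ j) * (1 - q))).
  rewrite ler_wpM2r ?subr_ge0 ?(ltW q1) // mulr_sumr; apply: ler_sum => j _.
  rewrite rE ler_wpM2l ?powR_ge0 // exprS.
  by apply: ler_piMl; [exact: exprn_ge0|exact: ltW].
rewrite -mulrA -[leRHS]mulr1 ler_wpM2l ?powR_ge0 //.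
have := subrX1 q J; set S := \sum_(j < J) _ => qJ.
have : 0 <= q ^+ J by exact: exprn_ge0.
rewrite (_ : S * (1 - q) = - ((q - 1) * S)); last by ring.
by rewrite -qJ; move: (q ^+ J) => u; lra.
Qed.

Definition sup_constant : R :=
  expR (1 / 2) * 2 ^+ n * @gauss_mass R n / (1 - (2 `^ alpha)^-1).

(** At scale r the kernels sum to at most a constant times r r^n, which the weight turns into
    r^alpha. Neither the number of scales nor the truncations enter the bound. *)
Lemma multiscale_sup E (I : finType) (F : I -> set L) (z : I -> V) (d t rho : R)
    J (T : 'I_J -> R) (y : V) :
  (mu E < +oo)%E -> pieces E F z d t -> 0 < rho -> (forall j, 1 <= T j) ->
  (forall j : 'I_J, d <= radius rho j) ->
  enorm (multiscale alpha (vol \o F) z rho T y) <= sup_constant * rho `^ alpha.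
Proof.
move=> Eoo PF rho0 T1 dr; set C := expR (1 / 2) * 2 ^+ n * @gauss_mass R n.
have W0 r : 0 <= W r by exact: powR_ge0.
have C0 : 0 <= C by rewrite !mulr_ge0 ?expR_ge0 ?exprn_ge0 // Rintegral_ge0 // => x _; exact: gauss_ge0.
apply: (@le_trans _ _ (\sum_(j < J) W (radius rho j) * (radius rho j *
    \sum_i vol (F i) * gauss (radius rho j ^- 2 / 2) (y - z i)))).
  rewrite /multiscale; apply: le_trans (enorm_sum _ _ _) _.
  apply: (@le_trans _ _ (\sum_i \sum_(j < J) W (radius rho j) * (radius rho j *
    (vol (F i) * gauss (radius rho j ^- 2 / 2) (y - z i))))).
    apply: ler_sum => i _; rewrite enormZ ger0_norm ?vol_ge0 //=.
    apply: le_trans (ler_wpM2l (vol_ge0 _) (enorm_sum _ _ _)) _.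
    rewrite mulr_sumr; apply: ler_sum => j _; rewrite enormZ ger0_norm //.
    rewrite mulrCA ler_wpM2l // mulrCA ler_wpM2l ?vol_ge0 //.
    have r0 := radius_gt0 j rho0.
    apply: le_trans (truncated_field_le _ _ _) _.
    - by rewrite invr_gt0 exprn_gt0.
    - exact: lt_le_trans (T1 j).
    - exact: enorm_gauss_field_le.
  rewrite exchange_big /=; apply: ler_sum => j _.
  by rewrite !mulr_sumr.
apply: (@le_trans _ _ (\sum_(j < J) C * radius rho j `^ alpha)).
  apply: ler_sum => j _; have r0 := radius_gt0 j rho0.
  rewrite -(scale_weightK r0) [leRHS]mulrCA ler_wpM2l //.
  rewrite [leRHS]mulrCA ler_wpM2l ?(ltW r0) //.
  exact: (gauss_sum_pieces_le n0 y Eoo PF r0 (dr j)).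
rewrite -mulr_sumr /sup_constant -/C -mulrA ler_wpM2l // mulrC; exact: sum_radius_powR.
Qed.

(** The one-scale bounds telescope; their common constant is independent of the scale. *)
Lemma multiscale_energy : 0 < @gauss_mass R n -> exists2 c : R, 0 < c &
  forall (I : finType) (w : I -> R) (z : I -> V) (rho : R) J, (forall i, 0 <= w i) -> 0 < rho ->
  c * (scale_sum w z (rho / 2 ^+ J) - scale_sum w z rho) <=
  \sum_(j < J) W (radius rho j) * pair_sum w z (fd (gauss_field (radius rho j ^- 2))).
Proof.
move=> M0; have [c c0 cP] := energy_lower_bound alpha0 alpha1 n0 M0.
exists c => // I w z rho J w0 rho0; elim: J => [|J IH].
  by rewrite big_ord0 expr0 divr1 subrr mulr0.
rewrite big_ord_recr /=; have r0 := radius_gt0 J rho0.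
have := cP I w z _ w0 r0; rewrite (_ : 2 * radius rho J = rho / 2 ^+ J); last first.
  by rewrite /radius exprS; field; rewrite lt0r_neq0 ?exprn_gt0.
rewrite -[rho / 2 ^+ J.+1]/(radius rho J); move=> h.
by apply: le_trans (lerD IH h); rewrite -mulrDr ler_pM2l // [leRHS]addrC addrA subrK.
Qed.

End multiscale_estimates.

Section test_field_energy.
Context {R : realType} {n : nat} (alpha : R).
Hypotheses (alpha0 : 0 < alpha) (alpha1 : alpha < 1) (n0 : (0 < n)%N).
Hypothesis unit_vol_gt0 : 0 < @unit_vol R n.
Local Notation V := 'rV[R]_n.
Local Notation L := (lebesgue_space R n).
Local Notation mu := (@leb R n).
Local Notation fd := (@fd R n alpha).
Local Notation W := (@scale_weight R n alpha).
Implicit Types (A E : set L).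

Lemma pieces_weaken E (I : finType) (F : I -> set L) (z : I -> V) (d d' t t' : R) :
  pieces E F z d t -> d <= d' -> t <= t' -> pieces E F z d' t'.
Proof.
move=> [mF tF zd rest] dd' tt'; split => //.
  by move=> i x xi; exact: le_trans (zd i x xi) dd'.
by apply: le_trans rest _; rewrite lee_fin.
Qed.

(** Passage from the integral to the double sum: on each piece the evaluation point moves to the
    centre and the truncated field is replaced by the Gaussian one, at cost eta per pair and scale;
    on the uncovered part only the sup bound of [fd phi] is used. *)
Lemma multiscale_integral_ge E (I : finType) (F : I -> set L) (z : I -> V) (d t rho eta : R)
    J (T B : 'I_J -> R) :
  measurable E -> (mu E < +oo)%E -> pieces E F z d t -> 0 < rho -> (forall j, 1 <= T j) ->
  0 <= eta -> (forall j, 0 <= B j) ->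
  (forall (j : 'I_J) x, `|fd (truncated_field (radius rho j ^- 2) (T j)) x| <= B j) ->
  (forall (j : 'I_J) x tau, enorm tau <= d ->
     `|fd (truncated_field (radius rho j ^- 2) (T j)) (x + tau) -
       fd (gauss_field (radius rho j ^- 2)) x| <= eta) ->
  let phi := multiscale alpha (vol \o F) z rho T in
  mu.-integrable E (EFin \o (fd phi : L -> R)) /\
  \sum_(j < J) W (radius rho j) * pair_sum (vol \o F) z (fd (gauss_field (radius rho j ^- 2)))
    - vol E ^+ 2 * (\sum_(j < J) W (radius rho j)) * eta
    - vol E * (\sum_(j < J) W (radius rho j) * B j) * t
  <= \int[mu]_(x in E) fd phi x.
Proof.
move=> mE Eoo PF rho0 T1 eta0 B0 kB kclose phi.
have W0 r : 0 <= W r by exact: powR_ge0.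
set SW := \sum_(j < J) W (radius rho j); set SB := \sum_(j < J) W (radius rho j) * B j.
have SW0 : 0 <= SW by apply: sumr_ge0.
have SB0 : 0 <= SB by apply: sumr_ge0 => j _; rewrite mulr_ge0.
have v0 := vol_ge0 E.
have wle := sum_vol_pieces_le mE Eoo PF.
have w0 : 0 <= \sum_i vol (F i) by apply: sumr_ge0 => i _; exact: vol_ge0.
have phiE x := fd_multiscale alpha0 alpha1 n0 (vol \o F) z rho0 T1 x.
have phic : continuous (fd phi) by exact: fd_multiscale_cts.
have phiB x : `|fd phi x| <= vol E * SB.
  rewrite phiE; apply: le_trans (ler_norm_sum _ _ _) _.
  apply: (@le_trans _ _ (\sum_i vol (F i) * SB)); last by rewrite -mulr_suml ler_wpM2r.
  apply: ler_sum => i _; rewrite normrM ger0_norm ?vol_ge0 //= ler_wpM2l ?vol_ge0 //.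
  apply: le_trans (ler_norm_sum _ _ _) _; apply: ler_sum => j _.
  by rewrite normrM ger0_norm // ler_wpM2l.
(* Lower bound for [fd phi] on the piece [F p]: the Gaussian value at the centre minus the
   accumulated error. *)
pose a p := \sum_i vol (F i) * \sum_(j < J) W (radius rho j) *
  fd (gauss_field (radius rho j ^- 2)) (z p - z i) - vol E * SW * eta.
have phia p x : F p x -> a p <= fd phi x.
  move=> px; have [_ _ zd _] := PF; have xz := zd p x px.
  rewrite phiE /a lerBlDr.
  apply: (@le_trans _ _ (\sum_i vol (F i) * (\sum_(j < J) W (radius rho j) *
    fd (truncated_field (radius rho j ^- 2) (T j)) (x - z i) + SW * eta))).
    apply: ler_sum => i _; rewrite ler_wpM2l ?vol_ge0 // /SW mulr_suml -big_split /=.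
    apply: ler_sum => j _; rewrite -mulrDr ler_wpM2l //.
    have := kclose j (z p - z i) (x - z p) xz.
    rewrite (_ : z p - z i + (x - z p) = x - z i); last by rewrite addrC addrA subrK.
    by rewrite ler_norml => /andP[+ _]; move: (fd _ _) (fd _ _) => u u'; lra.
  under eq_bigr do rewrite mulrDr; rewrite big_split /= lerD2l -mulr_suml.
  by rewrite mulrA -[leLHS]mulrA -[leRHS]mulrA ler_wpM2r // mulr_ge0.
have phi_ge x : E x -> - (vol E * SB) <= fd phi x.
  by move=> _; have := phiB x; rewrite ler_norml => /andP[].
have [iphi le] := integral_ge_pieces mE Eoo PF phic phiB (mulr_ge0 v0 SB0) phi_ge phia.
split=> //; apply: le_trans le; rewrite lerD2r.
have -> : \sum_i vol (F i) * a i = \sum_(j < J) W (radius rho j) *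
   pair_sum (vol \o F) z (fd (gauss_field (radius rho j ^- 2))) -
   (\sum_i vol (F i)) * (vol E * SW * eta).
  under eq_bigr do rewrite /a mulrBr; rewrite sumrB -mulr_suml; congr (_ - _).
  under [RHS]eq_bigr do rewrite /pair_sum mulr_sumr.
  rewrite [RHS]exchange_big /=; apply: eq_bigr => p _; rewrite mulr_sumr.
  under [RHS]eq_bigr do rewrite mulr_sumr.
  rewrite [RHS]exchange_big /=; apply: eq_bigr => i _; rewrite !mulr_sumr.
  by apply: eq_bigr => j _ /=; ring.
by rewrite lerD2l lerN2 expr2 -!mulrA ler_wpM2r // !mulr_ge0.
Qed.

(** The value of rho^n makes rho^-n |E|^2 = c0 |E| / 2, half of the lower bound c0 |E| at the
    smallest scale. The parameters are then fixed in the order J, B, eta and t, T and delta, d, and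
    only at the end the pieces. *)
Lemma exists_energy_field : exists c0 c1 : R, [/\ 0 < c0, 0 < c1 &
  forall E (rho : R), measurable E -> (mu E < +oo)%E -> 0 < vol E -> 0 < rho ->
  rho ^+ n = 2 * vol E / c0 ->
  exists N (F : 'I_N -> set L) (z : 'I_N -> V) (d t : R) J (T : 'I_J -> R),
  let phi := multiscale alpha (vol \o F) z rho T in
  [/\ pieces E F z d t, forall j, 1 <= T j, forall j : 'I_J, d <= radius rho j,
      mu.-integrable E (EFin \o (fd phi : L -> R)) &
      c1 * vol E <= \int[mu]_(x in E) fd phi x]].
Proof.
have M0 := gauss_mass_gt0 n0 unit_vol_gt0.
have [c0 c00 scale_ge] := scale_sum_ge n0 unit_vol_gt0.
have [c cp energy] := multiscale_energy alpha0 alpha1 n0 M0.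
exists c0, (c * c0 / 4); split; rewrite ?divr_gt0 ?mulr_gt0 //.
move=> E rho mE Eoo v0 rho0 rhoE.
have [e1 e10 PE] := scale_ge E mE Eoo v0.
have [J Je] : exists J, rho / 2 ^+ J <= e1.
  have [j /andP[_ jP]] := @dyadic_bounds R (1 + rho / e1) (ler_wpDr (ltW (divr_gt0 rho0 e10)) (lexx 1)).
  exists j.+1; rewrite ler_pdivrMr ?exprn_gt0 // mulrC -ler_pdivrMr //.
  by move: jP; move: (rho / e1) (2 ^+ j.+1) => u w; lra.
set e := rho / 2 ^+ J in Je.
have e0 : 0 < e by rewrite divr_gt0 // exprn_gt0.
have a0 j : 0 < radius rho j ^- 2 by rewrite invr_gt0 exprn_gt0 // radius_gt0.
have BP j := truncated_fd_approx alpha0 alpha1 n0 (a0 j).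
have /choice[B BB] : forall j, exists Bj : R, 0 <= Bj /\ forall eta : R, 0 < eta -> exists T delta : R,
  [/\ 1 <= T, 0 < delta,
      forall x, `|fd (truncated_field (radius rho j ^- 2) T) x| <= Bj &
      forall x tau, enorm tau <= delta ->
        `|fd (truncated_field (radius rho j ^- 2) T) (x + tau) -
          fd (gauss_field (radius rho j ^- 2)) x| <= eta].
  by move=> j; have [Bj Bj0 h] := BP j; exists Bj.
pose SW := \sum_(j < J) W (radius rho j); pose SB := \sum_(j < J) W (radius rho j) * B j.
have W0 r : 0 <= W r by exact: powR_ge0.
have SW0 : 0 <= SW by apply: sumr_ge0.
have SB0 : 0 <= SB by apply: sumr_ge0 => j _; rewrite mulr_ge0 // (BB j).1.
(* Each error term is made at most c c0 |E| / 8, so that c c0 |E| / 2 from the telescoped sum leaves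
   c c0 |E| / 4. The added 1 guards against a vanishing denominator. *)
pose eta := c * c0 / (8 * (vol E * SW + 1)).
pose t := Num.min (vol E / 4) (c * c0 / (8 * (SB + 1))).
have eta0 : 0 < eta.
  by rewrite divr_gt0 ?mulr_gt0 // ltr_wpDl // mulr_ge0 // ltW.
have t0 : 0 < t by rewrite lt_min !divr_gt0 ?mulr_gt0 // ltr_wpDl.
have /choice[T TP] : forall j, exists Tj : R, exists delta : R,
  [/\ 1 <= Tj, 0 < delta,
      forall x, `|fd (truncated_field (radius rho j ^- 2) Tj) x| <= B j &
      forall x tau, enorm tau <= delta ->
        `|fd (truncated_field (radius rho j ^- 2) Tj) (x + tau) -
          fd (gauss_field (radius rho j ^- 2)) x| <= eta].
  by move=> j; exact: (BB j).2 eta eta0.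
have [dl dlP] := choice TP.
(* Small enough for [scale_sum_ge], hence also for the sup bound at every scale, and below the
   displacement tolerated at each of the finitely many scales. *)
pose d := Num.min (e / 2) (\big[Num.min/1]_(j < J) dl j).
have d0 : 0 < d.
  rewrite lt_min divr_gt0 //=; apply: (big_ind (fun x : R => 0 < x)) => [|x y x0 y0|j _].
    exact: ltr01.
    by rewrite lt_min x0.
  by have [] := dlP j.
have dl_ge (j : 'I_J) : d <= dl j.
  by rewrite ge_min; apply/orP; right; rewrite (bigD1 j) //= ge_min lexx.
have de : d <= e / 2 by rewrite ge_min lexx.
have [N [F [z PF]]] := exists_pieces n0 mE Eoo d0 t0.
exists N, F, z, d, t, J, (fun j : 'I_J => T j) => phi.
have T1 (j : 'I_J) : 1 <= T j by have [] := dlP j.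
have PF' : pieces E F z (e / 2) (vol E / 4).
  by apply: (pieces_weaken PF) => //; rewrite ge_min lexx.
have [iphi phi_ge] : _ /\ _ := multiscale_integral_ge mE Eoo PF rho0 T1 (ltW eta0)
  (fun j : 'I_J => (BB j).1) (fun j : 'I_J => let: And4 _ _ h _ := dlP j in h)
  (fun (j : 'I_J) x tau h => let: And4 _ _ _ k := dlP j in k x tau (le_trans h (dl_ge j))).
split => //.
  move=> j; apply: le_trans de _; rewrite /e /radius -mulrA -invfM -exprSr ler_pM2l //.
  by rewrite lef_pV2 ?posrE ?exprn_gt0 // ler_weXn2l ?ler1n // ltnS ltnW.
apply: le_trans phi_ge.
have h1 := energy _ (vol \o F) z rho J (fun i => vol_ge0 (F i)) rho0.
have h2 := PE _ F z e e0 Je PF'.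
have h3 := scale_sum_le z (fun i => vol_ge0 (F i)) rho0.
have h4 := sum_vol_pieces_le mE Eoo PF.
have h5 : 0 <= \sum_i vol (F i) by apply: sumr_ge0 => i _; exact: vol_ge0.
have le_fraction (y x : R) : 0 <= y -> 0 <= x -> y * (x / (x + 1)) <= y.
  move=> y0 x0; rewrite -[leRHS]mulr1 ler_wpM2l // ler_pdivrMr ?mul1r ?lerDl //.
  by rewrite ltr_wpDl.
have ccv : 0 <= c * c0 / 8 * vol E by rewrite !mulr_ge0 // ltW.
have h6 : vol E ^+ 2 * SW * eta <= c * c0 / 8 * vol E.
  rewrite (_ : vol E ^+ 2 * SW * eta = c * c0 / 8 * vol E * (vol E * SW / (vol E * SW + 1))).
    exact: le_fraction ccv (mulr_ge0 (ltW v0) SW0).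
  by rewrite /eta; field; rewrite lt0r_neq0 // ltr_wpDl // mulr_ge0 // ltW.
have h7 : vol E * SB * t <= c * c0 / 8 * vol E.
  apply: (@le_trans _ _ (vol E * SB * (c * c0 / (8 * (SB + 1))))).
    by rewrite ler_wpM2l ?mulr_ge0 ?(ltW v0) // ge_min lexx orbT.
  rewrite (_ : vol E * SB * _ = c * c0 / 8 * vol E * (SB / (SB + 1))).
    exact: le_fraction ccv SB0.
  by field; rewrite lt0r_neq0 // ltr_wpDl.
have h8 : rho ^- n * (\sum_i vol (F i)) ^+ 2 <= c0 * vol E / 2.
  rewrite rhoE (_ : c0 * vol E / 2 = (2 * vol E / c0)^-1 * vol E ^+ 2); last first.
    by field; rewrite (lt0r_neq0 v0) (lt0r_neq0 c00).
  by rewrite ler_wpM2l ?invr_ge0 ?divr_ge0 ?mulr_ge0 ?(ltW v0) ?(ltW c00) // ler_pXn2r ?nnegrE ?(ltW v0).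
have h9 : c * (c0 * vol E / 2) <= c * (scale_sum (vol \o F) z e - scale_sum (vol \o F) z rho).
  rewrite ler_pM2l //; have := le_trans h3 h8; move: h2.
  move: (scale_sum _ z e) (scale_sum _ z rho) => s s' ; lra.
have := le_trans h9 h1; move: h6 h7; rewrite /SW /SB.
move: (vol E ^+ 2 * _ * eta) (vol E * _ * t) (\sum_(_ < _) _ * pair_sum _ _ _) => x y u.
lra.
Qed.

End test_field_energy.

(** * From the test field to the perimeter *)

Section perimeter_lower_bound.
Context {R : realType} {n : nat} (alpha : R).
Hypotheses (alpha0 : 0 < alpha) (alpha1 : alpha < 1) (n0 : (0 < n)%N).
Local Notation V := 'rV[R]_n.
Local Notation L := (lebesgue_space R n).
Local Notation mu := (@leb R n).
Implicit Types (E : set L).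

Lemma Lnorm_pinfty_le1 (phi : V -> V) : (forall x, enorm (phi x) <= 1) ->
  ('N[mu]_+oo [EFin \o (enorm \o phi)] <= 1)%E.
Proof.
move=> phi1; rewrite unlock; case: ifP => _ //.
apply/ess_sup_inf.ess_supP; apply: aeW => x /=.
by rewrite ger0_norm ?enorm_ge0 // lee_fin.
Qed.

(** The zero field is an admissible competitor; needed for sets of measure 0. *)
Lemma frac_perimeter_ge0 E : (0 <= frac_perimeter alpha E)%E.
Proof.
apply: ereal_sup_ubound; exists (fun=> 0).
  split.
  - apply: elementary_smooth => j.
    rewrite (_ : (fun x : V => _) = fun=> 0); first exact: elementary_cst.
    by apply/funext => x; rewrite mxE.
  - by apply: (@bounded_support_compact R n _ 0) => x; rewrite eqxx.
  - by apply: Lnorm_pinfty_le1 => x; rewrite enorm0.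
rewrite (eq_integral (cst 0%E)); first exact: integral0.
move=> x _; rewrite (frac_divE alpha0 alpha1 n0 x (increments_le0 alpha)).
by rewrite fd0 mulr0.
Qed.

Lemma frac_perimeter_ge (c : R) (phi : V -> V) (A M : R) E : 0 < c ->
  measurable E -> (forall i, elementary (fun x => (c *: phi x) 0 i)) ->
  (forall x, phi x != 0 -> `|x| <= M) -> (forall x, c * enorm (phi x) <= 1) ->
  increments_le alpha A phi -> mu.-integrable E (EFin \o (fd alpha phi : L -> R)) ->
  ((frac_const n alpha * c * \int[mu]_(x in E) fd alpha phi x)%:E <= frac_perimeter alpha E)%E.
Proof.
move=> c0 mE ephi sphi phi1 iphi Iphi.
apply: ereal_sup_ubound; exists (fun x => c *: phi x).
  split.
  - exact: elementary_smooth.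
  - apply: (@bounded_support_compact R n _ M) => x.
    by rewrite scaler_eq0 negb_or => /andP[_]; exact: sphi.
  - by apply: Lnorm_pinfty_le1 => x; rewrite enormZ gtr0_norm.
have iphi' := increments_le_scale c iphi.
rewrite (eq_integral (fun x : L => (frac_const n alpha * c)%:E * (fd alpha phi x)%:E)%E).
  rewrite integralZl // [RHS]EFinM fineK //.
  exact: integrable_fin_num.
move=> x _; rewrite (frac_divE alpha0 alpha1 n0 x iphi') (fd_scale alpha0 alpha1 n0 c x iphi).
by rewrite -EFinM mulrA.
Qed.

Lemma sup_constant_gt0 : 0 < @gauss_mass R n -> 0 < @sup_constant R n alpha.
Proof.
move=> M0; have p1 := powR2_gt1 alpha0.
have p0 : 0 < 2 `^ alpha :> R by exact: lt_trans p1.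
by rewrite divr_gt0 ?subr_gt0 ?invf_lt1 // !mulr_gt0 ?expR_gt0 ?exprn_gt0.
Qed.

(** The field is divided by its sup bound S rho^alpha = S (2/c0)^(alpha/n) |E|^(alpha/n); dividing
    c1 |E| by the same number gives the exponent (n-alpha)/n and the constant. *)
Lemma isoperimetric_lower_bound : 0 < @unit_vol R n -> 0 < frac_const n alpha ->
  exists2 k : R, 0 < k & forall E, measurable E -> (mu E < +oo)%E -> 0 < vol E ->
  ((k * vol E `^ ((n%:R - alpha) / n%:R))%:E <= frac_perimeter alpha E)%E.
Proof.
move=> u0 f0; have M0 := gauss_mass_gt0 n0 u0.
have S0 := sup_constant_gt0 M0; set S := @sup_constant R n alpha in S0.
have [c0 [c1 [c00 c10 H]]] := exists_energy_field alpha0 alpha1 n0 u0.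
have nR0 : 0 < n%:R :> R by rewrite ltr0n.
exists (frac_const n alpha * (c1 / (S * (2 / c0) `^ (alpha / n%:R)))).
  have c20 : 0 < 2 / c0 by rewrite divr_gt0.
  by rewrite mulr_gt0 // divr_gt0 // mulr_gt0 // powR_gt0.
move=> E mE Eoo v0; set v := vol E in v0 *.
pose rho := (2 * v / c0) `^ n%:R^-1.
have vc0 : 0 < 2 * v / c0 by rewrite divr_gt0 // mulr_gt0.
have rho0 : 0 < rho by exact: powR_gt0.
have rhoE : rho ^+ n = 2 * v / c0.
  by rewrite -powR_mulrn ?(ltW rho0) // -powRrM mulVf ?lt0r_neq0 // powRr1 // ltW.
have [N [F [z [d [t [J [T [PF T1 dr iphi le]]]]]]]] := H E rho mE Eoo v0 rho0 rhoE.
set phi := multiscale alpha (vol \o F) z rho T in iphi le.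
have [A phiA] := multiscale_increments alpha0 alpha1 n0 (vol \o F) z rho0 T1.
have [M phiM] := multiscale_support alpha (vol \o F) z rho0 T1.
have rA0 : 0 < rho `^ alpha by exact: powR_gt0.
have s0 : 0 < (S * rho `^ alpha)^-1 by rewrite invr_gt0 mulr_gt0.
have phiS x : (S * rho `^ alpha)^-1 * enorm (phi x) <= 1.
  rewrite ler_pdivrMl; last exact: mulr_gt0.
  rewrite mulr1.
  exact: (multiscale_sup alpha0 n0 x Eoo PF rho0 T1 dr).
apply: le_trans (frac_perimeter_ge s0 mE _ phiM phiS phiA iphi); last first.
  move=> i; exact: multiscale_elementary.
rewrite lee_fin -[leLHS]mulrA -[leRHS]mulrA ler_pM2l //.
apply: (@le_trans _ _ ((S * rho `^ alpha)^-1 * (c1 * v))); last by rewrite ler_pM2l.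
rewrite le_eqVlt; apply/orP; left; apply/eqP.
have -> : rho `^ alpha = (2 / c0) `^ (alpha / n%:R) * v `^ (alpha / n%:R).
  rewrite /rho -powRrM [_^-1 * _]mulrC -powRM ?divr_ge0 ?(ltW v0) ?(ltW c00) //.
  by rewrite mulrAC.
have -> : v `^ ((n%:R - alpha) / n%:R) = v / v `^ (alpha / n%:R).
  rewrite mulrBl mulfV ?lt0r_neq0 // powRD; last by rewrite (lt0r_neq0 v0) implybT.
  by rewrite powRr1 ?(ltW v0) // powRN.
by rewrite !invfM; ring.
Qed.

Lemma frac_isoperimetric : 0 < frac_const n alpha -> exists c : R, 0 < c /\
  forall E, measurable E -> (mu E < +oo)%E ->
  (poweR (mu E) ((n%:R - alpha) / n%:R) <= c%:E * frac_perimeter alpha E)%E.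
Proof.
(* Null sets: the power of 0 is 0 because alpha < 1 <= n keeps the exponent nonzero. *)
move=> f0; have null E (c : R) : mu E = 0 -> 0 < c ->
    (poweR (mu E) ((n%:R - alpha) / n%:R) <= c%:E * frac_perimeter alpha E)%E.
  move=> -> c0; rewrite poweR0r; last first.
    rewrite mulf_neq0 ?invr_eq0 ?pnatr_eq0 -?lt0n // subr_eq0 gt_eqF //.
    by rewrite (lt_le_trans alpha1) // ler1n.
  by rewrite mule_ge0 ?frac_perimeter_ge0 // lee_fin ltW.
have [u0|u0] := eqVneq (@unit_vol R n) 0.
  by exists 1; split=> // E _ _; apply: null => //; exact: leb_eq0.
have {}u0 : 0 < @unit_vol R n by rewrite lt_neqAle eq_sym u0 unit_vol_ge0.
have [k k0 kP] := isoperimetric_lower_bound u0 f0.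
exists k^-1; rewrite invr_gt0; split => // E mE Eoo.
have [v0|v0] := eqVneq (vol E) 0.
  by apply: null; rewrite ?invr_gt0 // -volK // v0.
have {}v0 : 0 < vol E by rewrite lt_neqAle eq_sym v0 vol_ge0.
rewrite -[X in poweR X _]volK // poweR_EFin.
have := kP E mE Eoo v0; rewrite EFinM.
move=> h; apply: le_trans (lee_wpmul2l _ h); last by rewrite lee_fin invr_ge0 ltW.
by rewrite -!EFinM lee_fin mulKf ?lt0r_neq0.
Qed.

End perimeter_lower_bound.

(** * The normalising constant *)

Section gamma.
Context {R : realType}.
Local Notation mu := (@lebesgue_measure R).
Local Notation T := (measurableTypeR R).

Definition gamma_density (s t : R) : R := t `^ (s - 1) * expR (- t).

Lemma gamma_density_ge0 s t : 0 <= gamma_density s t.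
Proof. by rewrite mulr_ge0 ?powR_ge0 ?expR_ge0. Qed.

Lemma measurable_gamma_density s : measurable_fun [set: R] (gamma_density s).
Proof.
apply: measurable_funM; first exact: measurable_powR.
by apply: measurableT_comp; [exact: measurable_expR|exact: measurable_funN].
Qed.

Lemma powR_subr1 (s t : R) : 0 < t -> t `^ (s - 1) = t `^ s / t.
Proof.
by move=> t0; rewrite powRD ?(lt0r_neq0 t0) ?implybT // powRN powRr1 // ltW.
Qed.

Lemma lebesgue_interval_le (a : R) : 0 <= a -> (mu `]0%R, a] <= a%:E)%E.
Proof.
move=> a0; rewrite lebesgue_measure_itv /= lte_fin.
by case: ifP => _; rewrite ?oppr0 ?addr0 ?sube0 ?lee_fin.
Qed.

(** For 2^-(j+1) < t <= 2^-j, the factor 1/t is below 2^(j+1) and t^s at most 2^(-js); against the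
    length 2^-j this leaves the ratio 2^-s. *)
Lemma integrable_gamma_near s : 0 < s ->
  mu.-integrable setT (EFin \o (fun t : R => \1_`]0, 1] t * gamma_density s t)).
Proof.
move=> s0; have q1 : (2 `^ s)^-1 < 1 :> R.
  by rewrite invf_lt1 ?powR_gt0 // powR2_gt1.
have q0 : 0 <= (2 `^ s)^-1 :> R by rewrite invr_ge0 powR_ge0.
have mI : measurable_fun [set: R] (\1_`]0, 1] : R -> R) by exact: measurable_indic.
apply: (integrable_geometric_cover (mu := mu) (A := fun j => `]0, (2 ^+ j)^-1]%classic)
   (m := fun j => (2 ^+ j)^-1) (c := fun j => 2 * 2 ^+ j * (2 `^ s)^-1 ^+ j) (M := 2)
   (q := (2 `^ s)^-1)).
- exact: measurable_funM mI (measurable_gamma_density s).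
- by move=> j; exact: measurable_itv.
- by move=> j; rewrite !mulr_ge0 ?exprn_ge0.
- by [].
- by rewrite q0.
- by move=> j; apply: lebesgue_interval_le; rewrite invr_ge0 exprn_ge0.
- move=> j.
  by rewrite mulrAC mulfK ?expf_neq0.
move=> t; rewrite indicE; case: (boolP (t \in _)); last by rewrite mul0r eqxx.
rewrite inE /= in_itv /= => /andP[t0 t1] _; rewrite mul1r.
have tV : 1 <= t^-1 by rewrite invf_ge1.
have [j /andP[j1 j2]] := dyadic_bounds tV.
have p0 : 0 < 2 ^+ j :> R by rewrite exprn_gt0.
have tj : t <= (2 ^+ j)^-1 by rewrite -[t]invrK lef_pV2 ?posrE // invr_gt0.
exists j; first by rewrite /= in_itv /= t0.
rewrite ger0_norm ?gamma_density_ge0 // /gamma_density powR_subr1 //.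
rewrite -mulrA mulrC; apply: ler_pM.
- by rewrite mulr_ge0 ?expR_ge0 ?invr_ge0 // ltW.
- exact: powR_ge0.
- apply: (@le_trans _ _ t^-1).
    by rewrite -[leRHS]mulr1 ler_wpM2l ?invr_ge0 ?(ltW t0) // -expR0 ler_expR oppr_le0 ltW.
  by rewrite -exprS ltW.
- apply: (@le_trans _ _ ((2 ^+ j)^-1 `^ s)).
    by rewrite ge0_ler_powR ?nnegrE ?invr_ge0 ?(ltW s0) ?(ltW t0) ?(ltW p0).
  by rewrite powR_invE ?(ltW p0) // powRN powR_exprn // exprVn.
Qed.

Lemma integrable_gamma_far s : 0 < s ->
  mu.-integrable setT (EFin \o (fun t : R => \1_`[1, +oo[ t * gamma_density s t)).
Proof.
move=> s0; have s1 : 0 <= 2 * (s + 1) by rewrite mulr_ge0 // addr_ge0 // ltW.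
(* Applied at the square root of t, this bounds t^(s+1) exp(-t), so the density is at most C /
   t^2. *)
have [C C0 CP] := @powR_gauss_bounded R _ 1 s1 ltr01.
have mI : measurable_fun [set: R] (\1_`[1, +oo[ : R -> R) by exact: measurable_indic.
have CE (t : R) : 0 < t -> gamma_density s t <= C / t ^+ 2.
  move=> t0; rewrite ler_pdivlMr ?exprn_gt0 //.
  have := CP (Num.sqrt t) (sqrtr_ge0 t); rewrite sqr_sqrtr ?(ltW t0) // mul1r.
  apply: le_trans; rewrite /gamma_density mulrAC ler_wpM2r ?expR_ge0 //.
  rewrite -powR_mulrn ?(ltW t0) // -powRD; last by rewrite (lt0r_neq0 t0) implybT.
  rewrite powRrM powR_mulrn ?sqrtr_ge0 // sqr_sqrtr ?(ltW t0) //.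
  by rewrite (_ : s - 1 + 2 = s + 1) //; ring.
apply: (integrable_geometric_cover (mu := mu) (A := fun j => `]0, 2 ^+ j.+1]%classic)
   (m := fun j => 2 ^+ j.+1) (c := fun j => C / 2 ^+ j / 2 ^+ j) (M := 2 * C) (q := 2^-1)).
- exact: measurable_funM mI (measurable_gamma_density s).
- by move=> j; exact: measurable_itv.
- by move=> j; rewrite !divr_ge0 ?exprn_ge0 // ltW.
- by rewrite mulr_ge0 // ltW.
- by apply/andP; split; lra.
- by move=> j; apply: lebesgue_interval_le; rewrite exprn_ge0.
- move=> j; rewrite le_eqVlt; apply/orP; left; apply/eqP; rewrite exprVn exprS; field.
  by rewrite expf_neq0.
move=> t; rewrite indicE; case: (boolP (t \in _)); last by rewrite mul0r eqxx.
rewrite inE /= in_itv /= andbT => t1 _; rewrite mul1r.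
have t0 : 0 < t by exact: lt_le_trans t1.
have [j /andP[j1 j2]] := dyadic_bounds t1.
have p0 : 0 < 2 ^+ j :> R by rewrite exprn_gt0.
exists j; first by rewrite /= in_itv /= t0 ltW.
rewrite ger0_norm ?gamma_density_ge0 //; apply: le_trans (CE t t0) _.
rewrite -mulrA -invfM ler_pM2l // lef_pV2 ?posrE ?mulr_gt0 ?exprn_gt0 //.
by rewrite expr2 ler_pM // ltW.
Qed.

(** The real-valued integral [Gamma] would be 0 if it diverged, so its positivity rests on this
    convergence. *)
Lemma integrable_gamma s : 0 < s ->
  mu.-integrable `]0, +oo[ (EFin \o gamma_density s).
Proof.
move=> s0.
have h := integrable_addr measurableT (integrable_gamma_near s0) (integrable_gamma_far s0).
have mD : @measurable _ T `]0, +oo[%classic by exact: measurable_itv.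
apply: (le_integrable_real mD _ _ (integrableS measurableT mD (@subsetT _ _) h)).
  by apply: measurable_funTS; exact: measurable_gamma_density.
move=> t; rewrite /= in_itv /= andbT => t0; rewrite ger0_norm ?gamma_density_ge0 //.
rewrite -mulrDl -[leLHS]mul1r ler_wpM2r ?gamma_density_ge0 // !indicE.
have [t1|t1] := leP t 1.
  by rewrite mem_set ?lerDl // /= in_itv /= t0.
by rewrite addrC mem_set ?lerDl // /= in_itv /= andbT ltW.
Qed.

Lemma Gamma_gt0 (s : R) : 0 < s -> 0 < Gamma s.
Proof.
move=> s0; have mD : @measurable _ T `]0, +oo[%classic by exact: measurable_itv.
have mB : @measurable _ T `]1, 2]%classic by exact: measurable_itv.
(* Lower bound of the density on the interval from 1 to 2, where t^s / t >= 1/2 and exp(-t) >=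
   exp(-2). *)
have k0 : 0 < expR (-2) / 2 :> R by rewrite divr_gt0 ?expR_gt0.
have muB : 0 < fine (mu `]1, 2]).
  rewrite lebesgue_measure_itv /= lte_fin ltr1n /=.
  by rewrite subr_gt0 ltr1n.
have i1 : mu.-integrable `]0, +oo[ (EFin \o (\1_`]1, 2] : R -> R)).
  apply: (integrableS measurableT mD (@subsetT _ _)).
  exact: integrable_indic_itv.
apply: (@lt_le_trans _ _ (\int[mu]_(t in `]0, +oo[) (expR (-2) / 2 * \1_`]1, 2] t))).
  rewrite (RintegralZl _ mD i1) /Rintegral (integral_indic _ mD mB) setIidl.
    exact: mulr_gt0 k0 muB.
  by move=> t /=; rewrite !in_itv /= andbT => /andP[t1 _]; exact: lt_trans t1.
apply: le_Rintegral => //; [exact: (integrable_scaler mD)|exact: integrable_gamma|].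
move=> t; rewrite /= in_itv /= andbT => t0; rewrite indicE.
case: (boolP (t \in _)); last by rewrite mulr0 gamma_density_ge0.
rewrite inE /= in_itv /= => /andP[t1 t2]; rewrite mulr1 /gamma_density powR_subr1 // mulrC.
apply: ler_pM.
- by rewrite invr_ge0.
- exact: expR_ge0.
- rewrite ler_pdivlMr //; apply: (@le_trans _ _ 1); first by rewrite mulrC ler_pdivrMr // mul1r.
  have := @ge0_ler_powR R s (ltW s0) 1 t.
  by rewrite !nnegrE powR1 ler01 (ltW t0); apply => //; exact: ltW.
- by rewrite ler_expR lerN2.
Qed.

Lemma frac_const_gt0 n (alpha : R) : 0 < alpha -> alpha < 1 -> 0 < frac_const n alpha.
Proof.
move=> a0 a1; rewrite divr_gt0 ?Gamma_gt0 ?divr_gt0 ?subr_gt0 //.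
rewrite !mulr_gt0 ?powR_gt0 ?pi_gt0 ?Gamma_gt0 ?divr_gt0 //.
by rewrite ltr_wpDl // addr_ge0 // ltW.
Qed.

End gamma.

Theorem theorem4p4 (R : realType) (n : nat) (alpha : R)
    (alpha0 : 0 < alpha) (alpha1 : alpha < 1) (n2 : (2 <= n)%N) :
  exists c : R, 0 < c /\
    forall E : set (lebesgue_space R n), measurable E ->
      (leb E < +oo)%E -> (frac_perimeter alpha E < +oo)%E ->
      (poweR (leb E) ((n%:R - alpha) / n%:R) <= c%:E * frac_perimeter alpha E)%E.
Proof.
have [c [c0 cP]] := frac_isoperimetric alpha0 alpha1 (ltnW n2) (frac_const_gt0 n alpha0 alpha1).
by exists c; split => // E mE Eoo _; exact: cP.
Qed.
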